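(* The Enriques surface $S=Y/\jmath$ described in the context contains an $A_3+3A_2$ configuration of smooth rational curves, i.e. nine smooth rational curves whose dual intersection graph is the disjoint union of one Dynkin diagram of type $A_3$ and three Dynkin diagrams of type $A_2$.
   Context: The base field is $\mathbb C$. Let $X_{3,3,3,3}\to\mathbb P^1$ be the rational elliptic surface given by the Hesse pencil $x^3+y^3+z^3+3\lambda xyz=0$, with zero section one of the base points; its singular fibres are four fibres of type $I_3$, located at $\lambda=\infty$ and at the cube roots of $-1$. Let $Y$ be the K3 surface with Picard number $20$ and transcendental lattice $$T(Y)=\begin{pmatrix}6&3\\3&12\end{pmatrix}.$$ $Y$ arises from $X_{3,3,3,3}$ by pull-back via a quadratic base change $\mathbb P^1\to\mathbb P^1$ ramified at $\lambda=\infty$ and at a second point $\lambda_0$ (one can take $\lambda_0=5/4$); let $\imath$ be the involution on $Y$ induced by the deck transformation of the base change, so that $Y/\imath$ is (birationally) $X_{3,3,3,3}$. Let $X'_{3,3,3,3}$ be the quadratic twist of $X_{3,3,3,3}$ ramified at the two points $\infty,\lambda_0$; it has singular fibres $I_3^*$ (at $\infty$), $I_0^*$ (at $\lambda_0$) and three $I_3$, and the same quadratic base change applied to it also yields $Y$. On $X'_{3,3,3,3}$ there is a section $Q'$ of height $7/12$ which is disjoint from the zero section and meets non-identity components exactly at the $I_3^*$ fibre (a far simple component), at one of the $I_3$ fibres, and at the $I_0^*$ fibre. Let $Q$ be the section of $Y$ induced from $Q'$ by pull-back; it is disjoint from the zero section $O$ and anti-invariant under $\imath^*$. Then $\jmath=(\text{fibrewise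 translation by }Q)\circ\imath$ is a fixed-point-free involution on $Y$, and $S=Y/\jmath$ is an Enriques surface. *)

(* Defs.v *)
From HB Require Import structures.
From mathcomp Require Import all_boot all_order all_algebra.
From mathcomp Require Import boolp classical_sets reals.
From mathcomp Require Import complex.
From mathcomp Require mpoly.

Set Implicit Arguments.
Unset Strict Implicit.
Unset Printing Implicit Defensive.

Import GRing.Theory.
Local Open Scope classical_set_scope.
Local Open Scope ring_scope.

(** * Varieties as spaces with functions

   A classical variety over an algebraically closed field K is its set of
   closed points, with the Zariski topology and the sheaf of K-valued regular
   functions.  [reg U f] says that the restriction of [f] to the open set [U]
   is regular; the values of [f] outside [U] are irrelevant. *)

Record fspace (K : fieldType) := FSpace {
  pt :> Type;
  opn : set (set pt);
  reg : set pt -> (pt -> K) -> Prop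
}.

Section Spaces.
Variable K : fieldType.
Implicit Types X Y : fspace K.

Definition peval n (p : mpoly.mpoly n K) (x : 'rV[K]_n) : K :=
  mpoly.meval (x 0) p.

Definition zariski_open n (U : set 'rV[K]_n) : Prop :=
  forall x, U x -> exists q : mpoly.mpoly n K,
    peval q x != 0 /\ forall y, peval q y != 0 -> U y.

Definition aff n : fspace K := @FSpace K 'rV[K]_n (@zariski_open n)
  (fun U f => zariski_open U /\
     forall x, U x -> exists p q : mpoly.mpoly n K,
       peval q x != 0 /\
       forall y, U y -> peval q y != 0 -> f y = peval p y / peval q y).

(* Induced structure on a (locally closed) subset: regular functions are
   locally restrictions of regular functions of the ambient space. *)
Definition sub_open X (A : set X) (U : set {x : X | A x}) : Prop :=
  exists2 V, opn V & forall x, U x <-> V (sval x).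

Definition subspace X (A : set X) : fspace K :=
  @FSpace K {x : X | A x} (@sub_open X A)
    (fun U f => sub_open U /\
       forall x, U x -> exists V g,
         [/\ opn V, V (sval x), reg V g &
             forall y : {x : X | A x}, U y -> V (sval y) -> f y = g (sval y)]).

(* Quotient by the relation whose classes are the sets [cls x]: the quotient
   topology, and the functions whose pull-back is regular. *)
Definition quot_pi X (cls : X -> set X) (x : X) :
    {S : set X | exists x, S = cls x} :=
  exist _ (cls x) (ex_intro _ x erefl).

Definition quot_open X (cls : X -> set X)
    (U : set {S : set X | exists x, S = cls x}) : Prop :=
  opn (quot_pi cls @^-1` U).

Definition quot X (cls : X -> set X) : fspace K :=
  @FSpace K {S : set X | exists x, S = cls x} (@quot_open X cls)
    (fun U f => reg (quot_pi cls @^-1` U) (f \o quot_pi cls)).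

Definition morphism X Y (phi : X -> Y) : Prop :=
  (forall V, opn V -> opn (phi @^-1` V)) /\
  (forall V f, reg V f -> reg (phi @^-1` V) (f \o phi)).

Definition isomorphic X Y : Prop := exists (phi : X -> Y) (psi : Y -> X),
  [/\ morphism phi, morphism psi, cancel phi psi & cancel psi phi].

(* [cone_space D r] is the quotient of the locally closed subset D of K^n by
   the torus action with orbit relation r; [coords p w] says that w is a vector
   of (multi)homogeneous coordinates of the point p. *)
Definition cone_space n (D : set 'rV[K]_n) (r : 'rV[K]_n -> 'rV[K]_n -> Prop) :
    fspace K :=
  @quot (@subspace (aff n) D) (fun v => [set w | r (sval v) (sval w)]).

Definition coords n (D : set 'rV[K]_n) r (p : cone_space D r)
    (w : 'rV[K]_n) : Prop :=
  exists v : subspace (X := aff n) D, p = quot_pi _ v /\ sval v = w.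

Definition proj_space n : fspace K :=
  @cone_space n.+1 [set w | w != 0]
    (fun v w => exists2 c : K, c != 0 & w = c *: v).

(** * Configurations of smooth rational curves *)

Definition closed_in X (A : set X) : Prop := opn (~` A).

Definition smooth_rational_curve X (A : set X) : Prop :=
  closed_in A /\ isomorphic (subspace A) (proj_space 1).

(* The ideals of A and B generate the maximal ideal of the local ring at p,
   i.e. O_p / (I_A + I_B) has length one. *)
Definition transversal_at X (A B : set X) (p : X) : Prop :=
  forall U f, opn U -> U p -> reg U f -> f p = 0 ->
  exists V g h,
    [/\ opn V, V p, V `<=` U, reg V g & reg V h] /\
    [/\ (forall x, V x -> A x -> g x = 0),
        (forall x, V x -> B x -> h x = 0) &
        (forall x, V x -> f x = g x + h x)].

(* Intersection number one, for two distinct curves. *)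
Definition meet_once X (A B : set X) : Prop :=
  exists p, A `&` B = [set p] /\ transversal_at A B p.

(* C is a family of smooth rational curves with dual graph (I, e); for the
   simple graph e below all intersection numbers are 0 or 1. *)
Definition rational_configuration X (I : eqType) (e : rel I)
    (C : I -> set X) : Prop :=
  (forall i, smooth_rational_curve (C i)) /\
  (forall i j, i != j ->
     if e i j then meet_once (C i) (C j) else C i `&` C j = set0).

End Spaces.

Arguments morphism {K X Y} phi.
Arguments coords {K n D r} p w.

Definition dynkinA n : rel 'I_n := fun i j => (i.+1 == j) || (j.+1 == i).

(* The disjoint union A_3 + 3 A_2. *)
Definition A3_3A2 : rel ('I_3 + 'I_3 * 'I_2)%type := fun u v =>
  match u, v with
  | inl i, inl j => dynkinA i j
  | inr (k, i), inr (l, j) => (k == l) && dynkinA i j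
  | _, _ => false
  end.

(** * The Hesse pencil and its base change *)

Section Hesse.
Variable K : fieldType.
Implicit Types (a p q o : 'rV[K]_3) (b : 'rV[K]_2) (m l lam : K).

(* The member lambda = l / m of the pencil. *)
Definition hesse m l a : K :=
  m * (\sum_(k < 3) a 0 k ^+ 3) + 3%:R * l * (\prod_(k < 3) a 0 k).

Definition base_point a : Prop :=
  [/\ a != 0, \sum_(k < 3) a 0 k ^+ 3 = 0 & \prod_(k < 3) a 0 k = 0].

(* The quadratic base change [s : t] |-> (m : l) = (s^2 : lam s^2 + t^2),
   i.e. lambda = lam + (t / s)^2, ramified at lambda = oo and lambda = lam,
   and its deck transformation. *)
Definition bc_m b : K := b 0 0 ^+ 2.
Definition bc_l lam b : K := lam * b 0 0 ^+ 2 + b 0 1 ^+ 2.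
Definition deck b : 'rV[K]_2 := \row_k (if k == 0 then b 0 0 else - b 0 1).

Definition bc_fibre lam b a : K := hesse (bc_m b) (bc_l lam b) a.

Definition smooth_fibre lam b : Prop :=
  bc_m b != 0 /\ bc_m b ^+ 3 + bc_l lam b ^+ 3 != 0.

(** The surface Y.  The fibre product { (a, b) | bc_fibre lam b a = 0 } in
   P^2 x P^1 is smooth except for three ordinary double points, at the nodes of
   the I_3 fibre over s = 0, i.e. where s = xy = yz = zx = 0.  Y is the blow-up
   at these three points, which is the minimal resolution: the smooth,
   relatively minimal elliptic surface with fibres I_6 (over s = 0) and 6 I_3.
   For lam = 5/4 it is the K3 surface with transcendental lattice
   (6 3; 3 12).
   The blow-up is the closure in P^2 x P^1 x P^5 of the graph of the rational
   map (s x^2 : s y^2 : s z^2 : t yz : t zx : t xy), whose components generate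
   the ideal of the three (reduced) points. *)

Definition crd2 (w : 'rV[K]_(3 + 2 + (3 + 3))) : 'rV[K]_3 := lsubmx (lsubmx w).
Definition crd1 (w : 'rV[K]_(3 + 2 + (3 + 3))) : 'rV[K]_2 := rsubmx (lsubmx w).
Definition crd5 (w : 'rV[K]_(3 + 2 + (3 + 3))) : 'rV[K]_(3 + 3) := rsubmx w.

Definition node_gens a b : 'rV[K]_(3 + 3) :=
  row_mx (\row_k (b 0 0 * a 0 k ^+ 2))
         (\row_k (b 0 1 * \prod_(i < 3 | i != k) a 0 i)).

Definition graph_cone lam : set 'rV[K]_(3 + 2 + (3 + 3)) :=
  [set w | [/\ crd2 w != 0, crd1 w != 0, crd5 w != 0,
               bc_fibre lam (crd1 w) (crd2 w) = 0 &
               exists c : K, crd5 w = c *: node_gens (crd2 w) (crd1 w)]].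

Definition zariski_closure n (A : set 'rV[K]_n) : set 'rV[K]_n :=
  [set w | forall f : mpoly.mpoly n K,
     (forall v, A v -> peval f v = 0) -> peval f w = 0].

Definition Y_cone lam : set 'rV[K]_(3 + 2 + (3 + 3)) :=
  [set w | [/\ crd2 w != 0, crd1 w != 0, crd5 w != 0 &
               zariski_closure (graph_cone lam) w]].

Definition surfY lam : fspace K :=
  cone_space (Y_cone lam) (fun v w => exists c2 c1 c5 : K,
    [/\ c2 != 0, c1 != 0, c5 != 0 &
        [/\ crd2 w = c2 *: crd2 v, crd1 w = c1 *: crd1 v
          & crd5 w = c5 *: crd5 v]]).

(* y lies over the point (a, b) of P^2 x P^1. *)
Definition lies_over lam (y : surfY lam) a b : Prop :=
  exists w, [/\ coords y w, crd2 w = a & crd1 w = b].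

(** The group law of a smooth plane cubic F = 0 with origin o.
   [collinear_triple F p q r]: some line cuts out the divisor p + q + r. *)
Definition collinear_triple (F : 'rV[K]_3 -> K) (p q r : 'rV[K]_3) : Prop :=
  exists n m1 m2 m3 : 'cV[K]_3,
    [/\ n != 0, p *m n = 0, q *m n = 0 & r *m n = 0] /\
    [/\ p *m m1 = 0, q *m m2 = 0, r *m m3 = 0 &
        forall x : 'rV[K]_3, x *m n = 0 ->
          F x = (x *m m1) 0 0 * (x *m m2) 0 0 * (x *m m3) 0 0].

(* r = p + q *)
Definition cubic_add (F : 'rV[K]_3 -> K) o p q r : Prop :=
  exists s : 'rV[K]_3,
    [/\ s != 0, collinear_triple F p q s & collinear_triple F s o r].

Definition is_section lam (Q : proj_space K 1 -> surfY lam) : Prop :=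
  morphism Q /\
  forall v b, coords v b -> exists a, lies_over (Q v) a b.

(* The zero section given by the base point o. *)
Definition zero_section lam o : set (surfY lam) :=
  [set y | exists b, lies_over y o b].

(* Q(-v) = - Q(v) on the smooth fibres, hence everywhere. *)
Definition anti_invariant lam o (Q : proj_space K 1 -> surfY lam) : Prop :=
  forall v v' b q q', smooth_fibre lam b ->
    coords v b -> coords v' (deck b) ->
    lies_over (Q v) q b -> lies_over (Q v') q' (deck b) ->
    cubic_add (bc_fibre lam b) o q q' o.

(* The points o and q of the triangle of lines F = 0 lie on a common line
   contained in it. *)
Definition same_line (F : 'rV[K]_3 -> K) o q : Prop :=
  exists n : 'cV[K]_3, [/\ n != 0, o *m n = 0, q *m n = 0 &
    forall x : 'rV[K]_3, x *m n = 0 -> F x = 0].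

(** The section Q induced by the section Q' of the quadratic twist X'.
   Sections of X' correspond to anti-invariant sections of Y.  The I_3* fibre
   of X' arises from the I_6 fibre of Y modulo (-1) o (deck), which fixes the
   component Theta_0 met by o and the opposite one Theta_3; the two far simple
   components of I_3* come from Theta_3.  With o on the line x_k = 0, Theta_3
   is the exceptional curve over the node e_k.  The component of the I_0* fibre
   is non-identity because Q and O are disjoint.  The height 4 - 7/4 - 2/3 - 1 =
   7/12 of Q' is a consequence of the conditions below.  For lam = 5/4 and
   o = (0 : 1 : -1) an example over t / s = (sqrt 3 / 2) u is
   Q = (1 + 3 u^2 : 2 u - 2 : - 2 u - 2), with mu = -1. *)
Definition twist_section lam o (Q : proj_space K 1 -> surfY lam) : Prop :=
  [/\ is_section Q,
      anti_invariant o Q,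
      (forall v, ~ zero_section o (Q v)),
      (exists k : 'I_3, o 0 k = 0 /\
         forall v, coords v (delta_mx 0 1) ->
           lies_over (Q v) (delta_mx 0 k) (delta_mx 0 1))
    & (exists mu : K, mu ^+ 3 = -1 /\
         forall v b q, coords v b -> bc_m b != 0 ->
           (bc_l lam b / bc_m b) ^+ 3 = -1 -> lies_over (Q v) q b ->
           (~ same_line (bc_fibre lam b) o q <-> bc_l lam b / bc_m b = mu))].

(* j is (translation by Q) o (deck transformation); a morphism of Y is
   determined by its restriction to the smooth fibres. *)
Definition translation_deck lam o (Q : proj_space K 1 -> surfY lam)
    (j : surfY lam -> surfY lam) : Prop :=
  morphism j /\
  forall y v a b q, smooth_fibre lam b -> lies_over y a b ->
    coords v (deck b) -> lies_over (Q v) q (deck b) ->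
    exists2 a', lies_over (j y) a' (deck b) &
                cubic_add (bc_fibre lam (deck b)) o a q a'.

(* The quotient by an involution. *)
Definition involution_quotient (X : fspace K) (j : X -> X) : fspace K :=
  quot (fun y : X => [set y; j y]).

End Hesse.

(* Main.v *)
(* The quotient map Y -> S is etale of degree two, so smooth rational curves on Y
   disjoint from their image under the involution j, together with their simple
   intersections, descend to S.  The induced elliptic fibration on S has
   three fibres I_3 (each the isomorphic image of a fibre of Y) and a half-fibre
   I_3 below the fibre I_6 at s = 0.  The zero section O is mapped by j to Q, so
   its image N on S meets a component of an I_3 fibre once for O and once for Q,
   and it meets one component of the half-fibre.
   - In the I_3 fibre where O and Q meet different components, N, the component
     met by O and the component met by neither form an A_3.
   - In each of the other two I_3 fibres, the two components not met by N form an
     A_2, and so do the two components of the half-fibre not met by N.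

   That j is an involution, maps O to Q and acts on the I_6 fibre as the rotation
   by three follows from identities on the smooth fibres, which are dense: for a
   base point T, the map q -> -q with respect to T is a linear involution of P^2
   preserving every cubic of the pencil, so the translations by base points are
   linear, and the images of the torsion sections determine how j permutes the
   components of the I_6 fibre. *)
Require Import Defs.
From mathcomp Require Import all_boot all_order all_algebra.
From mathcomp Require Import boolp classical_sets reals.
From mathcomp Require Import complex.
From mathcomp Require mpoly.
From mathcomp Require Import ring.

Set Implicit Arguments.
Unset Strict Implicit.
Unset Printing Implicit Defensive.

Import GRing.Theory Num.Theory.
Local Open Scope classical_set_scope.
Local Open Scope ring_scope.

(** * Polynomial functions *)

Section PolynomialFunctions.
Import mpoly.
Variable K : fieldType.

(** The map [j] is given by a formula only on the smooth fibres, and [S] only as a space with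
    functions. Two devices make up for this. Descent is done by averaging: a function [F] regular
    near [p] is replaced by (r F + (r F) o j) / (r + r o j), where the weight [r] vanishes on the
    other sheet of the curve; this needs one chart containing both [p] and [j p]. On the singular
    fibres [j] is controlled by density (identities of morphisms extend from the smooth fibres) and
    by irreducibility (a rational curve covered by finitely many components lies in one of them).
    Irreducibility asks only for a surjection from P^1, so the exceptional curves of the hexagon are
    treated merely as images of P^1: on [S] each has the same image as the opposite line, whose
    smoothness is proved. Transversality is certified by a retraction onto one curve that contracts
    the other. The value 5/4 enters through lam^3 != -1, which makes the two fibres of Y above an
    I_3 member distinct. *)

Definition polyfun n (f : 'rV[K]_n -> K) : Prop := exists p, f = peval p.

Section Closure.
Variable n : nat.
Implicit Types f g : 'rV[K]_n -> K.

Lemma polyfun_cst c : polyfun (fun _ : 'rV[K]_n => c).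
Proof.
by exists (mpoly.mpolyC n c); apply/funext => x; rewrite /peval mpoly.mevalC.
Qed.

Lemma polyfun_coord i : polyfun (fun x : 'rV[K]_n => x 0 i).
Proof.
exists (mpoly.mpolyX K (mpoly.mnm1 i)); apply/funext => x.
by rewrite /peval mpoly.mevalXU.
Qed.

Lemma polyfunD f g : polyfun f -> polyfun g -> polyfun (fun x => f x + g x).
Proof.
move=> [p ->] [q ->]; exists (p + q); apply/funext => x.
by rewrite /peval mpoly.mevalD.
Qed.

Lemma polyfunM f g : polyfun f -> polyfun g -> polyfun (fun x => f x * g x).
Proof.
move=> [p ->] [q ->]; exists (p * q); apply/funext => x.
by rewrite /peval mpoly.mevalM.
Qed.

Lemma polyfunN f : polyfun f -> polyfun (fun x => - f x).
Proof.
by move=> [p ->]; exists (- p); apply/funext => x; rewrite /peval mpoly.mevalN.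
Qed.

Lemma polyfunB f g : polyfun f -> polyfun g -> polyfun (fun x => f x - g x).
Proof. by move=> pf pg; apply: polyfunD => //; apply: polyfunN. Qed.

Lemma polyfunX f k : polyfun f -> polyfun (fun x => f x ^+ k).
Proof.
move=> [p ->]; exists (p ^+ k); apply/funext => x.
by rewrite /peval rmorphXn.
Qed.

Lemma polyfun_sum (I : Type) (r : seq I) (P : pred I) (F : I -> 'rV[K]_n -> K) :
  (forall i, polyfun (F i)) -> polyfun (fun x => \sum_(i <- r | P i) F i x).
Proof.
move=> /boolp.choice[p pE]; exists (\sum_(i <- r | P i) p i).
apply/funext => x; rewrite /peval raddf_sum; apply: eq_bigr => i _.
by rewrite pE.
Qed.

Lemma polyfun_prod (I : Type) (r : seq I) (P : pred I)
    (F : I -> 'rV[K]_n -> K) :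
  (forall i, polyfun (F i)) -> polyfun (fun x => \prod_(i <- r | P i) F i x).
Proof.
move=> /boolp.choice[p pE]; exists (\prod_(i <- r | P i) p i).
apply/funext => x; rewrite /peval rmorph_prod; apply: eq_bigr => i _.
by rewrite pE.
Qed.

(** The monomial expansion of [p] is built from constants, coordinates, sums and products; later
    facts about all polynomial functions are proved on these four cases. *)
Lemma polyfun_ind (P : ('rV[K]_n -> K) -> Prop) :
  (forall c, P (fun=> c)) -> (forall i, P (fun x => x 0 i)) ->
  (forall f g, P f -> P g -> P (fun x => f x + g x)) ->
  (forall f g, P f -> P g -> P (fun x => f x * g x)) ->
  forall f, polyfun f -> P f.
Proof.
move=> Pc Px PD PM _ [p ->].
have Pprod (m : mpoly.multinom n) (r : seq 'I_n) :
    P (fun x => \prod_(i <- r) x 0 i ^+ mpoly.fun_of_multinom m i).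
  elim: r => [|i r IH].
    by under eq_fun do rewrite big_nil; exact: Pc.
  under eq_fun do rewrite big_cons.
  apply: (PM) => //; elim: (mpoly.fun_of_multinom m i) => [|k IHk].
    by under eq_fun do rewrite expr0; exact: Pc.
  by under eq_fun do rewrite exprS; exact: (PM).
have -> : peval p = fun x => \sum_(m <- mpoly.msupp p)
    mpoly.mcoeff m p * \prod_i x 0 i ^+ mpoly.fun_of_multinom m i.
  by apply/funext => x; rewrite /peval mpoly.mevalE.
elim: (mpoly.msupp p : seq _) => [|m r IH].
  by under eq_fun do rewrite big_nil; exact: Pc.
under eq_fun do rewrite big_cons.
by apply: (PD) => //; apply: (PM).
Qed.

End Closure.

Definition polymap n m (F : 'rV[K]_n -> 'rV[K]_m) : Prop :=
  forall i, polyfun (fun x => F x 0 i).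

Lemma polyfun_comp n m (F : 'rV[K]_n -> 'rV[K]_m) f :
  polymap F -> polyfun f -> polyfun (f \o F).
Proof.
move=> pF; move: f.
apply: (@polyfun_ind m (fun f => polyfun (f \o F))) => //.
- by move=> c; exact: polyfun_cst.
- by move=> f g pf pg; exact: polyfunD.
- by move=> f g pf pg; exact: polyfunM.
Qed.

Lemma polymap_comp n m k (F : 'rV[K]_n -> 'rV[K]_m) (G : 'rV[K]_m -> 'rV[K]_k) :
  polymap F -> polymap G -> polymap (G \o F).
Proof. by move=> pF pG i; exact: (polyfun_comp pF (pG i)). Qed.

Lemma polymap_mulmx n m (M : 'M[K]_(n, m)) : polymap (fun x => x *m M).
Proof.
move=> i; under eq_fun do rewrite mxE.
by apply: polyfun_sum => k; apply: polyfunM;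
  [exact: polyfun_coord | exact: polyfun_cst].
Qed.

Lemma polymap_row_mx n m1 m2 (F : 'rV[K]_n -> 'rV[K]_m1)
    (G : 'rV[K]_n -> 'rV[K]_m2) :
  polymap F -> polymap G -> polymap (fun x => row_mx (F x) (G x)).
Proof.
move=> pF pG i; case: (split_ordP i) => k ->.
  by under eq_fun do rewrite row_mxEl; exact: pF.
by under eq_fun do rewrite row_mxEr; exact: pG.
Qed.

Lemma polymap_cst n m (c : 'rV[K]_m) : polymap (fun _ : 'rV[K]_n => c).
Proof. by move=> i; exact: polyfun_cst. Qed.

Lemma polymap_id n : polymap (fun x : 'rV[K]_n => x).
Proof. by move=> i; exact: polyfun_coord. Qed.

Lemma polymapZ n m (c : 'rV[K]_n -> K) (F : 'rV[K]_n -> 'rV[K]_m) :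
  polyfun c -> polymap F -> polymap (fun x => c x *: F x).
Proof. by move=> pc pF i; under eq_fun do rewrite mxE; exact: polyfunM. Qed.

Lemma zariski_open_neq0 n (f : 'rV[K]_n -> K) :
  polyfun f -> zariski_open [set x | f x != 0].
Proof. by move=> [p ->] x fx; exists p. Qed.

Lemma zariski_openP n (U : set 'rV[K]_n) : zariski_open U <->
  forall x, U x -> exists q, [/\ polyfun q, q x != 0 & forall y, q y != 0 -> U y].
Proof.
split=> oU x Ux.
  have [q [qx qU]] := oU x Ux; exists (peval q); split => //.
  by exists q.
by have [_ [[q ->] qx qU]] := oU x Ux; exists q.
Qed.

End PolynomialFunctions.

(** * Spaces with functions *)

Section GoodSpaces.
Variable K : fieldType.
Implicit Types X Y Z : fspace K.

(** [fspace] is bare data; these are the topology and sheaf axioms used below. [open_local] stands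
    for arbitrary unions (the empty one included), [reg_local] is the sheaf condition, and
    [open_neq0] makes zero loci closed. *)
Record good X : Prop := Good {
  open_setT : @opn K X setT;
  open_setI : forall U V : set X, opn U -> opn V -> opn (U `&` V);
  open_local : forall U : set X,
    (forall x, U x -> exists2 V, opn V & V x /\ V `<=` U) -> opn U;
  reg_open : forall (U : set X) f, reg U f -> opn U;
  reg_local : forall (U : set X) f, opn U ->
    (forall x, U x -> exists V g,
       [/\ opn V, V x, reg V g & forall y, U y -> V y -> f y = g y]) -> reg U f;
  reg_cst : forall (U : set X) c, opn U -> reg U (fun=> c);
  regD : forall (U : set X) f g,
    reg U f -> reg U g -> reg U (fun x => f x + g x);
  regM : forall (U : set X) f g,
    reg U f -> reg U g -> reg U (fun x => f x * g x);
  regV : forall (U : set X) f,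
    reg U f -> (forall x, U x -> f x != 0) -> reg U (fun x => (f x)^-1);
  open_neq0 : forall (U : set X) f,
    reg U f -> opn [set x | U x /\ f x != 0]
}.

Section Theory.
Variables (X : fspace K) (gX : good X).
Implicit Types (U V : set X) (f g : X -> K).

Lemma reg_sub U V f : opn V -> V `<=` U -> reg U f -> reg V f.
Proof.
move=> oV VU rf; apply: (reg_local gX) => // x Vx.
by exists U, f; split => //; [exact: reg_open rf | exact: VU].
Qed.

Lemma eq_reg U f g : (forall x, U x -> f x = g x) -> reg U f -> reg U g.
Proof.
move=> fg rf; have oU := reg_open gX rf.
by apply: (reg_local gX) => // x Ux; exists U, f; split => // y Uy _; rewrite fg.
Qed.

Lemma regN U f : reg U f -> reg U (fun x => - f x).
Proof.
move=> rf; have rc : reg U (fun=> -1 : K) := reg_cst gX _ (reg_open gX rf).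
by apply: eq_reg (regM gX rc rf) => x _; rewrite mulN1r.
Qed.

Lemma regB U f g : reg U f -> reg U g -> reg U (fun x => f x - g x).
Proof. by move=> rf rg; apply: (regD gX) => //; exact: regN. Qed.

Lemma open_setU U V : opn U -> opn V -> opn (U `|` V).
Proof.
move=> oU oV; apply: (open_local gX) => x [] h; by [exists U|exists V].
Qed.

Lemma closed_setI U V : closed_in U -> closed_in V -> closed_in (U `&` V).
Proof. by rewrite /closed_in setCI; exact: open_setU. Qed.

Lemma closed_setU U V : closed_in U -> closed_in V -> closed_in (U `|` V).
Proof. by rewrite /closed_in setCU; exact: (open_setI gX). Qed.

End Theory.

Lemma zariski_openI n (U V : set 'rV[K]_n) :
  zariski_open U -> zariski_open V -> zariski_open (U `&` V).
Proof.
move=> /zariski_openP oU /zariski_openP oV; apply/zariski_openP => x [Ux Vx].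
have [q [pq qx qU]] := oU x Ux; have [r [pr rx rV]] := oV x Vx.
exists (fun x => q x * r x); split; [exact: polyfunM | by rewrite mulf_neq0 |].
move=> y; rewrite mulf_eq0 negb_or => /andP[qy ry].
by split; [exact: qU | exact: rV].
Qed.

Lemma reg_affP n (U : set (aff K n)) f : reg U f <-> zariski_open U /\
  forall x, U x -> exists p q, [/\ polyfun p, polyfun q, q x != 0 &
    forall y, U y -> q y != 0 -> f y = p y / q y].
Proof.
split=> -[oU rf]; split=> // x Ux.
  by have [p [q [qx h]]] := rf x Ux; exists (peval p), (peval q); split => //;
    [exists p | exists q].
by have [_ [_ [[p ->] [q ->] qx h]]] := rf x Ux; exists p, q.
Qed.

Lemma good_aff n : good (aff K n).
Proof.
split.
- by apply/zariski_openP => x _; exists (fun=> 1); split => //;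
    [exact: polyfun_cst | exact: oner_neq0].
- exact: zariski_openI.
- move=> U hU; apply/zariski_openP => x /hU[V /zariski_openP oV [Vx VU]].
  have [q [pq qx qV]] := oV x Vx; exists q; split => // y /qV; exact: VU.
- by move=> U f [].
- move=> U f oU hf; apply/reg_affP; split => // x Ux.
  have [V [g [/zariski_openP oV Vx /reg_affP[_ rg] fg]]] := hf x Ux.
  have [q [pq qx qV]] := oV x Vx; have [p [r [pp pr rx gE]]] := rg x Vx.
  (* The common factor [q] confines the fraction [p / r] to the open set on which [g] agrees with
     [f]. *)
  exists (fun x => q x * p x), (fun x => q x * r x).
  split; [exact: polyfunM| exact: polyfunM| by rewrite mulf_neq0|].
  move=> y Uy; rewrite mulf_eq0 negb_or => /andP[qy ry].
  by rewrite fg ?gE //; [rewrite -mulf_div divff // mul1r|exact: qV|exact: qV].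
- move=> U c oU; apply/reg_affP; split => // x Ux.
  exists (fun=> c), (fun=> 1); split; try exact: polyfun_cst.
    exact: oner_neq0.
  by move=> y _ _; rewrite divr1.
- move=> U f g /reg_affP[oU rf] /reg_affP[_ rg]; apply/reg_affP.
  split => // x Ux; have [p [q [pp pq qx fE]]] := rf x Ux.
  have [r [s [pr ps sx gE]]] := rg x Ux.
  exists (fun x => p x * s x + r x * q x), (fun x => q x * s x).
  split; [by apply: polyfunD; exact: polyfunM|exact: polyfunM|
          by rewrite mulf_neq0|].
  move=> y Uy; rewrite mulf_eq0 negb_or => /andP[qy sy].
  by rewrite fE // gE // addf_div.
- move=> U f g /reg_affP[oU rf] /reg_affP[_ rg]; apply/reg_affP.
  split => // x Ux; have [p [q [pp pq qx fE]]] := rf x Ux.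
  have [r [s [pr ps sx gE]]] := rg x Ux.
  exists (fun x => p x * r x), (fun x => q x * s x).
  split; [exact: polyfunM|exact: polyfunM|by rewrite mulf_neq0|].
  move=> y Uy; rewrite mulf_eq0 negb_or => /andP[qy sy].
  by rewrite fE // gE // mulf_div.
- move=> U f /reg_affP[oU rf] f0; apply/reg_affP.
  split => // x Ux; have [p [q [pp pq qx fE]]] := rf x Ux.
  have px : p x != 0.
    apply: contra_neq (f0 x Ux); rewrite fE // => ->; exact: mul0r.
  exists (fun x => q x * q x), (fun x => p x * q x); split => //;
    try exact: polyfunM; first by rewrite mulf_neq0.
  move=> y Uy; rewrite mulf_eq0 negb_or => /andP[py qy].
  by rewrite fE // -mulf_div divff // mulr1 invf_div.
- move=> U f /reg_affP[/zariski_openP oU rf]; apply/zariski_openP => x [Ux fx].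
  have [p [q [pp pq qx fE]]] := rf x Ux; have [r [pr rx rU]] := oU x Ux.
  have px : p x != 0.
    apply: contra_neq fx; rewrite fE // => ->; exact: mul0r.
  exists (fun x => p x * (q x * r x)); split.
  + by apply: polyfunM => //; exact: polyfunM.
  + by rewrite !mulf_neq0.
  + move=> y; rewrite !mulf_eq0 !negb_or => /andP[py /andP[qy ry]].
    have Uy := rU y ry; split => //.
    by rewrite fE // mulf_neq0 // invr_neq0.
Qed.

Lemma good_subspace X (A : set X) : good X -> good (subspace A).
Proof.
move=> gX.
have oT : @opn K (subspace A) setT.
  by exists setT => //; exact: open_setT.
have oI : forall U V : set (subspace A), opn U -> opn V -> opn (U `&` V).
  move=> U V [U' oU' UE] [V' oV' VE]; exists (U' `&` V').
    exact: open_setI.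
  by move=> x; split=> -[] /UE ? /VE ?; split.
have regop (op : K -> K -> K) :
    (forall (V : set X) f g, reg V f -> reg V g -> reg V (fun x => op (f x) (g x))) ->
    forall (U : set (subspace A)) f g, reg U f -> reg U g ->
      reg U (fun x => op (f x) (g x)).
  move=> hop U f g [oU rf] [_ rg]; split => // x Ux.
  have [V [f2 [oV Vx rf2 fE]]] := rf x Ux.
  have [W [g2 [oW Wx rg2 gE]]] := rg x Ux.
  exists (V `&` W), (fun x => op (f2 x) (g2 x)); split => //.
  + exact: open_setI.
  + by apply: hop; [apply: (reg_sub gX) rf2 | apply: (reg_sub gX) rg2];
      try (exact: open_setI); move=> ? [].
  + by move=> y Uy [Vy Wy]; rewrite fE // gE.
split => //.
- move=> U hU; exists [set x | exists2 V, opn V & V x /\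
      forall y : subspace A, V (sval y) -> U y].
    apply: (open_local gX) => x [V oV [Vx VU]]; exists V => //.
    by split => // y Vy; exists V.
  move=> x; split => [/hU[V' [W oW VE] [/VE Wx VU]]|[V oV [Vx]]].
    by exists W => //; split => // y /VE; exact: VU.
  by apply.
- by move=> U f [].
- move=> U f oU hf; split => // x /[dup] Ux /hf.
  move=> [V [g [oV Vx [_ rg] fg]]].
  have [V2 [g2 [oV2 V2x rg2 g2E]]] := rg x Vx.
  have [W oW WE] := oV; exists (V2 `&` W), g2; split.
  + exact: open_setI.
  + by split => //; apply/WE.
  + apply: (reg_sub gX) rg2; [exact: open_setI | by move=> ? []].
  + by move=> y Uy [V2y /WE Vy]; rewrite fg // g2E.
- move=> U c oU; split => // x Ux; exists setT, (fun=> c); split => //.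
  + exact: open_setT.
  + by apply: (reg_cst gX); exact: open_setT.
- by move=> U f g; apply: regop => V f2 g2; exact: (regD gX).
- by move=> U f g; apply: regop => V f2 g2; exact: (regM gX).
- move=> U f [oU rf] f0; split => // x Ux.
  have [V [f2 [oV Vx rf2 fE]]] := rf x Ux.
  have oW := open_neq0 gX rf2.
  exists [set x | V x /\ f2 x != 0], (fun x => (f2 x)^-1); split => //.
  + by split => //; rewrite -fE // f0.
  + apply: (regV gX); last by move=> ? [].
    by apply: (reg_sub gX) rf2 => // ? [].
  + by move=> y Uy [Vy Wy]; rewrite fE.
(* One ambient open set has to serve all points, so it collects the non-vanishing loci of all local
   ambient extensions of [f], cut down to [W]. *)
- move=> U f [[W oW WE] rf]; exists [set x | exists V f2, [/\ reg V f2, V x,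
     W x, f2 x != 0 & forall y : subspace A, U y -> V (sval y) ->
       f y = f2 (sval y)]].
    apply: (open_local gX) => x [V [f2 [rf2 Vx Wx f2x fE]]].
    have oN := open_neq0 gX rf2.
    exists ([set x | V x /\ f2 x != 0] `&` W); first exact: open_setI.
    by split => // y [[Vy f2y] Wy]; exists V, f2.
  move=> x; split => [[Ux fx]|[V [f2 [rf2 Vx Wx f2x fE]]]].
    have [V [f2 [oV Vx rf2 fE]]] := rf x Ux.
    by exists V, f2; split => //; [apply/WE | rewrite -fE].
  by have Ux : U x := (WE x).2 Wx; split => //; rewrite fE.
Qed.

Lemma good_quot X (cls : X -> set X) : good X -> good (quot cls).
Proof.
move=> gX; split.
- exact: (open_setT gX).
- by move=> U V oU oV; exact: (open_setI gX).
- move=> U hU; apply: (open_local gX) => x /hU[V oV [Vx VU]].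
  by exists (quot_pi cls @^-1` V) => //; split => // y; exact: VU.
- by move=> U f /(reg_open gX).
- move=> U f oU hf; apply: (reg_local gX) => // x /hf[V [g [oV Vx rg fg]]].
  exists (quot_pi cls @^-1` V), (g \o quot_pi cls); split => //.
  by move=> y Uy Vy; exact: fg.
- by move=> U c oU; exact: (reg_cst gX).
- by move=> U f g rf rg; exact: (regD gX rf rg).
- by move=> U f g rf rg; exact: (regM gX rf rg).
- by move=> U f rf f0; apply: (regV gX rf) => x Ux; exact: f0.
- by move=> U f rf; exact: (open_neq0 gX rf).
Qed.

Lemma good_cone_space n (D : set 'rV[K]_n) r : good (cone_space D r).
Proof. by apply: good_quot; apply: good_subspace; exact: good_aff. Qed.

End GoodSpaces.

(** * Morphisms, separatedness, density and irreducibility *)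

Section Morphisms.
Variable K : fieldType.
Implicit Types X Y Z : fspace K.

(** Inverses of parametrisations are regular only on an open set; [phi] is total, and intersecting
    preimages with [U] discards its arbitrary values elsewhere. *)
Definition morph_on X Y (U : set X) (phi : X -> Y) : Prop :=
  (forall V, opn V -> opn (U `&` phi @^-1` V)) /\
  (forall V f, reg V f -> reg (U `&` phi @^-1` V) (f \o phi)).

Lemma morph_onT X Y (phi : X -> Y) : morph_on setT phi <-> morphism phi.
Proof.
by split=> -[h1 h2]; split=> [V oV|V f rf];
  have := h1; have := h2; move=> /(_ V) h2' /(_ V) h1';
  rewrite ?setTI in h1' h2' *; auto.
Qed.

Lemma morphism_comp X Y Z (phi : X -> Y) (psi : Y -> Z) :
  morphism phi -> morphism psi -> morphism (psi \o phi).
Proof.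
move=> [h1 h2] [k1 k2]; split=> [V /k1 /h1 //|V f /k2 /h2]; exact.
Qed.

Lemma morphism_id X : morphism (@id X).
Proof. by []. Qed.

Lemma morph_on_comp X Y Z (U : set X) (phi : X -> Y) (psi : Y -> Z) :
  morph_on U phi -> morphism psi -> morph_on U (psi \o phi).
Proof.
by move=> [h1 h2] [k1 k2]; split=> [V /k1 /h1 //|V f /k2 /h2].
Qed.

Lemma closed_preimage X Y (phi : X -> Y) (A : set Y) :
  morphism phi -> closed_in A -> closed_in (phi @^-1` A).
Proof. by move=> [h _] /h. Qed.

Lemma morphism_subspace X Y (A : set Y) (phi : X -> Y)
    (hA : forall x, A (phi x)) : good X -> morphism phi ->
  @morphism K X (subspace A) (fun x => exist _ (phi x) (hA x)).
Proof.
move=> gX [h1 h2].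
have oA : forall V : set (subspace A), opn V ->
    opn ((fun x => exist _ (phi x) (hA x) : subspace A) @^-1` V).
  move=> V [W oW VE]; rewrite (_ : _ @^-1` V = phi @^-1` W); first exact: h1.
  by apply/seteqP; split => x /= /(VE (exist _ (phi x) (hA x))).
split=> // V f [oV rf]; apply: (reg_local gX); first exact: oA.
move=> x Vx; have [W [g [oW Wx rg fg]]] := rf _ Vx.
exists (phi @^-1` W), (g \o phi); split => //; [exact: h1| exact: h2|].
by move=> y Vy Wy; exact: (fg (exist _ (phi y) (hA y))).
Qed.

Lemma morphism_sval X (A : set X) : good X ->
  @morphism K (subspace A) X sval.
Proof.
move=> gX; split=> [V oV|V f rf]; first by exists V.
split=> [|x Vx]; first by exists V => //; exact: (reg_open gX rf).
by exists V, f; split => //; exact: (reg_open gX rf).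
Qed.

Lemma morph_on_subspace X Y (A U : set X) (phi : X -> Y) : good X ->
  A `<=` U -> opn U -> morph_on U phi ->
  @morphism K (subspace A) Y (phi \o sval).
Proof.
move=> gX AU oU [h1 h2].
have E V : sval @^-1` (U `&` phi @^-1` V) =
    [set x : subspace A | V (phi (sval x))].
  by apply/seteqP; split => [x []//|x Vx]; split => //; apply: AU; case: x Vx.
have [s1 s2] := morphism_sval A gX.
split=> [V /h1 /s1|V f /h2 /s2]; rewrite E //.
Qed.

Lemma isomorphic_trans X Y Z :
  isomorphic X Y -> isomorphic Y Z -> isomorphic X Z.
Proof.
move=> [f [g [mf mg fK gK]]] [h [k [mh mk hK kK]]].
exists (h \o f), (g \o k); split; try exact: morphism_comp.
- by move=> x /=; rewrite hK fK.
- by move=> x /=; rewrite gK kK.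
Qed.

Lemma isomorphic_sym X Y : isomorphic X Y -> isomorphic Y X.
Proof. by move=> [f [g [mf mg fK gK]]]; exists g, f. Qed.

(* Weak form of "any two points lie in a common affine open subset": regular
   germs at a point of the chart are fractions of functions on the chart. *)
Definition pair_charts X : Prop := forall p p' : X, exists U : set X,
  [/\ opn U, U p, U p',
      (p <> p' -> exists u, reg U u /\ u p != u p') &
      forall x V f, U x -> V x -> reg V f -> exists q,
        [/\ reg U q, reg U (fun y => f y * q y), q x != 0 &
            forall y, U y -> q y != 0 -> V y]].

(** Where the values of [phi] and [psi] differ, a chart around both carries a regular function
    separating them, and the difference of its two pull-backs stays non-zero on a neighbourhood.
    Together with density this extends identities for [j] from the smooth fibres. *)
Lemma closed_equalizer X Y (phi psi : X -> Y) : good X -> good Y ->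
  pair_charts Y -> morphism phi -> morphism psi ->
  closed_in [set x | phi x = psi x].
Proof.
move=> gX gY pY [p1 p2] [s1 s2]; apply: (open_local gX) => x /= nx.
have [U [oU Ux Ux' /(_ nx)[u [ru ux]] _]] := pY (phi x) (psi x).
have oW : opn (phi @^-1` U `&` psi @^-1` U).
  by apply: (open_setI gX); [exact: p1|exact: s1].
have ru1 : reg (phi @^-1` U `&` psi @^-1` U) (u \o phi).
  by apply: (reg_sub gX) (p2 _ _ ru) => // ? [].
have ru2 : reg (phi @^-1` U `&` psi @^-1` U) (u \o psi).
  by apply: (reg_sub gX) (s2 _ _ ru) => // ? [].
have oN := open_neq0 gX (regB gX ru1 ru2).
exists [set y | (phi @^-1` U `&` psi @^-1` U) y /\
                (u \o phi) y - (u \o psi) y != 0] => //.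
split; first by split => //=; rewrite subr_eq0.
by move=> y [_] /= + E; rewrite E subrr eqxx.
Qed.

Definition dense X (D : set X) : Prop :=
  forall U : set X, opn U -> U !=set0 -> exists x, U x /\ D x.

Lemma dense_closed X (D A : set X) : dense D -> closed_in A ->
  D `<=` A -> forall x, A x.
Proof.
move=> dD cA DA x; apply: contrapT => nAx.
by have [y [nAy /DA]] := dD _ cA (ex_intro _ x nAx).
Qed.

Definition irreducible X : Prop :=
  forall U V : set X, opn U -> opn V -> U !=set0 -> V !=set0 ->
    exists x, U x /\ V x.

(** If the first closed set is not everything, its complement meets every non-empty open set, which
    forces the remaining sets to cover. Applied to P^1, this puts the image of a rational curve
    inside a single fibre component. *)
Lemma irreducible_cover X (I : eqType) (s : seq I) (A : I -> set X) :
  irreducible X -> good X -> (exists x : X, True) ->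
  (forall i, closed_in (A i)) -> (forall x, exists2 i, i \in s & A i x) ->
  exists2 i, i \in s & forall x, A i x.
Proof.
move=> iX gX [x0 _] cA; elim: s => [|i s IH] cov.
  by have [] := cov x0.
have [iA|/existsNP[x nAx]] := pselect (forall x, A i x).
  by exists i => //; rewrite mem_head.
have [//|k ks Ak] := IH; last by exists k => //; rewrite inE ks orbT.
move=> y; apply: contrapT => ny.
have : opn (\big[setI/setT]_(k <- s) ~` A k).
  elim: (s) => [|k s' IHs]; first by rewrite big_nil; exact: (open_setT gX).
  by rewrite big_cons; apply: (open_setI gX) => //; exact: cA.
have inE' z : (\big[setI/setT]_(k <- s) ~` A k) z <->
    forall k, k \in s -> ~ A k z.
  elim: (s) => [|k s' IHs]; first by rewrite big_nil; split.
  rewrite big_cons; split => [[h1 /IHs h2] l|h].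
    by rewrite inE => /orP[/eqP -> //|/h2].
  split; first by apply: h; rewrite mem_head.
  by apply/IHs => l ls; apply: h; rewrite inE ls orbT.
move=> /(iX _ _ (cA i)) []; first by exists x.
  by exists y; apply/inE' => k ks Ak; apply: ny; exists k.
move=> z [nz /inE' nzs]; have [k] := cov z.
by rewrite inE => /orP[/eqP -> /nz //|/nzs].
Qed.

(* If [phi \o psi] is a retraction onto A which contracts B to a point, then
   f = (f - f \o phi \o psi) + f \o phi \o psi. *)
Lemma transversal_retraction X Y (A B U : set X) (phi : Y -> X) (psi : X -> Y)
    (p : X) :
  good X -> opn U -> U p -> morphism phi -> morph_on U psi ->
  phi (psi p) = p ->
  (forall x, A x -> U x -> phi (psi x) = x) ->
  (forall x, B x -> U x -> psi x = psi p) ->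
  transversal_at A B p.
Proof.
move=> gX oU Up mphi mpsi hp hA hB W f oW Wp rf fp.
have [c1 c2] := morph_on_comp mpsi mphi.
pose V := W `&` (U `&` (phi \o psi) @^-1` W).
have oV : opn V by apply: (open_setI gX) => //; exact: c1.
have r2 : reg V (f \o (phi \o psi)) by apply: (reg_sub gX) (c2 _ _ rf) => // ? [].
have r1 : reg V f by apply: (reg_sub gX) rf => // ? [].
exists V, (fun x => f x - f (phi (psi x))), (f \o (phi \o psi)); split; split => //.
- by split => //; split => //=; rewrite hp.
- by move=> x [].
- exact: (regB gX).
- by move=> x [_ [Ux _]] Ax; rewrite hA // subrr.
- by move=> x [_ [Ux _]] Bx /=; rewrite hB // hp.
- by move=> x _ /=; rewrite subrK.
Qed.

Lemma smooth_rational_param X (A U : set X) (phi : proj_space K 1 -> X)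
    (psi : X -> proj_space K 1) :
  good X -> good (proj_space K 1) -> closed_in A -> opn U -> A `<=` U ->
  morphism phi -> morph_on U psi ->
  (forall v, A (phi v)) -> (forall v, psi (phi v) = v) ->
  (forall x, A x -> phi (psi x) = x) -> smooth_rational_curve A.
Proof.
move=> gX gP cA oU AU mphi mpsi hA h1 h2; split => //.
exists (psi \o sval), (fun v => exist _ (phi v) (hA v)); split.
- exact: morph_on_subspace mpsi.
- exact: morphism_subspace.
- move=> [x Ax] /=; have e := h2 _ Ax.
  by apply: eq_exist; rewrite /= e.
- by move=> v /=; rewrite h1.
Qed.

End Morphisms.

(** * Quotients by fixed-point-free involutions *)

Section InvolutionQuotient.
Variables (K : fieldType) (X : fspace K) (j : X -> X).
Hypotheses (gX : good X) (pX : pair_charts X) (mj : morphism j)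
  (jK : involutive j).
Implicit Types (A B U V : set X) (f : X -> K).

Local Notation S := (involution_quotient j).
Local Notation pi := (quot_pi (fun y : X => [set y; j y]) : X -> S).

Let gS : good S. Proof. exact: good_quot. Qed.

Lemma quot_pi_eq x y : pi x = pi y :> S <-> y = x \/ y = j x.
Proof.
split=> [[E]|[->//|->]].
  have : [set y; j y] y by left.
  by rewrite -E => -[] /= ->; [left|right].
by apply: eq_exist => /=; rewrite jK setUC.
Qed.

Lemma quot_pi_surj (z : S) : exists x, z = pi x.
Proof. by case: z => A [x E]; exists x; apply: eq_exist. Qed.

Let rep (z : S) : X := projT1 (cid (quot_pi_surj z)).

Let repK z : pi (rep z) = z.
Proof. by rewrite /rep; case: cid. Qed.

Let rep_pi x : rep (pi x) = x \/ rep (pi x) = j x.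
Proof. by apply/quot_pi_eq; rewrite repK. Qed.

Lemma morphism_quot_pi : morphism (pi : X -> S).
Proof. by []. Qed.

Lemma preimage_quot U : (forall y, U y -> U (j y)) -> pi @^-1` (pi @` U) = U.
Proof.
move=> jU; apply/seteqP; split => [x [y Uy /quot_pi_eq[->//|->]]|x Ux].
  exact: jU.
by exists x.
Qed.

(** Regularity on the quotient is regularity of the pull-back, so for an invariant function the
    arbitrary choice of representatives [rep] is harmless. *)
Lemma reg_descend U f : (forall y, U y -> U (j y)) ->
  (forall y, U y -> f (j y) = f y) -> reg U f ->
  exists2 g : S -> K, reg (pi @` U) g & forall y, U y -> g (pi y) = f y.
Proof.
move=> jU jf rf; exists (f \o rep) => [|y Uy /=].
  suff : reg (pi @^-1` (pi @` U)) ((f \o rep) \o pi) by [].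
  rewrite preimage_quot //; apply: (eq_reg gX) rf => x Ux /=.
  by case: (rep_pi x) => -> //; rewrite jf.
by case: (rep_pi y) => -> //; rewrite jf.
Qed.

Lemma reg_comp_j U f : reg U f -> reg (j @^-1` U) (f \o j).
Proof. by case: mj => _; exact. Qed.

Lemma closed_image_pi A : closed_in A -> closed_in (pi @` A).
Proof.
move=> cA; have cjA : closed_in (j @^-1` A) by exact: closed_preimage cA.
suff E : pi @^-1` (~` (pi @` A)) = ~` (A `|` j @^-1` A).
  by rewrite /closed_in /= /quot_open E; exact: (closed_setU gX).
rewrite -preimage_setC; congr (~` _); apply/seteqP; split=> x.
  by move=> [y Ay /quot_pi_eq[->|->]]; [left|right; rewrite /= jK].
by move=> [Ax|jAx]; [exists x|exists (j x) => //; apply/quot_pi_eq; right; rewrite jK].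
Qed.

Lemma saturation U : opn U -> exists W : set X,
  [/\ opn W, forall y, W y -> W (j y) & W = U `&` j @^-1` U].
Proof.
move=> oU; exists (U `&` j @^-1` U); split => //.
  by apply: (open_setI gX) => //; exact: mj.1.
by move=> y [Uy Ujy]; split => //=; rewrite jK.
Qed.

(** Disjointness from [j A] makes [pi] injective on [A]. The substance is that the inverse [h] is a
    morphism: a function regular on [A] near a point must extend locally to a [j]-invariant
    function. *)
Lemma smooth_rational_quot A : A `&` (j @^-1` A) = set0 ->
  smooth_rational_curve A -> smooth_rational_curve (pi @` A).
Proof.
move=> AjA [cA isoA]; split; first exact: closed_image_pi.
apply: isomorphic_trans isoA; apply: isomorphic_sym.
have nAjA x : A x -> ~ A (j x).
  by move=> Ax Ajx; have : set0 x by rewrite -AjA.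
have hA (x : subspace A) : (pi @` A) (pi (sval x)).
  by exists (sval x) => //; case: x.
have inv (z : subspace (X := S) (pi @` A)) : {x : subspace A | pi (sval x) = sval z}.
  by apply: cid; case: z => z [x Ax E]; exists (exist _ x Ax).
pose h (z : subspace (X := S) (pi @` A)) : subspace A := projT1 (inv z).
have hE z : pi (sval (h z)) = sval z by rewrite /h; case: (inv z).
have piA (x y : subspace A) : pi (sval x) = pi (sval y) -> x = y.
  case: x y => x Ax [y Ay] /quot_pi_eq /= [E|E].
    by apply: eq_exist.
  by exfalso; apply: (nAjA x) => //; rewrite -E.
exists (fun x => exist _ (pi (sval x)) (hA x)), h; split.
- refine (@morphism_subspace _ (subspace A) S (pi @` A) (fun x => pi (sval x)) hA _ _).
    exact: good_subspace.
  exact: morphism_comp (morphism_sval A gX) morphism_quot_pi.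
- have oh : forall V : set (subspace A), opn V -> opn (h @^-1` V).
    move=> V [W oW VE].
    (* Continuity of [h] comes from closedness of [pi]: the preimage is cut out by the complement of
       the image of the closed set [Z]. *)
    pose Z := A `&` ~` W; have cZ : closed_in Z.
      by apply: (closed_setI gX) => //; rewrite /closed_in setCK.
    exists (~` (pi @` Z)); first exact: (closed_image_pi cZ).
    move=> z; split=> [/(VE (h z)) Wz [x [Ax nWx]]|nz].
      rewrite -hE => /(piA (exist _ x Ax)) E.
      by move: nWx; rewrite -[x]/(sval (exist _ x Ax : subspace A)) E.
    suff Wz : W (sval (h z)) by exact: ((VE _).2 Wz).
    apply: contrapT => nW; apply: nz; exists (sval (h z)); last exact: hE.
    by split => //; case: (h z).
  split=> // V f rf; have oV : opn V := rf.1; split; first exact: oh.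
  move=> z Vz; set p := sval (h z).
  have [W [g [oW Wp rg fg]]] := rf.2 _ Vz.
  have Ap : A p by rewrite /p; case: (h z).
  have [U [oU Up Ujp _ fr]] := pX p (j p).
  have [q [rq rgq qp qW]] := fr _ _ _ Up Wp rg.
  have cjA : closed_in (j @^-1` A) by exact: closed_preimage cA.
  (* The constant 1 on the complement of [j A] yields [e], regular on the chart, non-zero at [p] and
     zero on the part of [j A] in the chart. *)
  have [e [re _ ep eA]] := fr _ _ _ Up (nAjA _ Ap) (reg_cst gX 1 cjA).
  pose r x := e x * q x; pose P x := r x * g x.
  have rr : reg U r by exact: (regM gX).
  have rP : reg U P.
    apply: (eq_reg gX) (regM gX re rgq) => x _.
    by rewrite /P /r mulrAC mulrA.
  have [N [oN jN NE]] := saturation oU.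
  have tr F : reg U F -> reg N (fun x => F x + F (j x)).
    move=> rF; apply: (regD gX).
      by apply: (reg_sub gX) rF => //; rewrite NE => ? [].
    by apply: (reg_sub gX) (reg_comp_j rF) => //; rewrite NE => ? [].
  have e0 x : A x -> U (j x) -> e (j x) = 0.
    move=> Ax Ujx; apply/eqP/negP => /negP /(eA _ Ujx) /=.
    by rewrite jK.
  pose M := [set x | N x /\ r x + r (j x) != 0].
  have oM : opn M := open_neq0 gX (tr _ rr).
  have jM y : M y -> M (j y).
    by move=> [Ny nz]; split; [exact: jN|rewrite jK addrC].
  have rM F : reg N F -> reg M F by move=> rF; apply: (reg_sub gX) rF => // ? [].
  (* Weighted average over the two sheets. At a point of [A] the weight of the other sheet is zero
     by [e0], so the quotient reduces to P / r = g. *)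
  have rG : reg M (fun x => (P x + P (j x)) / (r x + r (j x))).
    apply: (regM gX); first exact/rM/tr.
    by apply: (regV gX); [exact/rM/tr|move=> ? []].
  have [|G rGS GE] := reg_descend jM _ rG.
    by move=> y _; rewrite jK addrC [r _ + r _]addrC.
  exists (pi @` M), G; split => //.
  + exact: (reg_open gS rGS).
  + exists p; last exact: hE.
    split; first by rewrite NE; split.
    by rewrite /r (e0 p) // mul0r addr0 mulf_neq0.
  + move=> z' Vz' [y My yz'].
    set x := sval (h z'); have Ax : A x by rewrite /x; case: (h z').
    have pix : pi x = sval z' := hE z'.
    have Mx : M x.
      by move: pix; rewrite -yz' => /quot_pi_eq [<-//|E]; rewrite -[x]jK -E; exact: jM.
    rewrite -pix GE // /= ; have [Nx nz] := Mx.
    move: Nx; rewrite NE => -[Ux Ujx].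
    have rj : r (j x) = 0 by rewrite /r e0 // mul0r.
    move: nz; rewrite /P rj mul0r !addr0 => nz.
    have qx : q x != 0 by apply: contra_neq nz => qx; rewrite /r qx mulr0.
    by rewrite mulrAC divff // mul1r -fg //; exact: qW.
- by move=> x; apply: piA; rewrite hE.
- by move=> z; move: (hE z); case: z => z hz /= E; apply: eq_exist => /=.
Qed.

(** A decomposition of the pulled-back function at [p] is averaged over [j] with a weight that
    vanishes on [j A] and [j B]; invariance of the pull-back of [f] turns the averaged sum into [f]
    again. *)
Lemma transversal_quot A B p : closed_in A -> closed_in B ->
  A `&` (j @^-1` A) = set0 -> B `&` (j @^-1` B) = set0 -> A p -> B p ->
  transversal_at A B p -> transversal_at (pi @` A) (pi @` B) (pi p : S).
Proof.
move=> cA cB AjA BjB Ap Bp tAB U f oU Up rf fp.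
have nAjA x : A x -> ~ A (j x).
  by move=> Ax Ajx; have : set0 x by rewrite -AjA.
have nBjB x : B x -> ~ B (j x).
  by move=> Bx Bjx; have : set0 x by rewrite -BjB.
have [V [g [h [[oV Vp VU rg rh] [gA hB fgh]]]]] :=
  tAB _ _ oU Up rf fp.
have [C [oC Cp Cjp _ fr]] := pX p (j p).
have [qg [rqg rgq qgp qgV]] := fr _ _ _ Cp Vp rg.
have [qh [rqh rhq qhp qhV]] := fr _ _ _ Cp Vp rh.
have oE : opn (~` (j @^-1` A `|` j @^-1` B)).
  by apply: (closed_setU gX); exact: closed_preimage.
have Ep : (~` (j @^-1` A `|` j @^-1` B)) p.
  by case; [exact: nAjA|exact: nBjB].
have [e [re _ ep eE]] := fr _ _ _ Cp Ep (reg_cst gX 1 oE).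
(* [qg] and [qh] clear the denominators of [g] and [h] on the chart; [e] kills the other sheet of
   both curves. *)
pose r x := e x * qg x * qh x.
have rr : reg C r by apply: (regM gX) => //; exact: (regM gX).
have rrg : reg C (fun x => r x * g x).
  apply: (eq_reg gX) (regM gX (regM gX re rgq) rqh) => x _.
  by rewrite /r; ring.
have rrh : reg C (fun x => r x * h x).
  apply: (eq_reg gX) (regM gX (regM gX re rhq) rqg) => x _.
  by rewrite /r; ring.
have rV x : C x -> r x != 0 -> V x.
  move=> Cx rx; apply: qgV => //.
  by apply: contra_neq rx => qx; rewrite /r qx mulr0 mul0r.
have rE x : C x -> r x != 0 -> ~ A (j x) /\ ~ B (j x).
  move=> Cx rx; have /eE : e x != 0.
    by apply: contra_neq rx => qx; rewrite /r qx !mul0r.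
  by move=> /(_ Cx) nE; split=> ?; apply: nE; [left|right].
have [W [oW jW WE]] := saturation (open_setI gX oC (oU : opn (pi @^-1` U))).
have WC x : W x -> [/\ C x, C (j x) & U (pi x)].
  by rewrite WE => -[[? ?] [? ?]].
have tr F : reg C F -> reg W (fun x => F x + F (j x)).
  move=> rF; apply: (regD gX).
    by apply: (reg_sub gX) rF => // ? /WC[].
  by apply: (reg_sub gX) (reg_comp_j rF) => // ? /WC[].
pose M := [set x | W x /\ r x + r (j x) != 0].
have oM : opn M := open_neq0 gX (tr _ rr).
have jM y : M y -> M (j y).
  by move=> [Ny nz]; split; [exact: jW|rewrite jK addrC].
have rM F : reg W F -> reg M F by move=> rF; apply: (reg_sub gX) rF => // ? [].
have rdiv F : reg C F -> reg M (fun x => (F x + F (j x)) / (r x + r (j x))).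
  move=> rF; apply: (regM gX); first exact/rM/tr.
  by apply: (regV gX); [exact/rM/tr|move=> ? []].
have [|G rG GE] := reg_descend jM _ (rdiv _ rrg).
  by move=> y _; rewrite jK addrC [r _ + r _]addrC.
have [|H rH HE] := reg_descend jM _ (rdiv _ rrh).
  by move=> y _; rewrite jK addrC [r _ + r _]addrC.
exists (pi @` M), G, H; split; split => //.
- exact: (reg_open gS rG).
- exists p => //; split.
    rewrite WE; split; split => //=.
    by rewrite (_ : pi (j p) = pi p) //; apply/quot_pi_eq; right; rewrite jK.
  have -> : r (j p) = 0.
    by apply/eqP/negP => /negP /(rE _ Cjp) []; rewrite jK.
  by rewrite addr0 /r !mulf_neq0.
- by move=> _ [x [/WC[_ _ Ux] _] <-].
- move=> _ [x Mx <-] [y Ay yx]; rewrite GE //.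
  have [/WC[Cx Cjx _] _] := Mx.
  (* Both terms of the average vanish separately: where the weight is non-zero the point is off
     [j A], hence on [A], where [g] is zero. *)
  suff z x' : C x' -> A x' \/ A (j x') -> r x' * g x' = 0.
    rewrite z // ?[r (j x) * _]z //; first by rewrite addr0 mul0r.
      by move/quot_pi_eq: yx => [->|->]; [right|left]; rewrite ?jK.
    by move/quot_pi_eq: yx => [->|->]; [left|right]; rewrite ?jK.
  move=> Cx' Ax'; have [->|rx'] := eqVneq (r x') 0; first exact: mul0r.
  case: Ax' => [Ax'|Ajx']; last by case: (rE _ Cx' rx').
  by rewrite gA ?mulr0 //; exact: rV.
- move=> _ [x Mx <-] [y By yx]; rewrite HE //.
  have [/WC[Cx Cjx _] _] := Mx.
  suff z x' : C x' -> B x' \/ B (j x') -> r x' * h x' = 0.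
    rewrite z // ?[r (j x) * _]z //; first by rewrite addr0 mul0r.
      by move/quot_pi_eq: yx => [->|->]; [right|left]; rewrite ?jK.
    by move/quot_pi_eq: yx => [->|->]; [left|right]; rewrite ?jK.
  move=> Cx' Bx'; have [->|rx'] := eqVneq (r x') 0; first exact: mul0r.
  case: Bx' => [Bx'|Bjx']; last by case: (rE _ Cx' rx').
  by rewrite hB ?mulr0 //; exact: rV.
- move=> _ [x Mx <-]; rewrite GE // HE //; have [/WC[Cx Cjx _] nz] := Mx.
  have E x' : C x' -> r x' * f (pi x') = r x' * g x' + r x' * h x'.
    move=> Cx'; have [->|rx'] := eqVneq (r x') 0; first by rewrite !mul0r addr0.
    by rewrite -mulrDr -fgh //; exact: rV.
  have fj : f (pi (j x)) = f (pi x).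
    by congr f; apply/quot_pi_eq; right; rewrite jK.
  rewrite -mulrDl addrACA -(E _ Cx) -(E _ Cjx) fj -mulrDl mulrAC divff //.
  by rewrite mul1r.
Qed.

Lemma meet_once_quot A B p : closed_in A -> closed_in B ->
  A `&` (j @^-1` A) = set0 -> B `&` (j @^-1` B) = set0 ->
  A `&` (j @^-1` B) = set0 -> A `&` B = [set p] -> transversal_at A B p ->
  meet_once (X := S) (pi @` A) (pi @` B).
Proof.
move=> cA cB AjA BjB AjB AB tAB; exists (pi p).
have [Ap Bp] : (A `&` B) p by rewrite AB.
split; last exact: transversal_quot.
apply/seteqP; split=> [_ [[x Ax <-] [y By /quot_pi_eq[E|E]]]|_ ->].
- have : (A `&` B) x by split => //; rewrite E.
  by rewrite AB => ->.
- by have : set0 x; [rewrite -AjB; split => //=; rewrite E jK|].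
- by split; exists p.
Qed.

Lemma disjoint_quot A B : A `&` B = set0 -> A `&` (j @^-1` B) = set0 ->
  pi @` A `&` pi @` B = set0 :> set S.
Proof.
move=> AB AjB; apply/seteqP; split=> [_ [[x Ax <-] [y By /quot_pi_eq[E|E]]]|//].
- by have : set0 x; [rewrite -AB; split => //; rewrite E|].
- by have : set0 x; [rewrite -AjB; split => //=; rewrite E jK|].
Qed.

End InvolutionQuotient.

(** * Quotients of cones *)

Section Polynomials.
Variable K : numFieldType.

Lemma poly_nonroot (p : {poly K}) : p != 0 -> exists u, p.[u] != 0.
Proof.
move=> p0; apply: contrapT => h.
have rts : all (root p) [seq i%:R | i <- iota 0 (size p)].
  apply/allP => _ /mapP[i _ ->]; apply/negPn/negP => nr; apply: h.
  by exists i%:R.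
have U : uniq [seq (i%:R : K) | i <- iota 0 (size p)].
  by rewrite map_inj_uniq ?iota_uniq // => a b /eqP; rewrite eqr_nat => /eqP.
by have := max_poly_roots p0 rts U; rewrite size_map size_iota ltnn.
Qed.

Lemma poly_eq0 (p : {poly K}) : (forall u, p.[u] = 0) -> p = 0.
Proof.
by move=> h; apply/eqP/negPn/negP => /poly_nonroot[u]; rewrite h eqxx.
Qed.

Definition polycurve n (w : K -> 'rV[K]_n) : Prop :=
  forall i, exists p : {poly K}, forall u, w u 0 i = p.[u].

Lemma polyfun_curve n (w : K -> 'rV[K]_n) f : polycurve w -> polyfun f ->
  exists p : {poly K}, forall u, f (w u) = p.[u].
Proof.
move=> pw; move: f.
apply: (@polyfun_ind _ n (fun f => exists p : {poly K}, forall u, f (w u) = p.[u])).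
- by move=> c; exists c%:P => u; rewrite hornerC.
- exact: pw.
- by move=> f g [p hp] [q hq]; exists (p + q) => u; rewrite hornerD hp hq.
- by move=> f g [p hp] [q hq]; exists (p * q) => u; rewrite hornerM hp hq.
Qed.

Definition line_through n (v w : 'rV[K]_n) (u : K) : 'rV[K]_n :=
  v + u *: (w - v).

Lemma line_through0 n (v w : 'rV[K]_n) : line_through v w 0 = v.
Proof. by rewrite /line_through scale0r addr0. Qed.

Lemma line_through1 n (v w : 'rV[K]_n) : line_through v w 1 = w.
Proof. by rewrite /line_through scale1r addrC subrK. Qed.

Lemma polycurve_line n (v w : 'rV[K]_n) : polycurve (line_through v w).
Proof.
move=> i; exists ((v 0 i)%:P + 'X * (w 0 i - v 0 i)%:P) => u.
by rewrite /line_through !mxE hornerD hornerM hornerX !hornerC.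
Qed.

(** If neither of two coordinates, one non-zero at [v] and one at [w], works for both, their sum
    does; this lets a single affine chart contain two given points. *)
Lemma linear_form2 n (v w : 'rV[K]_n) : v != 0 -> w != 0 ->
  exists m : 'cV[K]_n, (v *m m) 0 0 != 0 /\ (w *m m) 0 0 != 0.
Proof.
move=> /rV0Pn[i vi] /rV0Pn[k wk].
have dE (x : 'rV[K]_n) (l : 'I_n) : (x *m (delta_mx l 0 : 'cV[K]_n)) 0 0 = x 0 l.
  rewrite mxE (bigD1 l) //= mxE !eqxx mulr1 big1 ?addr0 // => k' kl.
  by rewrite mxE (negPf kl) mulr0.
have [wi|wi] := eqVneq (w 0 i) 0; last first.
  by exists (delta_mx i 0); rewrite !dE.
have [vk|vk] := eqVneq (v 0 k) 0; last first.
  by exists (delta_mx k 0); rewrite !dE.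
exists (delta_mx i 0 + delta_mx k 0).
by rewrite !mulmxDr ![((_ + _) : 'M__) 0 0]mxE !dE wi vk add0r addr0.
Qed.

End Polynomials.

(** * Homogeneous coordinates, charts and maps of cone quotients *)

Section Cones.
Variable K : fieldType.

Section OneCone.
Variables (n : nat) (D : set 'rV[K]_n) (r : 'rV[K]_n -> 'rV[K]_n -> Prop).
Hypotheses (r_refl : forall v, r v v) (r_sym : forall v w, r v w -> r w v)
  (r_trans : forall u v w, r u v -> r v w -> r u w).
Local Notation X := (cone_space D r).
Implicit Types (p q : X) (v w : 'rV[K]_n).

Definition cone_pt w (Dw : D w) : X :=
  @quot_pi K (@subspace K (aff K n) D) _ (exist (fun z => D z) w Dw).

Lemma coords_cone_pt w (Dw : D w) : coords (cone_pt Dw) w.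
Proof. by exists (exist _ w Dw). Qed.

Lemma coords_dom p w : coords p w -> D w.
Proof. by case=> [[v Dv] [_ <-]]. Qed.

Lemma coords_ex p : exists w, coords p w.
Proof.
case: p => A [[w Dw] E]; exists w, (exist _ w Dw); split => //.
exact: eq_exist.
Qed.

Lemma coords_pt p w (Dw : D w) : coords p w -> p = cone_pt Dw.
Proof.
move=> [[v Dv] [-> /= E]]; subst v.
by rewrite (Prop_irrelevance Dw Dv).
Qed.

Lemma coords_rel p v w : coords p v -> coords p w -> r v w.
Proof.
move=> /[dup] /coords_dom Dv /(coords_pt Dv) -> [[w' Dw'] [[E] /= <-]].
have : [set z : subspace (X := aff K n) D | r w' (sval z)] (exist _ w' Dw').
  exact: r_refl.
by rewrite -E.
Qed.

Lemma coords_trans p v w : coords p v -> D w -> r v w -> coords p w.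
Proof.
move=> [[v' Dv] [-> /= <-]] Dw vw; exists (exist _ w Dw); split => //.
apply: eq_exist; apply/seteqP; split=> z /= h; last exact: r_trans h.
by apply: r_trans h; exact: r_sym.
Qed.

Lemma coords_inj p q w : coords p w -> coords q w -> p = q.
Proof.
by move=> /[dup] /coords_dom Dw /(coords_pt Dw) -> /(coords_pt Dw) ->.
Qed.

Lemma open_cone (U : set X) : opn U <-> exists2 V, zariski_open V &
  forall p w, coords p w -> (U p <-> V w).
Proof.
split=> [[V oV VE]|[V oV VE]]; exists V => //.
  by move=> p w [x [-> <-]]; exact: VE.
by move=> [w Dw]; exact: (VE _ _ (coords_cone_pt Dw)).
Qed.

Lemma closed_cone (I : Type) (h : I -> 'rV[K]_n -> K) :
  (forall i, polyfun (h i)) ->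
  (forall v w, r v w -> (forall i, h i v = 0) -> forall i, h i w = 0) ->
  closed_in [set p : X | forall w, coords p w -> forall i, h i w = 0].
Proof.
move=> ph hr; apply/open_cone.
exists [set w | exists i, h i w != 0].
  apply/zariski_openP => w [i hw]; exists (h i); split => // w' hw'.
  by exists i.
move=> p w pw; split=> [np|[i hi] np]; last by rewrite np ?eqxx in hi.
apply: contrapT => nh; apply: np => v pv i.
apply: (hr w v); first exact: coords_rel pw pv.
by move=> k; apply/eqP/negPn/negP => hk; apply: nh; exists k.
Qed.

Lemma reg_cone (U : set X) (f : X -> K) : reg U f <-> opn U /\
  forall p w, U p -> coords p w -> exists V (g : 'rV[K]_n -> K),
    [/\ zariski_open V, V w, @reg K (aff K n) V g &
        forall q v, U q -> coords q v -> V v -> f q = g v].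
Proof.
split=> [[oU rf]|[oU hf]].
  split=> // p w Up [[w' Dw] [E /= E']]; subst p w'.
  have [V [g [oV Vx rg gE]]] := rf _ Up.
  exists V, g; split => // q v Uq [[v' Dv] [Eq /= Ev]] Vv; subst q v'.
  exact: (gE (exist _ v Dv)).
split=> // -[w Dw] Up.
have [V [g [oV Vx rg gE]]] := hf _ _ Up (coords_cone_pt Dw).
exists V, g; split => // -[v Dv] Uv Vv.
exact: (gE _ _ Uv (coords_cone_pt Dv)).
Qed.

(* [N w / d w] is a representative of [w] which only depends on its class. *)
Lemma pair_charts_cone :
  (forall v w, D v -> D w -> exists (d : 'rV[K]_n -> K) N,
     [/\ polyfun d, polymap N, d v != 0, d w != 0 &
         forall x, D x -> d x != 0 ->
         [/\ D ((d x)^-1 *: N x), r x ((d x)^-1 *: N x) &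
             forall y, r x y ->
               d y != 0 /\ (d y)^-1 *: N y = (d x)^-1 *: N x]]) ->
  pair_charts X.
Proof.
move=> nrm p p'; have gX : good X := good_cone_space D r.
have [v pv] := coords_ex p; have [v' pv'] := coords_ex p'.
have [d [N [pd pN dv dv' hN]]] := nrm _ _ (coords_dom pv) (coords_dom pv').
pose U : set X := [set q | forall w, coords q w -> d w != 0].
have UP q w : coords q w -> (U q <-> d w != 0).
  move=> qw; split=> [|dw w' qw']; first exact.
  have [_ _ h] := hN _ (coords_dom qw) dw.
  by have [] := h _ (coords_rel qw qw').
pose rep (q : X) := projT1 (cid (coords_ex q)).
have repP q : coords q (rep q) by rewrite /rep; case: cid.
pose nf (q : X) : 'rV[K]_n := (d (rep q))^-1 *: N (rep q).
have nfE q w : coords q w -> U q -> nf q = (d w)^-1 *: N w.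
  move=> qw Uq; have dw := (UP _ _ qw).1 Uq.
  have [_ _ h] := hN _ (coords_dom qw) dw.
  by have [] := h _ (coords_rel qw (repP q)).
have nfP q : U q -> coords q (nf q).
  move=> Uq; have dw := (UP _ _ (repP q)).1 Uq.
  have [h1 h2 _] := hN _ (coords_dom (repP q)) dw.
  exact: coords_trans (repP q) h1 h2.
have oU : opn U.
  by apply/open_cone; exists [set w | d w != 0] => //; exact: zariski_open_neq0.
have regnf (h : 'rV[K]_n -> K) : polyfun h -> reg U (h \o nf).
  move: h; apply: polyfun_ind.
  - by move=> c; exact: (reg_cst gX).
  - move=> i; apply/reg_cone; split => // q w Uq qw.
    have od := zariski_open_neq0 pd.
    exists [set x | d x != 0], (fun x => (d x)^-1 * N x 0 i); split => //.
    + exact: ((UP _ _ qw).1 Uq).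
    + apply/reg_affP; split => // x dx.
      exists (fun x => N x 0 i), d; split => // y _ _; exact: mulrC.
    + by move=> y z Uy yz dz /=; rewrite (nfE _ _ yz Uy) mxE.
  - by move=> f g; exact: (regD gX).
  - by move=> f g; exact: (regM gX).
exists U; split => //.
- exact: ((UP _ _ pv).2 dv).
- exact: ((UP _ _ pv').2 dv').
- move=> pp'; have Up := (UP _ _ pv).2 dv; have Up' := (UP _ _ pv').2 dv'.
  have ne : nf p != nf p'.
    apply/eqP => E; apply: pp'; have := nfP _ Up.
    by rewrite E => pE; exact: coords_inj pE (nfP _ Up').
  have [i ni] : exists i, nf p 0 i != nf p' 0 i.
    apply: contrapT => h; move/eqP: ne; apply; apply/rowP => i.
    by apply/eqP/negPn/negP => ni; apply: h; exists i.
  exists ((fun w : 'rV[K]_n => w 0 i) \o nf); split => //.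
  by apply: regnf; exact: polyfun_coord.
move=> x V f Ux Vx /reg_cone[/open_cone[V' oV' VE] rf].
have [W [g [oW Wx /reg_affP[_ rg] gE]]] := rf _ _ Vx (nfP _ Ux).
have [P [Q [pP pQ Qx gPQ]]] := rg _ Wx.
have V'x : V' (nf x) by apply/(VE _ _ (nfP _ Ux)).
have /zariski_openP/(_ _ Wx)[q1 [pq1 q1x q1W]] := oW.
have /zariski_openP/(_ _ V'x)[q2 [pq2 q2x q2V]] := oV'.
(* [q1] and [q2] vanish outside the domains of the fraction and of [f]. [Q] is squared because f *
   qq = P * Q * q1 * q2 must also hold where [Q] is zero and the fraction says nothing about [f]. *)
pose qq w := Q w * Q w * (q1 w * q2 w).
have pqq : polyfun qq by apply: polyfunM; exact: polyfunM.
exists (qq \o nf); split.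
- exact: regnf.
- have pPq : polyfun (fun w => P w * Q w * (q1 w * q2 w)).
    by apply: polyfunM; exact: polyfunM.
  apply: (eq_reg gX) (regnf _ pPq) => y Uy /=.
  rewrite /qq.
  have [->|Qy] := eqVneq (Q (nf y)) 0; first by rewrite !(mulr0, mul0r).
  have [->|q1y] := eqVneq (q1 (nf y)) 0; first by rewrite !(mulr0, mul0r).
  have [->|q2y] := eqVneq (q2 (nf y)) 0; first by rewrite !(mulr0, mul0r).
  have Vy : V y by apply/(VE _ _ (nfP _ Uy)); exact: q2V.
  have Wy : W (nf y) by exact: q1W.
  rewrite (gE _ _ Vy (nfP _ Uy) Wy) gPQ // !mulrA divfK //.
- by rewrite /= /qq !mulf_neq0.
- move=> y Uy /=; rewrite /qq !mulf_eq0 !negb_or => /andP[_ /andP[_ q2y]].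
  by apply/(VE _ _ (nfP _ Uy)); exact: q2V.
Qed.

End OneCone.

Lemma zariski_open_preimage n m (F : 'rV[K]_n -> 'rV[K]_m) V :
  polymap F -> zariski_open V -> zariski_open (F @^-1` V).
Proof.
move=> pF /zariski_openP oV; apply/zariski_openP => x /oV[q [pq qx qV]].
by exists (q \o F); split => //; [exact: polyfun_comp|move=> y /qV].
Qed.

Lemma reg_aff_preimage n m (F : 'rV[K]_n -> 'rV[K]_m) (V : set (aff K m)) f :
  polymap F -> reg V f -> @reg K (aff K n) (F @^-1` V) (f \o F).
Proof.
move=> pF /reg_affP[oV rf]; apply/reg_affP; split.
  exact: zariski_open_preimage.
move=> x /rf[p [q [pp pq qx fE]]]; exists (p \o F), (q \o F).
by split => //; [exact: polyfun_comp|exact: polyfun_comp|move=> y Vy; exact: fE].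
Qed.

(** Pull-backs along [F] of Zariski-open sets and of fractions are of the same kind, and
    compatibility with the orbit relations makes the map well defined. [p0] is the default value off
    [E]. *)
Lemma cone_map n m (D : set 'rV[K]_n) r (D' : set 'rV[K]_m) r'
    (E : set 'rV[K]_n) (F : 'rV[K]_n -> 'rV[K]_m) (p0 : cone_space D' r') :
  (forall v, r v v) -> (forall v w, r v w -> r w v) ->
  (forall v, r' v v) -> (forall v w, r' v w -> r' w v) ->
  (forall u v w, r' u v -> r' v w -> r' u w) ->
  polymap F -> zariski_open E ->
  (forall w, D w -> E w -> D' (F w)) ->
  (forall v w, D v -> D w -> r v w -> E v -> E w /\ r' (F v) (F w)) ->
  exists phi : cone_space D r -> cone_space D' r',
    let U := [set p | forall w, coords p w -> E w] in
    [/\ forall p w, U p -> coords p w -> coords (phi p) (F w), opn U &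
        morph_on U phi].
Proof.
move=> rr rs rr' rs' rt' pF oE hD hr.
pose U : set (cone_space D r) := [set p | forall w, coords p w -> E w].
have UP p w : coords p w -> (U p <-> E w).
  move=> pw; split=> [|Ew w' pw']; first exact.
  have [] // := hr _ _ (coords_dom pw) (coords_dom pw') _ Ew.
  exact: coords_rel pw pw'.
have ex p : exists q : cone_space D' r', forall w, U p -> coords p w ->
    coords q (F w).
  have [w pw] := coords_ex p.
  have [Ew|nEw] := pselect (E w); last first.
    by exists p0 => w' /(UP _ _ pw).
  have Dw := hD _ (coords_dom pw) Ew.
  exists (cone_pt r' Dw) => w' _ pw'.
  have [] // := hr _ _ (coords_dom pw) (coords_dom pw') _ Ew.
    exact: coords_rel pw pw'.
  move=> Ew' FF; apply: coords_trans (coords_cone_pt _ Dw) _ FF => //.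
  by apply: hD => //; exact: coords_dom pw'.
pose phi p := projT1 (cid (ex p)).
have phiP p w : U p -> coords p w -> coords (phi p) (F w).
  by move=> Up pw; rewrite /phi; case: cid => q /= /(_ _ Up pw).
have oP V : opn V -> opn (U `&` phi @^-1` V).
  move=> /open_cone[V' oV' VE]; apply/open_cone.
  exists (E `&` F @^-1` V').
    by apply: zariski_openI => //; exact: zariski_open_preimage.
  move=> p w pw; split => -[h1 h2].
    by split; [exact/(UP _ _ pw)|exact/(VE _ _ (phiP _ _ h1 pw))].
  have Up : U p by exact/(UP _ _ pw).
  by split => //; exact/(VE _ _ (phiP _ _ Up pw)).
exists phi => U'; split => //.
  by apply/open_cone; exists E.
split=> // V f /[dup] /(reg_open (good_cone_space _ _)) oV /reg_cone[_ rf].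
apply/reg_cone; split; first exact: oP.
move=> p w [Up Vp] pw.
have [W [g [oW Wx rg gE]]] := rf _ _ Vp (phiP _ _ Up pw).
exists (F @^-1` W), (g \o F); split => //.
- exact: zariski_open_preimage.
- exact: reg_aff_preimage.
- by move=> q v [Uq Vq] qv Wv; apply: (gE _ _ Vq (phiP _ _ Uq qv)).
Qed.

Lemma cone_mapT n m (D : set 'rV[K]_n) r (D' : set 'rV[K]_m) r'
    (F : 'rV[K]_n -> 'rV[K]_m) (p0 : cone_space D' r') :
  (forall v, r v v) -> (forall v w, r v w -> r w v) ->
  (forall v, r' v v) -> (forall v w, r' v w -> r' w v) ->
  (forall u v w, r' u v -> r' v w -> r' u w) ->
  polymap F -> (forall w, D w -> D' (F w)) ->
  (forall v w, D v -> D w -> r v w -> r' (F v) (F w)) ->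
  exists phi : cone_space D r -> cone_space D' r',
    (forall p w, coords p w -> coords (phi p) (F w)) /\ morphism phi.
Proof.
move=> rr rs rr' rs' rt' pF hD hr.
have [|||phi [h1 _ h2]] := @cone_map n m D r D' r' setT F p0 rr rs rr' rs' rt' pF.
- exact: (open_setT (good_aff K n)).
- by move=> w Dw _; exact: hD.
- by move=> v w Dv Dw vw _; split => //; exact: hr.
exists phi; split; first by move=> p w; exact: h1.
by apply/morph_onT; rewrite (_ : [set p | _] = setT) // in h2; apply/seteqP.
Qed.

End Cones.

(** * Projective spaces *)

Section ProjectiveSpace.
Variables (K : numFieldType) (n : nat).
Implicit Types (v w : 'rV[K]_n.+1) (p q : proj_space K n).

Definition prop v w : Prop := exists2 c : K, c != 0 & w = c *: v.

Lemma prop_refl v : prop v v.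
Proof. by exists 1; rewrite ?oner_neq0 ?scale1r. Qed.

Lemma prop_sym v w : prop v w -> prop w v.
Proof.
move=> [c c0 ->]; exists c^-1; first by rewrite invr_neq0.
by rewrite scalerA mulVf // scale1r.
Qed.

Lemma prop_trans u v w : prop u v -> prop v w -> prop u w.
Proof.
move=> [c c0 ->] [d d0 ->]; exists (d * c); first by rewrite mulf_neq0.
by rewrite scalerA.
Qed.

Lemma proj_pt v : v != 0 -> exists p, coords p v.
Proof.
move=> v0; exists (cone_pt (D := [set w | w != 0]) prop v0).
exact: coords_cone_pt.
Qed.

Lemma good_proj_space : good (proj_space K n).
Proof. exact: good_cone_space. Qed.

(** The chart is the complement of a hyperplane missing both points; representatives are normalised
    to give its linear form the value 1. *)
Lemma pair_charts_proj_space : pair_charts (proj_space K n).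
Proof.
apply: pair_charts_cone => [|||v w v0 w0].
- exact: prop_refl.
- exact: prop_sym.
- exact: prop_trans.
have [m [vm wm]] := linear_form2 v0 w0.
exists (fun x => (x *m m) 0 0), id; split => //.
- exact: polymap_mulmx.
- exact: polymap_id.
move=> x x0 dx; have xV : ((x *m m) 0 0)^-1 != 0 by rewrite invr_neq0.
split; first by rewrite /= scaler_eq0 negb_or xV.
  by exists ((x *m m) 0 0)^-1.
move=> y [c c0 ->]; rewrite -scalemxAl mxE mulf_neq0 //; split => //.
by rewrite scalerA invfM mulrAC mulVf // mul1r.
Qed.

(** Along the line joining representatives of two points, membership in [U], membership in [V] and
    being a non-zero vector each follow from the non-vanishing of a non-zero polynomial in the
    parameter; the product of the three has a non-root. *)
Lemma irreducible_proj_space : irreducible (proj_space K n).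
Proof.
move=> U V /open_cone[U' /zariski_openP oU UE] /open_cone[V' /zariski_openP oV VE].
move=> [p Up] [q Vq]; have [v pv] := coords_ex p; have [w qw] := coords_ex q.
have [f [pf fv fU]] := oU v ((UE _ _ pv).1 Up).
have [g [pg gw gV]] := oV w ((VE _ _ qw).1 Vq).
have [P hP] := polyfun_curve (polycurve_line v w) pf.
have [Q hQ] := polyfun_curve (polycurve_line v w) pg.
have /rV0Pn[i vi] : v != 0 by exact: coords_dom pv.
have [R hR] := polycurve_line v w i.
have P0 : P != 0.
  by apply: contra_neq fv => P0; rewrite -(line_through0 v w) hP P0 horner0.
have Q0 : Q != 0.
  by apply: contra_neq gw => Q0; rewrite -(line_through1 v w) hQ Q0 horner0.
have R0 : R != 0.
  by apply: contra_neq vi => R0; rewrite -[v](line_through0 v w) hR R0 horner0.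
have [u] := poly_nonroot (mulf_neq0 (mulf_neq0 P0 Q0) R0).
rewrite !hornerM !mulf_eq0 !negb_or -hP -hQ -hR => /andP[/andP[fu gu] ru].
have nz : line_through v w u != 0 by apply/rV0Pn; exists i.
have [x xu] := proj_pt nz; exists x; split.
  by apply/(UE _ _ xu); exact: fU.
by apply/(VE _ _ xu); exact: gV.
Qed.

End ProjectiveSpace.

(** * The surface Y *)

Definition o0 : 'I_3 := @Ordinal 3 0 isT.
Definition o1 : 'I_3 := @Ordinal 3 1 isT.
Definition o2 : 'I_3 := @Ordinal 3 2 isT.

Lemma ord3P (P : 'I_3 -> Prop) : P o0 -> P o1 -> P o2 -> forall i, P i.
Proof.
move=> h0 h1 h2 [[|[|[|//]]] hi].
- by rewrite (_ : Ordinal hi = o0) //; exact: val_inj.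
- by rewrite (_ : Ordinal hi = o1) //; exact: val_inj.
- by rewrite (_ : Ordinal hi = o2) //; exact: val_inj.
Qed.

Lemma ord3_third (r t : 'I_3) : r != t -> exists n, [/\ n != r, n != t &
  forall k, k != r -> k != t -> k = n].
Proof.
move: r t; apply: ord3P; apply: ord3P => // _;
  [exists o2|exists o1|exists o2|exists o0|exists o1|exists o0];
  by split => //; apply: ord3P.
Qed.

Lemma ord2P (P : 'I_2 -> Prop) : P 0 -> P 1 -> forall i, P i.
Proof.
move=> h0 h1 [[|[|//]] hi].
- by rewrite (_ : Ordinal hi = 0) //; exact: val_inj.
- by rewrite (_ : Ordinal hi = 1) //; exact: val_inj.
Qed.

Section Ord3.
Variable R : comNzRingType.

Lemma sum3 (f : 'I_3 -> R) : \sum_(k < 3) f k = f o0 + f o1 + f o2.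
Proof.
rewrite !big_ord_recl big_ord0 addr0 addrA.
by congr (f _ + f _ + f _); exact: val_inj.
Qed.

Lemma prod3 (f : 'I_3 -> R) : \prod_(k < 3) f k = f o0 * f o1 * f o2.
Proof.
rewrite !big_ord_recl big_ord0 mulr1 mulrA.
by congr (f _ * f _ * f _); exact: val_inj.
Qed.

Lemma prod3D1 (f : 'I_3 -> R) i : \prod_(k < 3 | k != i) f k =
  (if o0 != i then f o0 else 1) * (if o1 != i then f o1 else 1) *
  (if o2 != i then f o2 else 1).
Proof. by rewrite big_mkcond prod3. Qed.

Lemma sum2 (f : 'I_2 -> R) : \sum_(k < 2) f k = f 0 + f 1.
Proof.
rewrite !big_ord_recl big_ord0 addr0.
by congr (f _ + f _); exact: val_inj.
Qed.

End Ord3.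

Lemma row3P (T : Type) (a b : 'rV[T]_3) :
  a 0 o0 = b 0 o0 -> a 0 o1 = b 0 o1 -> a 0 o2 = b 0 o2 -> a = b.
Proof. by move=> *; apply/rowP; apply: ord3P. Qed.

Lemma row2P (T : Type) (a b : 'rV[T]_2) : a 0 0 = b 0 0 -> a 0 1 = b 0 1 -> a = b.
Proof. by move=> *; apply/rowP; apply: ord2P. Qed.

(** * Multihomogeneous coordinates on P^2 x P^1 x P^5 *)

Section Coordinates.
Variable K : fieldType.
Implicit Types (a : 'rV[K]_3) (b : 'rV[K]_2) (x : 'rV[K]_(3 + 3))
  (w : 'rV[K]_(3 + 2 + (3 + 3))).

Definition mkrow a b x : 'rV[K]_(3 + 2 + (3 + 3)) := row_mx (row_mx a b) x.

Lemma crd2_mk a b x : crd2 (mkrow a b x) = a.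
Proof. by rewrite /crd2 /mkrow !row_mxKl. Qed.

Lemma crd1_mk a b x : crd1 (mkrow a b x) = b.
Proof. by rewrite /crd1 /mkrow row_mxKl row_mxKr. Qed.

Lemma crd5_mk a b x : crd5 (mkrow a b x) = x.
Proof. by rewrite /crd5 /mkrow row_mxKr. Qed.

Definition crdE := (crd2_mk, crd1_mk, crd5_mk).

Lemma mk_crd w : w = mkrow (crd2 w) (crd1 w) (crd5 w).
Proof. by rewrite /mkrow /crd2 /crd1 /crd5 !hsubmxK. Qed.

Lemma polymap_mkrow n (A : 'rV[K]_n -> 'rV[K]_3) B X :
  polymap A -> polymap B -> polymap X ->
  polymap (fun v => mkrow (A v) (B v) (X v)).
Proof. by move=> pA pB pX; do 2![apply: polymap_row_mx => //]. Qed.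

Lemma polymap_crd2 : polymap (@crd2 K).
Proof.
by move=> i; rewrite /crd2 /lsubmx; under eq_fun do rewrite !mxE;
  exact: polyfun_coord.
Qed.

Lemma polymap_crd1 : polymap (@crd1 K).
Proof.
by move=> i; rewrite /crd1 /lsubmx /rsubmx; under eq_fun do rewrite !mxE;
  exact: polyfun_coord.
Qed.

Lemma polymap_crd5 : polymap (@crd5 K).
Proof.
by move=> i; rewrite /crd5 /rsubmx; under eq_fun do rewrite !mxE;
  exact: polyfun_coord.
Qed.

Lemma polymap_node_gens n (A : 'rV[K]_n -> 'rV[K]_3) B :
  polymap A -> polymap B -> polymap (fun v => node_gens (A v) (B v)).
Proof.
move=> pA pB; apply: polymap_row_mx => i; under eq_fun do rewrite mxE.
  by apply: polyfunM; [exact: pB|exact/polyfunX/pA].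
by apply: polyfunM; [exact: pB|exact/polyfun_prod].
Qed.

Lemma polyfun_bc_fibre n lam (A : 'rV[K]_n -> 'rV[K]_3) B :
  polymap A -> polymap B -> polyfun (fun v => bc_fibre lam (B v) (A v)).
Proof.
move=> pA pB; rewrite /bc_fibre /hesse /bc_m /bc_l; apply: polyfunD.
  apply: polyfunM; first exact/polyfunX/pB.
  by apply: polyfun_sum => i; exact/polyfunX/pA.
apply: polyfunM; last by apply: polyfun_prod => i; exact: pA.
apply: polyfunM; first exact: polyfun_cst.
apply: polyfunD; last exact/polyfunX/pB.
by apply: polyfunM; [exact: polyfun_cst|exact/polyfunX/pB].
Qed.

Definition yscal (v w : 'rV[K]_(3 + 2 + (3 + 3))) : Prop :=
  exists c2 c1 c5 : K, [/\ c2 != 0, c1 != 0, c5 != 0 &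
    [/\ crd2 w = c2 *: crd2 v, crd1 w = c1 *: crd1 v & crd5 w = c5 *: crd5 v]].

Lemma yscal_refl v : yscal v v.
Proof. by exists 1, 1, 1; rewrite oner_neq0 !scale1r. Qed.

Lemma yscal_sym v w : yscal v w -> yscal w v.
Proof.
move=> [c2 [c1 [c5 [n2 n1 n5 [e2 e1 e5]]]]]; exists c2^-1, c1^-1, c5^-1.
by rewrite !invr_neq0 // e2 e1 e5 !scalerA !mulVf // !scale1r.
Qed.

Lemma yscal_trans u v w : yscal u v -> yscal v w -> yscal u w.
Proof.
move=> [c2 [c1 [c5 [n2 n1 n5 [e2 e1 e5]]]]].
move=> [d2 [d1 [d5 [m2 m1 m5 [f2 f1 f5]]]]].
exists (d2 * c2), (d1 * c1), (d5 * c5).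
by rewrite !mulf_neq0 // f2 f1 f5 e2 e1 e5 !scalerA.
Qed.

Lemma node_gensZ c d a b :
  node_gens (c *: a) (d *: b) = (c ^+ 2 * d) *: node_gens a b.
Proof.
rewrite /node_gens scale_row_mx; congr row_mx; apply/rowP; apply: ord3P;
  by rewrite !mxE ?prod3D1 /= ?mxE; ring.
Qed.

Lemma bc_fibreZ lam c d a b :
  bc_fibre lam (d *: b) (c *: a) = d ^+ 2 * c ^+ 3 * bc_fibre lam b a.
Proof.
rewrite /bc_fibre /hesse /bc_m /bc_l !sum3 !prod3 !mxE; ring.
Qed.

End Coordinates.

Section Surface.
Variables (K : numClosedFieldType) (lam : K).
Implicit Types (a : 'rV[K]_3) (b : 'rV[K]_2) (x : 'rV[K]_(3 + 3))
  (v w : 'rV[K]_(3 + 2 + (3 + 3))).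
Local Notation Y := (surfY lam).
Local Notation P1 := (proj_space K 1).

Lemma graph_cone_yscal v w : yscal v w -> graph_cone lam v -> graph_cone lam w.
Proof.
move=> [c2 [c1 [c5 [n2 n1 n5 [e2 e1 e5]]]]] [h2 h1 h5 hf [c hc]].
split; rewrite ?e2 ?e1 ?e5 ?scaler_eq0 ?negb_or ?n2 ?n1 ?n5 //.
  by rewrite bc_fibreZ hf mulr0.
exists (c5 * c / (c2 ^+ 2 * c1)); rewrite node_gensZ hc !scalerA.
by rewrite divfK // mulf_neq0 // expf_neq0.
Qed.

(** Rescaling the three blocks is a polynomial map preserving the graph, so a polynomial vanishing
    on the graph still does so after composition with it. *)
Lemma Y_cone_yscal v w : yscal v w -> Y_cone lam v -> Y_cone lam w.
Proof.
move=> [c2 [c1 [c5 [n2 n1 n5 [e2 e1 e5]]]]] [h2 h1 h5 cl].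
split; rewrite ?e2 ?e1 ?e5 ?scaler_eq0 ?negb_or ?n2 ?n1 ?n5 //.
move=> f hf; pose T z := mkrow (c2 *: crd2 z) (c1 *: crd1 z) (c5 *: crd5 z).
have pT : polymap T.
  apply: polymap_mkrow; apply: polymapZ; do ?[exact: polyfun_cst];
    [exact: polymap_crd2|exact: polymap_crd1|exact: polymap_crd5].
have [g gE] : polyfun (peval f \o T) by apply: polyfun_comp => //; exists f.
rewrite (mk_crd w) e2 e1 e5 -/(T v) -[LHS]/((peval f \o T) v) gE.
apply: cl => z gz; rewrite -gE /=; apply: hf; apply: graph_cone_yscal gz.
by exists c2, c1, c5; rewrite /T !crdE.
Qed.

Lemma Y_cone_eq0 (f : 'rV[K]_(3 + 2 + (3 + 3)) -> K) : polyfun f ->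
  (forall w, graph_cone lam w -> f w = 0) -> forall w, Y_cone lam w -> f w = 0.
Proof. by move=> [p ->] h w [_ _ _]; exact. Qed.

Lemma good_surfY : good Y.
Proof. exact: good_cone_space. Qed.

Lemma pair_charts_surfY : pair_charts Y.
Proof.
apply: pair_charts_cone => [|||v w Dv Dw].
- exact: yscal_refl.
- exact: yscal_sym.
- exact: yscal_trans.
have [v2 v1 v5 _] := Dv; have [w2 w1 w5 _] := Dw.
have [m2 [mv2 mw2]] := linear_form2 v2 w2.
have [m1 [mv1 mw1]] := linear_form2 v1 w1.
have [m5 [mv5 mw5]] := linear_form2 v5 w5.
pose l2 z := (crd2 z *m m2) 0 0; pose l1 z := (crd1 z *m m1) 0 0.
pose l5 z := (crd5 z *m m5) 0 0.
have p2 : polyfun l2 := polymap_comp (@polymap_crd2 K) (polymap_mulmx m2) 0.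
have p1 : polyfun l1 := polymap_comp (@polymap_crd1 K) (polymap_mulmx m1) 0.
have p5 : polyfun l5 := polymap_comp (@polymap_crd5 K) (polymap_mulmx m5) 0.
pose d z := l2 z * l1 z * l5 z.
(* Dividing by the single scalar [d] must normalise each block by its own form, so each block is
   multiplied by the other two forms. *)
pose N z := mkrow ((l1 z * l5 z) *: crd2 z) ((l2 z * l5 z) *: crd1 z)
                  ((l2 z * l1 z) *: crd5 z).
have dZ c (a' b' : K) : d c != 0 -> [/\ l2 c != 0, l1 c != 0 & l5 c != 0].
  by rewrite /d !mulf_eq0 !negb_or => /andP[/andP[-> ->] ->].
have NE z : d z != 0 -> (d z)^-1 *: N z =
    mkrow ((l2 z)^-1 *: crd2 z) ((l1 z)^-1 *: crd1 z) ((l5 z)^-1 *: crd5 z).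
  move=> /(dZ _ 0 0)[z2 z1 z5]; rewrite /N /mkrow !scale_row_mx !scalerA /d.
  by congr (row_mx (row_mx (_ *: _) (_ *: _)) (_ *: _)); field; rewrite z2 z1 z5.
exists d, N; split.
- by apply: polyfunM => //; exact: polyfunM.
- apply: polymap_mkrow; apply: polymapZ; do ?[exact: polyfunM];
    [exact: polymap_crd2|exact: polymap_crd1|exact: polymap_crd5].
- by rewrite /d /l2 /l1 /l5 !mulf_neq0.
- by rewrite /d /l2 /l1 /l5 !mulf_neq0.
move=> z Dz dz; have [z2 z1 z5] := dZ _ 0 0 dz.
have sz : yscal z ((d z)^-1 *: N z).
  exists (l2 z)^-1, (l1 z)^-1, (l5 z)^-1.
  by rewrite NE // !crdE !invr_neq0.
split => //; first exact: Y_cone_yscal sz Dz.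
move=> y [c2 [c1 [c5 [n2 n1 n5 [e2 e1 e5]]]]].
have y2 : l2 y = c2 * l2 z by rewrite /l2 e2 -scalemxAl mxE.
have y1 : l1 y = c1 * l1 z by rewrite /l1 e1 -scalemxAl mxE.
have y5 : l5 y = c5 * l5 z by rewrite /l5 e5 -scalemxAl mxE.
have dy : d y != 0 by rewrite /d y2 y1 y5 !mulf_neq0.
split => //; rewrite !NE // y2 y1 y5 e2 e1 e5 !scalerA.
by congr mkrow; congr (_ *: _); rewrite invfM -mulrA mulrC -mulrA mulfV ?mulr1.
Qed.

(** * Polynomial arcs in the surface *)

(* Restrictions to the curve q(u) t^2 = p(u), where every polynomial function
   is of the form (A(u) + B(u) t) / q(u)^N. *)
Definition quad_fun (p q : {poly K}) (g : K -> K -> K) : Prop :=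
  exists N (A B : {poly K}), forall u t, q.[u] * t ^+ 2 = p.[u] ->
    q.[u] ^+ N * g u t = A.[u] + B.[u] * t.

Lemma quad_fun_poly p q (A : {poly K}) : quad_fun p q (fun u _ => A.[u]).
Proof.
by exists 0%N, A, 0 => u t _; rewrite expr0 mul1r horner0 mul0r addr0.
Qed.

Lemma quad_fun_cst p q c : quad_fun p q (fun _ _ => c).
Proof.
have [N [A [B h]]] := quad_fun_poly p q c%:P.
by exists N, A, B => u t E; rewrite -(h u t E) hornerC.
Qed.

Lemma quad_fun_sqrt p q : quad_fun p q (fun _ t => t).
Proof.
exists 0%N, 0, 1 => u t _.
by rewrite expr0 mul1r horner0 hornerC mul1r add0r.
Qed.

Lemma quad_fun_curve p q n (w : K -> 'rV[K]_n) : polycurve w ->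
  forall i, quad_fun p q (fun u _ => w u 0 i).
Proof.
move=> pw i; have [P hP] := pw i; have [N [A [B h]]] := quad_fun_poly p q P.
by exists N, A, B => u t E; rewrite hP; exact: h.
Qed.

Lemma quad_fun_polyfun p q n (w : K -> K -> 'rV[K]_n) f :
  (forall i, quad_fun p q (fun u t => w u t 0 i)) -> polyfun f ->
  quad_fun p q (fun u t => f (w u t)).
Proof.
move=> hw; move: f.
apply: (@polyfun_ind _ n (fun f => quad_fun p q (fun u t => f (w u t)))).
- move=> c; exists 0%N, c%:P, 0 => u t _.
  by rewrite expr0 mul1r horner0 hornerC mul0r addr0.
- exact: hw.
- move=> f g [N [A [B hf]]] [M [C [D hg]]].
  exists (N + M)%N, (q ^+ M * A + q ^+ N * C), (q ^+ M * B + q ^+ N * D) => u t h.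
  rewrite mulrDr exprD -mulrA [q.[u] ^+ M * _]mulrC mulrA hf //.
  rewrite -[_ * g _]mulrA hg // !(hornerD, hornerM, horner_exp); ring.
- move=> f g [N [A [B hf]]] [M [C [D hg]]].
  (* One more power of [q] turns the term B D t^2 of the product into B D p. *)
  exists (N + M).+1, (q * A * C + p * B * D), (q * (A * D + B * C)) => u t h.
  have -> : q.[u] ^+ (N + M).+1 * (f (w u t) * g (w u t)) =
    q.[u] * (q.[u] ^+ N * f (w u t)) * (q.[u] ^+ M * g (w u t)).
    by rewrite exprS exprD; ring.
  rewrite hf // hg // !(hornerD, hornerM) -h; ring.
Qed.

(* Both signs of t occur, so A and B vanish identically. *)
Lemma quad_closure p q (e : {poly K}) n m (w : K -> K -> 'rV[K]_n)
    (G : 'rV[K]_n -> 'rV[K]_m) (S : set 'rV[K]_m) :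
  e != 0 -> q.[0] != 0 -> polymap G ->
  (forall i, quad_fun p q (fun u t => w u t 0 i)) ->
  (forall u t, q.[u] * t ^+ 2 = p.[u] -> e.[u] != 0 -> S (G (w u t))) ->
  forall t, q.[0] * t ^+ 2 = p.[0] -> zariski_closure S (G (w 0 t)).
Proof.
move=> e0 q0 pG hw hS t ht f hf.
have [|N [A [B hAB]]] := quad_fun_polyfun hw (f := peval f \o G).
  by apply: polyfun_comp => //; exists f.
have qn0 : q != 0 by apply: contra_neq q0 => ->; rewrite horner0.
have AB u : e.[u] != 0 -> q.[u] != 0 -> A.[u] = 0 /\ B.[u] * p.[u] = 0.
  move=> eu qu; pose s := sqrtC (p.[u] / q.[u]).
  have s2 : q.[u] * s ^+ 2 = p.[u] by rewrite sqrtCK mulrC divfK.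
  have s2' : q.[u] * (- s) ^+ 2 = p.[u] by rewrite sqrrN.
  have h1 := hAB _ _ s2; have h2 := hAB _ _ s2'.
  rewrite /= (hf _ (hS _ _ s2 eu)) mulr0 in h1.
  rewrite /= (hf _ (hS _ _ s2' eu)) mulr0 mulrN in h2.
  have hA : A.[u] = 0.
    have : A.[u] *+ 2 = 0.
      have -> : A.[u] *+ 2 = (A.[u] + B.[u] * s) + (A.[u] - B.[u] * s) by ring.
      by rewrite -h1 -h2 addr0.
    by move/eqP; rewrite mulrn_eq0 /= => /eqP.
  split => //; rewrite -s2; move: h1; rewrite hA add0r => h1.
  have -> : B.[u] * (q.[u] * s ^+ 2) = B.[u] * s * q.[u] * s by ring.
  by rewrite -h1 !mul0r.
have A0 : A * e * q = 0.
  apply: poly_eq0 => u; rewrite !hornerM.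
  have [->|eu] := eqVneq e.[u] 0; first by rewrite mulr0 mul0r.
  have [->|qu] := eqVneq q.[u] 0; first by rewrite mulr0.
  by have [-> _] := AB _ eu qu; rewrite !mul0r.
have B0 : B * p * e * q = 0.
  apply: poly_eq0 => u; rewrite !hornerM.
  have [->|eu] := eqVneq e.[u] 0; first by rewrite mulr0 mul0r.
  have [->|qu] := eqVneq q.[u] 0; first by rewrite mulr0.
  by have [_ ->] := AB _ eu qu; rewrite !mul0r.
have {A0} A0 : A = 0.
  by apply/eqP; move/eqP: A0; rewrite !mulf_eq0 (negPf e0) (negPf qn0) !orbF.
have {B0} B0 : (B == 0) || (p == 0).
  by move/eqP: B0; rewrite !mulf_eq0 (negPf e0) (negPf qn0) !orbF.
have := hAB _ _ ht; rewrite A0 horner0 add0r /= => E.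
have : q.[0] ^+ N * peval f (G (w 0 t)) = 0.
  (* If [p] is zero, the only point over 0 has t = 0, so the term B t vanishes in either case. *)
  rewrite E; case/orP: B0 => /eqP Z; first by rewrite Z horner0 mul0r.
  move: ht; rewrite Z horner0 => /eqP; rewrite mulf_eq0 (negPf q0) /= sqrf_eq0.
  by move=> /eqP ->; rewrite mulr0.
by move/eqP; rewrite mulf_eq0 expf_eq0 (negPf q0) andbF /= => /eqP.
Qed.

End Surface.

(** * Density of the smooth fibres *)

Section SmoothFibresDense.
Variables (K : numClosedFieldType) (lam : K).
Implicit Types (a : 'rV[K]_3) (b : 'rV[K]_2) (x : 'rV[K]_(3 + 3))
  (v w : 'rV[K]_(3 + 2 + (3 + 3))).
Local Notation Y := (surfY lam).

Definition row2 (s t : K) : 'rV[K]_2 := \row_k (if k == 0 then s else t).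

Lemma row2_0 s t : row2 s t 0 0 = s. Proof. by rewrite mxE. Qed.
Lemma row2_1 s t : row2 s t 0 1 = t. Proof. by rewrite mxE. Qed.

Lemma row2E b : b = row2 (b 0 0) (b 0 1).
Proof. by apply: row2P; rewrite mxE. Qed.

Lemma row2_neq0 s t : (row2 s t != 0) = (s != 0) || (t != 0).
Proof.
apply/idP/orP => [/rV0Pn[k]|[h|h]].
- by rewrite mxE; case: ifP => _; [left|right].
- by apply/rV0Pn; exists 0; rewrite row2_0.
- by apply/rV0Pn; exists 1; rewrite row2_1.
Qed.

Lemma quad_fun_row2 p q (f g : K -> K -> K) : quad_fun p q f -> quad_fun p q g ->
  forall k, quad_fun p q (fun u t => row2 (f u t) (g u t) 0 k).
Proof.
move=> [N [A [B hf]]] [M [C [D hg]]]; apply: ord2P.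
  by exists N, A, B => u t E; rewrite row2_0; exact: hf.
by exists M, C, D => u t E; rewrite row2_1; exact: hg.
Qed.

Definition cubes a : K := \sum_(k < 3) a 0 k ^+ 3.
Definition xyz a : K := \prod_(k < 3) a 0 k.

Lemma polyfun_cubes : polyfun cubes.
Proof. by apply: polyfun_sum => i; apply: polyfunX; exact: polyfun_coord. Qed.

Lemma polyfun_xyz : polyfun xyz.
Proof. by apply: polyfun_prod => i; exact: polyfun_coord. Qed.

Lemma bc_fibreE a b : bc_fibre lam b a =
  b 0 0 ^+ 2 * cubes a + 3%:R * (lam * b 0 0 ^+ 2 + b 0 1 ^+ 2) * xyz a.
Proof. by []. Qed.

(** The member through [a] has lambda = - cubes a / (3 xyz a), so lambda^3 = -1 becomes cubes^3 = 27
    xyz^3, a condition on [a] alone that can be tested along a line in the plane. *)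
Lemma smooth_fibre_of_cubic a b : b 0 0 != 0 -> xyz a != 0 ->
  cubes a ^+ 3 != 27%:R * xyz a ^+ 3 -> bc_fibre lam b a = 0 ->
  smooth_fibre lam b.
Proof.
move=> s0 P0 nE /eqP; rewrite bc_fibreE => hF; split; first by rewrite expf_neq0.
apply: contra_neq nE => hs; apply/eqP; rewrite -subr_eq0.
have s3 : b 0 0 ^+ 6 != 0 by rewrite expf_neq0.
rewrite -(inj_eq (mulfI s3)) mulr0.
move: hF; rewrite addr_eq0 => /eqP hF.
have -> : b 0 0 ^+ 6 * (cubes a ^+ 3 - 27%:R * xyz a ^+ 3) =
  (b 0 0 ^+ 2 * cubes a) ^+ 3 - 27%:R * b 0 0 ^+ 6 * xyz a ^+ 3 by ring.
rewrite hF -[X in _ == X](mulr0 (- 27%:R * xyz a ^+ 3)) -hs /bc_m /bc_l.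
by apply/eqP; ring.
Qed.

Lemma node_gens_neq0 a b : b 0 0 != 0 -> a != 0 -> node_gens a b != 0.
Proof.
move=> b0 /rV0Pn[i ai]; apply/rV0Pn; exists (lshift 3 i).
by rewrite row_mxEl mxE mulf_neq0 // expf_neq0.
Qed.

Definition disc b : K := bc_m b * (bc_m b ^+ 3 + bc_l lam b ^+ 3).

Lemma polyfun_disc : polyfun disc.
Proof.
have pm : polyfun (@bc_m K) by apply: polyfunX; exact: polyfun_coord.
have pl : polyfun (bc_l lam).
  apply: polyfunD; last by apply: polyfunX; exact: polyfun_coord.
  by apply: polyfunM; [exact: polyfun_cst|apply: polyfunX; exact: polyfun_coord].
by apply: polyfunM => //; apply: polyfunD; exact: polyfunX.
Qed.

(** The choice t^2 = - lam gives lambda = 0, the Fermat cubic. *)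
Lemma smooth_fibre_ex : smooth_fibre lam (row2 1 (sqrtC (- lam))).
Proof.
rewrite /smooth_fibre /bc_m /bc_l row2_0 row2_1 sqrtCK.
have -> : lam * 1 ^+ 2 + - lam = 0 by ring.
by rewrite !expr1n expr0n addr0 oner_neq0.
Qed.

Definition smooth_graph : set 'rV[K]_(3 + 2 + (3 + 3)) :=
  [set v | graph_cone lam v /\ smooth_fibre lam (crd1 v)].

(* A point on a smooth member of the pencil, towards which the points of P^2
   are moved along lines. *)
Let a1 : 'rV[K]_3 := \row_k (if k == o2 then -1 else 1).

Let cubes_a1 : cubes a1 = 1.
Proof. by rewrite /cubes sum3 !mxE /=; ring. Qed.

Let xyz_a1 : xyz a1 = -1.
Proof. by rewrite /xyz prod3 !mxE /=; ring. Qed.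

Let G c (z : 'rV[K]_(3 + 2)) :=
  mkrow (lsubmx z) (rsubmx z) (c *: node_gens (lsubmx z) (rsubmx z)).

Let pG c : polymap (G c).
Proof.
have pl : polymap (fun z : 'rV[K]_(3 + 2) => lsubmx z).
  by move=> i; under eq_fun do rewrite mxE; exact: polyfun_coord.
have pr : polymap (fun z : 'rV[K]_(3 + 2) => rsubmx z).
  by move=> i; under eq_fun do rewrite mxE; exact: polyfun_coord.
apply: polymap_mkrow => //; apply: polymapZ; first exact: polyfun_cst.
exact: polymap_node_gens.
Qed.

Let G_smooth c a b : c != 0 -> a != 0 -> bc_fibre lam b a = 0 ->
  smooth_fibre lam b -> smooth_graph (G c (row_mx a b)).
Proof.
move=> c0 a0 F0 sb; rewrite /G !row_mxKl !row_mxKr.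
have b0 : b 0 0 != 0 by case: sb; rewrite /bc_m expf_eq0.
split; last by rewrite crdE.
split; rewrite ?crdE //.
- by apply/rV0Pn; exists 0.
- by rewrite scaler_eq0 negb_or c0 node_gens_neq0.
- by exists c.
Qed.

Let deform_poly a : exists2 P : {poly K} * {poly K},
  (forall u, cubes (line_through a a1 u) = P.1.[u]) /\
  (forall u, xyz (line_through a a1 u) = P.2.[u]) &
  P.2 * (P.1 ^+ 3 - 27%:R *: P.2 ^+ 3) != 0.
Proof.
have [P hP] := polyfun_curve (polycurve_line a a1) polyfun_cubes.
have [Q hQ] := polyfun_curve (polycurve_line a a1) polyfun_xyz.
exists (P, Q) => //=; apply/negP => /eqP E.
have := congr1 (fun p => p.[1]) E.
rewrite hornerM hornerD hornerN hornerZ !horner_exp -hP -hQ horner0.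
rewrite line_through1 cubes_a1 xyz_a1 => /eqP.
have -> : -1 * (1 ^+ 3 - 27%:R * (-1) ^+ 3) = - 28%:R :> K by ring.
by rewrite oppr_eq0 pnatr_eq0.
Qed.

(** Every point is joined to the smooth fibres by an arc. The fibre equation is linear in s^2 and
    t^2, so moving the plane point along a line towards [a1] and solving for s or t gives a double
    cover of the line, to which [quad_closure] applies. Which variable is solved for depends on the
    coefficient that survives at the start. *)
Lemma graph_cone_smooth_closure w :
  graph_cone lam w -> zariski_closure smooth_graph w.
Proof.
move=> [n2 n1 n5 F0 [c cE]]; rewrite (mk_crd w) cE.
set a := crd2 w in n2 F0 cE *; set b := crd1 w in n1 F0 cE *.
have c0 : c != 0.
  by apply: contra_neq n5 => c0; rewrite cE c0 scale0r.
have g0 : node_gens a b != 0.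
  by apply: contra_neq n5 => g0; rewrite cE g0 scaler0.
have -> : mkrow a b (c *: node_gens a b) = G c (row_mx a b).
  by rewrite /G row_mxKl row_mxKr.
have rowE p q (f : K -> K -> 'rV[K]_2) (l : K -> 'rV[K]_3) : polycurve l ->
    (forall k, quad_fun p q (fun u t => f u t 0 k)) ->
    forall k, quad_fun p q (fun u t => row_mx (l u) (f u t) 0 k).
  move=> pl hf k; case: (split_ordP k) => m ->.
    have [N [A [B h]]] := quad_fun_curve p q pl m.
    by exists N, A, B => u t E; rewrite row_mxEl; exact: h.
  have [N [A [B h]]] := hf m.
  by exists N, A, B => u t E; rewrite row_mxEr; exact: h.
have [sb|nsb] := pselect (smooth_fibre lam b).
  move=> f hf; apply: hf; exact: G_smooth.
have [[P Q] /= [hP hQ] PQ0] := deform_poly a.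
have lt0 : line_through a a1 0 = a := line_through0 a a1.
have P0 : P.[0] = cubes a by rewrite -hP lt0.
have Q0 : Q.[0] = xyz a by rewrite -hQ lt0.
have PQu u : (Q * (P ^+ 3 - 27%:R *: Q ^+ 3)).[u] != 0 ->
    xyz (line_through a a1 u) != 0 /\
    cubes (line_through a a1 u) ^+ 3 != 27%:R * xyz (line_through a a1 u) ^+ 3.
  rewrite hornerM hornerD hornerN hornerZ !horner_exp mulf_eq0 negb_or -hP -hQ.
  by rewrite subr_eq0 => /andP[].
have nz a' : xyz a' != 0 -> a' != 0.
  by apply: contra_neq => ->; rewrite /xyz prod3 !mxE mul0r mul0r.
(* The coefficient 3 xyz of t^2 is non-zero at the start: keep s and solve for t. *)
have [xa|xa] := eqVneq (xyz a) 0; last first.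
  have s0 : b 0 0 != 0.
    apply: contra_neq xa => s0; move: F0; rewrite bc_fibreE s0 expr0n /= mul0r.
    rewrite mulr0 !add0r => /eqP; rewrite mulf_eq0 mulf_eq0 pnatr_eq0 sqrf_eq0.
    move=> /orP[/eqP t0|/eqP //]; move: n1.
    by rewrite (row2E b) s0 t0 row2_neq0 eqxx.
  pose p := - ((b 0 0 ^+ 2) *: (P + (3%:R * lam) *: Q)); pose q := 3%:R *: Q.
  have := @quad_closure _ p q (Q * (P ^+ 3 - 27%:R *: Q ^+ 3)) _ _
    (fun u t => row_mx (line_through a a1 u) (row2 (b 0 0) t)) (G c) smooth_graph
    PQ0 _ (pG c) _ _ (b 0 1).
  rewrite lt0 -row2E; apply.
  - by rewrite hornerZ Q0 mulf_neq0 // pnatr_eq0.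
  - apply: rowE; first exact: polycurve_line.
    exact: quad_fun_row2 (quad_fun_cst p q (b 0 0)) (quad_fun_sqrt p q).
  - move=> u t E /PQu[x0 xc].
    have F : bc_fibre lam (row2 (b 0 0) t) (line_through a a1 u) = 0.
      rewrite bc_fibreE row2_0 row2_1; move: E.
      rewrite /p /q !(hornerZ, hornerN, hornerD) -hP -hQ => E.
      have -> : b 0 0 ^+ 2 * cubes (line_through a a1 u) +
         3%:R * (lam * b 0 0 ^+ 2 + t ^+ 2) * xyz (line_through a a1 u) =
         b 0 0 ^+ 2 * (cubes (line_through a a1 u) +
           3%:R * lam * xyz (line_through a a1 u)) +
         3%:R * xyz (line_through a a1 u) * t ^+ 2 by ring.
      by rewrite E addrN.
    apply: G_smooth => //; first exact: nz.
    by apply: smooth_fibre_of_cubic F => //; rewrite row2_0.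
  - rewrite /p /q !(hornerZ, hornerN, hornerD) P0 Q0.
    apply/eqP; rewrite -addr_eq0 -F0 bc_fibreE; apply/eqP; ring.
(* A base point lies on every member, so the plane point stays fixed and only [b] moves; the cover
   degenerates to t = 0, with p = 0 and q = 1. *)
have [ca|ca] := eqVneq (cubes a) 0.
  pose b1 := row2 1 (sqrtC (- lam)).
  have [e he] := polyfun_curve (polycurve_line b b1) polyfun_disc.
  have e0 : e != 0.
    apply/negP => /eqP e0; have := he 1; rewrite e0 horner0 line_through1.
    by move/eqP; rewrite /disc mulf_eq0; case: smooth_fibre_ex => /negPf-> /negPf->.
  have := @quad_closure _ 0 1 e _ _ (fun u t => row_mx a (line_through b b1 u))
    (G c) smooth_graph e0 _ (pG c) _ _ 0.
  rewrite line_through0; apply.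
  - by rewrite hornerC oner_eq0.
  - apply: (rowE 0 1 (fun u _ => line_through b b1 u) (fun=> a)).
      by move=> m; exists (a 0 m)%:P => u; rewrite hornerC.
    exact: quad_fun_curve (polycurve_line b b1).
  - move=> u t _; rewrite -he /disc mulf_eq0 negb_or => /andP[m0 d0].
    by apply: G_smooth => //; rewrite bc_fibreE ca xa !mulr0 addr0.
  - by rewrite horner0 expr0n mulr0.
(* Now s = 0, and the coefficient of s^2 equals [cubes a] at the start: keep t and solve for s. *)
have s0 : b 0 0 = 0.
  move/eqP: F0; rewrite bc_fibreE xa mulr0 addr0 mulf_eq0 sqrf_eq0.
  by rewrite (negPf ca) orbF => /eqP.
have t0 : b 0 1 != 0.
  by move: n1; rewrite (row2E b) s0 row2_neq0 eqxx /= row2_1.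
pose p := - ((3%:R * b 0 1 ^+ 2) *: Q); pose q := P + (3%:R * lam) *: Q.
have := @quad_closure _ p q (Q * (P ^+ 3 - 27%:R *: Q ^+ 3)) _ _
  (fun u t => row_mx (line_through a a1 u) (row2 t (b 0 1))) (G c) smooth_graph
  PQ0 _ (pG c) _ _ (b 0 0).
rewrite lt0 -row2E; apply.
- by rewrite hornerD hornerZ P0 Q0 xa mulr0 addr0.
- apply: rowE; first exact: polycurve_line.
  exact: quad_fun_row2 (quad_fun_sqrt p q) (quad_fun_cst p q (b 0 1)).
- move=> u t E /PQu[x0 xc].
  have F : bc_fibre lam (row2 t (b 0 1)) (line_through a a1 u) = 0.
    rewrite bc_fibreE row2_0 row2_1; move: E.
    rewrite /p /q !(hornerZ, hornerN, hornerD) -hP -hQ => E.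
    have -> : t ^+ 2 * cubes (line_through a a1 u) +
       3%:R * (lam * t ^+ 2 + b 0 1 ^+ 2) * xyz (line_through a a1 u) =
       (cubes (line_through a a1 u) +
         3%:R * lam * xyz (line_through a a1 u)) * t ^+ 2 +
       3%:R * b 0 1 ^+ 2 * xyz (line_through a a1 u) by ring.
    by rewrite E addNr.
  apply: G_smooth => //; first exact: nz.
  apply: smooth_fibre_of_cubic F => //; rewrite row2_0.
  apply: contra_neq x0 => t00; move: E.
  rewrite t00 expr0n mulr0 /p hornerN hornerZ -hQ => /esym/eqP.
  by rewrite oppr_eq0 mulf_eq0 mulf_eq0 pnatr_eq0 sqrf_eq0 (negPf t0) => /eqP.
- by rewrite s0 expr0n mulr0 /p hornerN hornerZ Q0 xa mulr0 oppr0.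
Qed.

Lemma Y_cone_smooth_closure w :
  Y_cone lam w -> zariski_closure smooth_graph w.
Proof.
move=> [_ _ _ cl] f hf; apply: cl => v gv.
exact: (graph_cone_smooth_closure gv).
Qed.

(** A polynomial vanishing on the smooth part of the graph vanishes on the whole closure, so it
    cannot single out an open set missing the smooth fibres. *)
Lemma smooth_fibres_dense :
  dense [set y : Y | exists w, coords y w /\ smooth_graph w].
Proof.
move=> U /open_cone[V /zariski_openP oV VE] [y Uy].
have [w yw] := coords_ex y.
have [q [pq qw qV]] := oV w ((VE _ _ yw).1 Uy).
have [v [sv qv]] : exists v, smooth_graph v /\ q v != 0.
  apply: contrapT => h; have [p pE] := pq; move: qw; rewrite pE.
  rewrite (Y_cone_smooth_closure (coords_dom yw)) ?eqxx // => v sv.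
  apply/eqP/negPn/negP => qv; apply: h; exists v; split => //.
  by rewrite pE.
have Dv : Y_cone lam v.
  have [gv _] := sv; have [v2 v1 v5 _ _] := gv.
  by split => // f hf; exact: hf.
exists (cone_pt (@yscal K) Dv); split; last first.
  by exists v; split => //; exact: coords_cone_pt.
by apply/(VE _ _ (coords_cone_pt _ Dv)); exact: qV.
Qed.

End SmoothFibresDense.

(** * The group law on smooth members of the Hesse pencil *)

Section LinearAlgebra.
Variable K : fieldType.

Lemma col_prop_of_ker d (n g : 'cV[K]_d) :
  (forall w : 'rV[K]_d, w *m n = 0 -> w *m g = 0) -> exists c, g = c *: n.
Proof.
move=> h; suff /sub_rVP[c E] : (g^T <= n^T)%MS.
  by exists c; apply: trmx_inj; rewrite E linearZ.
rewrite submxE; apply/eqP/trmx_inj; rewrite trmx_mul trmxK trmx0.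
have E : (cokermx n^T)^T *m n = 0.
  by apply: trmx_inj; rewrite trmx_mul trmxK mulmx_coker trmx0.
by apply/row_matrixP => i; rewrite row_mul h ?row0 // -row_mul E row0.
Qed.

(** [z] witnesses that [m] is not a multiple of [n], so the two forms have rank two and a
    one-dimensional common kernel. *)
Lemma row_prop_in_ker (n m : 'cV[K]_3) (x y z : 'rV[K]_3) : n != 0 ->
  z *m n = 0 -> z *m m != 0 -> x *m n = 0 -> x *m m = 0 ->
  y *m n = 0 -> y *m m = 0 -> x != 0 -> exists c, y = c *: x.
Proof.
move=> n0 zn zm xn xm yn ym x0.
pose A := row_mx n m.
have rA : (1 < \rank A)%N.
  have rn : \rank n^T = 1%N by rewrite rank_rV -trmx0 (inj_eq trmx_inj) n0.
  rewrite -mxrank_tr tr_row_mx ltnNge; apply/negP => le1.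
  have nA : (n^T <= col_mx n^T m^T)%MS by rewrite -addsmxE addsmxSl.
  have mA : (m^T <= col_mx n^T m^T)%MS by rewrite -addsmxE addsmxSr.
  have An : (col_mx n^T m^T <= n^T)%MS.
    by rewrite -(mxrank_leqif_sup nA) rn eqn_leq le1 -[X in (X <= _)%N]rn mxrankS.
  have /sub_rVP[c mE] := submx_trans mA An.
  move: zm; rewrite -[m]trmxK mE linearZ /= trmxK -scalemxAr zn scaler0.
  by rewrite eqxx.
have kA (v : 'rV[K]_3) : v *m n = 0 -> v *m m = 0 -> (v <= kermx A)%MS.
  by move=> vn vm; apply/sub_kermxP; rewrite mul_mx_row vn vm row_mx0.
have xk := kA _ xn xm; have yk := kA _ yn ym.
apply/sub_rVP; apply: submx_trans yk _.
rewrite -(mxrank_leqif_sup xk) rank_rV x0 mxrank_ker.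
have : (0 < \rank (kermx A))%N.
  by rewrite lt0n mxrank_eq0; apply: contraNneq x0 => k0; rewrite k0 submx0 in xk.
by rewrite mxrank_ker; case: (\rank A) rA => [|[|[|r]]].
Qed.

(** This is [row_prop_in_ker] in the dual plane, with [p] and [q] as linear forms; their
    non-proportionality supplies the witness [z]. *)
Lemma line_unique (n n' : 'cV[K]_3) (p q : 'rV[K]_3) : n != 0 -> n' != 0 ->
  p != 0 -> (forall c, q <> c *: p) -> p *m n = 0 -> q *m n = 0 ->
  p *m n' = 0 -> q *m n' = 0 -> exists c, n' = c *: n.
Proof.
move=> n0 n0' p0 pq pn qn pn' qn'.
have trm (a : 'rV[K]_3) (b : 'cV[K]_3) : a *m b = 0 -> b^T *m a^T = 0.
  by move=> E; rewrite -trmx_mul E trmx0.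
have [z [zp zq]] : exists z : 'rV[K]_3, z *m p^T = 0 /\ z *m q^T != 0.
  apply: contrapT => h.
  have [w wp|c E] := @col_prop_of_ker _ p^T q^T.
    by apply/eqP/negPn/negP => wq; apply: h; exists w.
  by apply: (pq c); apply: trmx_inj; rewrite linearZ /= E.
have nt (b : 'cV[K]_3) : b != 0 -> b^T != 0.
  by move=> b0; rewrite -trmx0 (inj_eq trmx_inj).
have pt : p^T != 0 by rewrite -trmx0 (inj_eq trmx_inj).
have [c E] := row_prop_in_ker pt zp zq (trm _ _ pn) (trm _ _ qn) (trm _ _ pn')
  (trm _ _ qn') (nt _ n0).
by exists c; apply: trmx_inj; rewrite linearZ /= E.
Qed.

End LinearAlgebra.

(** * Smooth Hesse cubics: absence of lines, smoothness, uniqueness of the third point *)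

Section HesseCubic.
Variables (K : numFieldType) (m l : K).
Hypotheses (m0 : m != 0) (disc0 : m ^+ 3 + l ^+ 3 != 0).
Implicit Types (a o p q r s w x y z : 'rV[K]_3) (n g : 'cV[K]_3).
Local Notation F := (hesse m l).

Lemma mx11_eq0 (A : 'M[K]_1) : (A == 0) = (A 0 0 == 0).
Proof.
apply/eqP/eqP => [->|h]; first by rewrite mxE.
by apply/matrixP => i k; rewrite !ord1 h mxE.
Qed.

Let addZ00 (A B : 'M[K]_1) t : (A + t *: B) 0 0 = A 0 0 + t * B 0 0.
Proof. by rewrite !mxE. Qed.

Let subZ00 (A B : 'M[K]_1) t : (A - t *: B) 0 0 = A 0 0 - t * B 0 0.
Proof. by rewrite !mxE. Qed.

Lemma hesse3 a : F a = m * (a 0 o0 ^+ 3 + a 0 o1 ^+ 3 + a 0 o2 ^+ 3) +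
  3%:R * l * (a 0 o0 * a 0 o1 * a 0 o2).
Proof. by rewrite /hesse sum3 prod3. Qed.

(** On the line z = c x + d y, the values at (1,0), (0,1), (1,1) and (1,-1) give c^3 = d^3 = -1 and
    (c + d)(m c d + l) = (c - d)(m c d + l) = 0. So either l = - m c d, against the discriminant, or
    c = 0. *)
Let no_line_aux (c d : K) : (forall x y : K,
  m * (x ^+ 3 + y ^+ 3 + (c * x + d * y) ^+ 3) +
  3%:R * l * (x * y * (c * x + d * y)) = 0) -> False.
Proof.
move=> h; move: disc0.
have hc : c ^+ 3 = -1.
  apply: (mulfI m0); apply/eqP; rewrite -subr_eq0 -(h 1 0); apply/eqP; ring.
have hd : d ^+ 3 = -1.
  apply: (mulfI m0); apply/eqP; rewrite -subr_eq0 -(h 0 1); apply/eqP; ring.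
have c0 : c != 0.
  by apply/eqP => c0; move/eqP: hc; rewrite c0 expr0n eq_sym oppr_eq0 oner_eq0.
have h1 : (c + d) * (m * c * d + l) = 0.
  apply: (@mulfI _ 3%:R); first by rewrite pnatr_eq0.
  rewrite mulr0 -(h 1 1).
  have -> : (c * 1 + d * 1) ^+ 3 =
    c ^+ 3 + d ^+ 3 + 3%:R * c * d * (c + d) by ring.
  rewrite hc hd; ring.
have h2 : (c - d) * (m * c * d + l) = 0.
  apply: (@mulfI _ (- 3%:R)); first by rewrite oppr_eq0 pnatr_eq0.
  rewrite mulr0 -(h 1 (-1)).
  have -> : (c * 1 + d * (-1)) ^+ 3 =
    c ^+ 3 - d ^+ 3 - 3%:R * c * d * (c - d) by ring.
  rewrite hc hd; ring.
have [E|E] := eqVneq (m * c * d + l) 0.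
  have -> : l = - (m * c * d) by apply/eqP; rewrite -addr_eq0 addrC E.
  have -> : m ^+ 3 + (- (m * c * d)) ^+ 3 = m ^+ 3 * (1 - c ^+ 3 * d ^+ 3) by ring.
  by rewrite hc hd mulrNN mul1r subrr mulr0 eqxx.
move/eqP: h1 h2; rewrite mulf_eq0 (negPf E) orbF => /eqP h1.
move/eqP; rewrite mulf_eq0 (negPf E) orbF => /eqP h2.
have : c *+ 2 = (c + d) + (c - d) by ring.
by rewrite h1 h2 addr0 => /eqP; rewrite mulrn_eq0 (negPf c0).
Qed.

Lemma hesse_no_line n : n != 0 -> exists z, z *m n = 0 /\ F z != 0.
Proof.
move=> n0; apply: contrapT => h.
have {}h z : z *m n = 0 -> F z = 0.
  by move=> zn; apply/eqP/negPn/negP => Fz; apply: h; exists z.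
have mulE z : z *m n = 0 <->
    z 0 o0 * n o0 0 + z 0 o1 * n o1 0 + z 0 o2 * n o2 0 = 0.
  split=> [/(congr1 (fun A : 'M_1 => A 0 0))|E]; first by rewrite !mxE sum3.
  by apply/eqP; rewrite mx11_eq0 mxE sum3 E.
have [k nk] : exists i, n i 0 != 0.
  apply: contrapT => hn; move/eqP: n0; apply; apply/colP => i; rewrite mxE.
  by apply/eqP/negPn/negP => ni; apply: hn; exists i.
move: k nk; apply: ord3P => ni.
- apply: (@no_line_aux (- n o1 0 / n o0 0) (- n o2 0 / n o0 0)) => x y.
  pose z : 'rV[K]_3 := \row_k (if k == o0 then
    - n o1 0 / n o0 0 * x + - n o2 0 / n o0 0 * y else if k == o1 then x else y).
  have /h : z *m n = 0 by apply/mulE; rewrite !mxE /=; field.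
  by rewrite hesse3 !mxE /= => <-; ring.
- apply: (@no_line_aux (- n o0 0 / n o1 0) (- n o2 0 / n o1 0)) => x y.
  pose z : 'rV[K]_3 := \row_k (if k == o1 then
    - n o0 0 / n o1 0 * x + - n o2 0 / n o1 0 * y else if k == o0 then x else y).
  have /h : z *m n = 0 by apply/mulE; rewrite !mxE /=; field.
  by rewrite hesse3 !mxE /= => <-; ring.
- apply: (@no_line_aux (- n o0 0 / n o2 0) (- n o1 0 / n o2 0)) => x y.
  pose z : 'rV[K]_3 := \row_k (if k == o2 then
    - n o0 0 / n o2 0 * x + - n o1 0 / n o2 0 * y else if k == o0 then x else y).
  have /h : z *m n = 0 by apply/mulE; rewrite !mxE /=; field.
  by rewrite hesse3 !mxE /= => <-; ring.
Qed.

Let grad p : 'cV[K]_3 := \col_k (3%:R * m * p 0 k ^+ 2 +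
  3%:R * l * \prod_(i < 3 | i != k) p 0 i).

(** At a singular point (m^3 + l^3) (X Y Z)^2 = 0, so one coordinate is zero, and the partial
    derivatives then kill the other two. *)
Let grad_neq0 p : p != 0 -> grad p != 0.
Proof.
apply: contra_neq => /matrixP g0.
have e k : m * p 0 k ^+ 2 + l * \prod_(i < 3 | i != k) p 0 i = 0.
  apply: (@mulfI _ 3%:R); first by rewrite pnatr_eq0.
  by have := g0 k 0; rewrite !mxE mulr0 => E; rewrite -[RHS]E; ring.
have := e o0; have := e o1; have := e o2; rewrite !prod3D1 /= !mul1r !mulr1.
set X := p 0 o0; set Y := p 0 o1; set Z := p 0 o2 => e2 e1 e0.
have sq u : m * u ^+ 2 + 0 = 0 -> u = 0.
  by move=> /eqP; rewrite addr0 mulf_eq0 (negPf m0) sqrf_eq0 => /eqP.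
have : X * Y * Z = 0.
  apply/eqP; rewrite -sqrf_eq0 -(inj_eq (mulfI disc0)) mulr0.
  (* An explicit certificate that the left side lies in the ideal of the partial derivatives. *)
  have -> : (m ^+ 3 + l ^+ 3) * (X * Y * Z) ^+ 2 =
     (m * X ^+ 2 + l * (Y * Z)) * (m ^+ 2 * Y ^+ 2 * Z ^+ 2)
     - (m * Y ^+ 2 + l * (X * Z)) * (l * (Y * Z) * m * Z ^+ 2)
     + (m * Z ^+ 2 + l * (X * Y)) * (l ^+ 2 * X * Y * Z ^+ 2) by ring.
  by rewrite e0 e1 e2 !mul0r subr0 addr0.
move/eqP; rewrite !mulf_eq0 => /orP[/orP[]|] /eqP E;
  move: e0 e1 e2; rewrite E !(mul0r, mulr0).
- by move=> _ /sq Y0 /sq Z0; apply: row3P; rewrite mxE.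
- by move=> /sq X0 _ /sq Z0; apply: row3P; rewrite mxE.
- by move=> /sq X0 /sq Y0 _; apply: row3P; rewrite mxE.
Qed.

Lemma triple_swap p q r : collinear_triple F p q r -> collinear_triple F q p r.
Proof.
move=> [n [n1 [n2 [n3 [[n0 pn qn rn] [pn1 qn2 rn3 hF]]]]]].
exists n, n2, n1, n3; split; split => // x xn.
by rewrite hF // [_ * (x *m n1) 0 0]mulrC.
Qed.

Lemma triple_rot p q r : collinear_triple F p q r -> collinear_triple F q r p.
Proof.
move=> [n [n1 [n2 [n3 [[n0 pn qn rn] [pn1 qn2 rn3 hF]]]]]].
exists n, n2, n3, n1; split; split => // x xn.
by rewrite hF // -mulrA mulrC.
Qed.

Lemma triple_prop p q r p' : prop p p' ->
  collinear_triple F p q r -> collinear_triple F p' q r.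
Proof.
move=> [c _ ->] [n [n1 [n2 [n3 [[n0 pn qn rn] [pn1 qn2 rn3 hF]]]]]].
exists n, n1, n2, n3; split; split => //.
  by rewrite -scalemxAl pn scaler0.
by rewrite -scalemxAl pn1 scaler0.
Qed.

Lemma propP p q : p != 0 -> q != 0 -> (exists c, q = c *: p) -> prop p q.
Proof.
move=> p0 q0 [c E]; exists c => //.
by apply: contra_neq q0 => c0; rewrite E c0 scale0r.
Qed.

(* A double root of F on the line n at p makes n the tangent line at p. *)
Let tangent_line n n1 n2 n3 p : p *m n = 0 -> p *m n1 = 0 -> p *m n2 = 0 ->
  (forall x, x *m n = 0 ->
     F x = (x *m n1) 0 0 * (x *m n2) 0 0 * (x *m n3) 0 0) ->
  exists c, grad p = c *: n.
Proof.
move=> pn p1 p2 hF; apply: col_prop_of_ker => w wn; apply/eqP.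
rewrite mx11_eq0 mxE sum3 !mxE !prod3D1 /= !mul1r !mulr1.
set A := w *m n1; set B := w *m n2; set C := w *m n3; set D := p *m n3.
have E t : F (p + t *: w) = t ^+ 2 * (A 0 0 * B 0 0 * (D 0 0 + t * C 0 0)).
  rewrite hF; last by rewrite mulmxDl -scalemxAl pn wn scaler0 addr0.
  rewrite !mulmxDl -!scalemxAl p1 p2 !add0r -/A -/B -/C -/D !mxE; ring.
have E1 := E 1; have E2 := E (-1); have E3 := E 2%:R; have E4 := E (- 2%:R).
move: E1 E2 E3 E4 {E}; rewrite !hesse3.
move: (A 0 0) (B 0 0) (C 0 0) (D 0 0) => {}A {}B {}C {}D.
rewrite !mxE => E1 E2 E3 E4.
(* For the values of F at p + t w, the combination 8 (F(1) - F(-1)) - (F(2) - F(-2)) removes the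
   even and cubic terms and leaves 12 times the linear coefficient, which is [grad p] applied to
   [w]; the double root makes it zero. *)
have s0 : 12%:R != 0 :> K by rewrite pnatr_eq0.
apply/eqP; apply: (mulfI s0); rewrite mulr0.
pose f1 := 8%:R * (1 ^+ 2 * (A * B * (D + 1 * C)))
  - 8%:R * ((-1) ^+ 2 * (A * B * (D + (-1) * C)))
  - 2%:R ^+ 2 * (A * B * (D + 2%:R * C))
  + (- 2%:R) ^+ 2 * (A * B * (D + (- 2%:R) * C)).
have -> : 0 = f1 by rewrite /f1; ring.
rewrite /f1 -E1 -E2 -E3 -E4; ring.
Qed.

(** Both triples lie on one line, the join of [p] and [q], or the tangent at [p] when they coincide.
    On it the first two factors of the two factorisations agree up to scalars, hence so do the third
    ones, whose zeros are [r] and [r']. *)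
Lemma third_point_unique p q r r' : p != 0 -> q != 0 -> r != 0 -> r' != 0 ->
  collinear_triple F p q r -> collinear_triple F p q r' -> prop r r'.
Proof.
move=> p0 q0 r0 r0'.
move=> [n [n1 [n2 [n3 [[n0 pn qn rn] [pn1 qn2 rn3 hF]]]]]].
move=> [n' [n1' [n2' [n3' [[n0' pn' qn' rn'] [pn1' qn2' rn3' hF']]]]]].
have [d nE] : exists c, n' = c *: n.
  have [[c qE]|npq] := pselect (exists c, q = c *: p); last first.
    by apply: (line_unique n0 n0' p0 _ pn qn) => // c E; apply: npq; exists c.
  have c0 : c != 0 by apply: contra_neq q0 => c0; rewrite qE c0 scale0r.
  have kill (u : 'cV[K]_3) : q *m u = 0 -> p *m u = 0.
    rewrite qE -scalemxAl => /eqP; rewrite scaler_eq0 (negPf c0) /=.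
    by move/eqP.
  have [d dE] := tangent_line pn pn1 (kill _ qn2) hF.
  have [d' dE'] := tangent_line pn' pn1' (kill _ qn2') hF'.
  have g0 := grad_neq0 p0.
  have d'0 : d' != 0 by apply: contra_neq g0 => z; rewrite dE' z scale0r.
  by exists (d'^-1 * d); rewrite -scalerA -dE dE' scalerA mulVf // scale1r.
have d0 : d != 0 by apply: contra_neq n0' => z; rewrite nE z scale0r.
have on' x : x *m n = 0 -> x *m n' = 0.
  by move=> xn; rewrite nE -scalemxAr xn scaler0.
have rn2 : r' *m n = 0.
  move/eqP: rn'; rewrite nE -scalemxAr scaler_eq0 (negPf d0) /=; exact/eqP.
have [z [zn Fz]] := hesse_no_line n0.
have := Fz; rewrite hF // !mulf_eq0 !negb_or => /andP[/andP[z1 z2] z3].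
have := Fz; rewrite hF' ?on' // !mulf_eq0 !negb_or => /andP[/andP[z1' z2'] z3'].
have nz (u : 'cV[K]_3) : (z *m u) 0 0 != 0 -> z *m u != 0 by rewrite mx11_eq0.
(* Two forms vanishing at the same point [y] of the line are proportional on it; the ratio is
   measured at [z]. *)
have scal (u u' : 'cV[K]_3) y x : y != 0 -> y *m n = 0 -> y *m u = 0 ->
    y *m u' = 0 -> (z *m u) 0 0 != 0 -> x *m n = 0 ->
    (x *m u') 0 0 = (z *m u') 0 0 / (z *m u) 0 0 * (x *m u) 0 0.
  move=> y0 yn yu yu' zu xn; pose t := (x *m u) 0 0 / (z *m u) 0 0.
  have [c cE] : exists c, x - t *: z = c *: y.
    apply: (@row_prop_in_ker _ n u y _ z) => //; first exact: nz.
      by rewrite mulmxBl -scalemxAl xn zn scaler0 subr0.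
    apply/eqP; rewrite mulmxBl -scalemxAl mx11_eq0 subZ00.
    by rewrite /t divfK // subrr.
  have : (x - t *: z) *m u' = 0 by rewrite cE -scalemxAl yu' scaler0.
  rewrite mulmxBl -scalemxAl => /eqP; rewrite subr_eq0 => /eqP ->.
  by rewrite mxE /t; ring.
set c1 := (z *m n1') 0 0 / (z *m n1) 0 0.
set c2 := (z *m n2') 0 0 / (z *m n2) 0 0.
have m3E x : x *m n = 0 -> (x *m n1) 0 0 != 0 -> (x *m n2) 0 0 != 0 ->
    (x *m n3) 0 0 = c1 * c2 * (x *m n3') 0 0.
  move=> xn x1 x2; apply: (mulfI (mulf_neq0 x1 x2)); rewrite -hF // hF' ?on' //.
  rewrite (scal n1 n1' p) // (scal n2 n2' q) // -/c1 -/c2; ring.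
(* [r'] may equal [p] or [q], where the first two factors cannot be cancelled; a point r' + t z
   avoids this, and linearity leads back to [r']. *)
have [t] : exists t, ((r' + t *: z) *m n1) 0 0 * ((r' + t *: z) *m n2) 0 0 != 0.
  pose P : {poly K} := (((r' *m n1) 0 0)%:P + ((z *m n1) 0 0) *: 'X) *
                       (((r' *m n2) 0 0)%:P + ((z *m n2) 0 0) *: 'X).
  have lin (c e : K) : e != 0 -> c%:P + e *: 'X != 0 :> {poly K}.
    apply: contra_neq => /(congr1 (fun p : {poly K} => p`_1)).
    by rewrite coefD coefC coefZ coefX coef0 /= add0r mulr1.
  have [t Pt] := poly_nonroot (mulf_neq0 (lin ((r' *m n1) 0 0) _ z1)
                                         (lin ((r' *m n2) 0 0) _ z2)).
  exists t; move: Pt; rewrite hornerM !hornerD !hornerZ !hornerC !hornerX.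
  by rewrite !mulmxDl -!scalemxAl !addZ00 ![t * _]mulrC.
rewrite mulf_eq0 negb_or => /andP[t1 t2].
have rtn : (r' + t *: z) *m n = 0.
  by rewrite mulmxDl -scalemxAl zn rn2 scaler0 addr0.
have r3 : r' *m n3 = 0.
  apply/eqP; rewrite mx11_eq0; have := m3E _ rtn t1 t2.
  rewrite !mulmxDl -!scalemxAl !addZ00 rn3' (m3E z) // [(0 : 'M__) 0 0]mxE add0r => E.
  by apply/eqP/(addIr (t * (c1 * c2 * (z *m n3') 0 0))); rewrite E; ring.
by apply: propP => //; apply: (row_prop_in_ker n0 zn (nz _ z3)).
Qed.

End HesseCubic.

(** * Base points and their linear inversions *)

Section BasePoints.
Variable K : numFieldType.
Implicit Types (T o p q r s w x y z : 'rV[K]_3).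

(* The harmonic homology with centre the flex T; on every member of the pencil
   it is [q |-> - q] for the group law with origin T. *)
Definition inversion T : 'M[K]_3 := 1%:M - (\col_k (T 0 k)^-1) *m T.

Lemma inversionE T q :
  q *m inversion T = q - (\sum_k q 0 k / T 0 k) *: T.
Proof.
rewrite mulmxBr mulmx1 mulmxA; congr (_ - _).
apply/rowP => i; rewrite !mxE big_ord_recl big_ord0 addr0; congr (_ * _).
by rewrite mxE; apply: eq_bigr => k _; rewrite mxE.
Qed.

(** The product forces a zero coordinate, and a second zero would force the third through the sum of
    cubes. Each triple lists the vanishing index first. *)
Lemma base_point_cases T (P : Prop) : base_point T ->
  (forall i k l : 'I_3, (i, k, l) \in [:: (o0, o1, o2); (o1, o0, o2); (o2, o0, o1)] ->
     T 0 i = 0 -> T 0 k != 0 -> T 0 l != 0 -> T 0 k ^+ 3 + T 0 l ^+ 3 = 0 -> P) ->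
  P.
Proof.
move=> [T0]; rewrite sum3 prod3 => hs /eqP hp h.
have nz i k l : (forall j, j = i \/ j = k \/ j = l) ->
    T 0 i = 0 -> T 0 k ^+ 3 + T 0 l ^+ 3 = 0 -> T 0 k != 0 /\ T 0 l != 0.
  move=> cov Ti Tkl; have aux m1 m2 : (forall j, j = i \/ j = m1 \/ j = m2) ->
      T 0 m1 ^+ 3 + T 0 m2 ^+ 3 = 0 -> T 0 m1 != 0.
    move=> cov' E; apply: contra_neq T0 => Tm1; apply/rowP => j; rewrite mxE.
    move: E; rewrite Tm1 expr0n add0r => /eqP; rewrite expf_eq0 /= => /eqP Tm2.
    by have [->|[->|->]] := cov' j.
  split; first exact: aux cov Tkl.
  apply: (aux l k); last by rewrite addrC.
  by move=> j; have [->|[->|->]] := cov j; auto.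
have cv i k l : (i, k, l) \in [:: (o0, o1, o2); (o1, o0, o2); (o2, o0, o1)] ->
    forall j, j = i \/ j = k \/ j = l.
  rewrite !inE => /orP[|/orP[]] /eqP[-> -> ->];
  by apply: ord3P; auto.
move: hp; rewrite !mulf_eq0 => /orP[/orP[]|] /eqP Ti.
- have E : T 0 o1 ^+ 3 + T 0 o2 ^+ 3 = 0 by rewrite -[RHS]hs Ti; ring.
  have [a b] := nz o0 o1 o2 (cv o0 o1 o2 isT) Ti E.
  exact: (h o0 o1 o2).
- have E : T 0 o0 ^+ 3 + T 0 o2 ^+ 3 = 0 by rewrite -[RHS]hs Ti; ring.
  have [a b] := nz o1 o0 o2 (cv o1 o0 o2 isT) Ti E.
  exact: (h o1 o0 o2).
- have E : T 0 o0 ^+ 3 + T 0 o1 ^+ 3 = 0 by rewrite -[RHS]hs Ti; ring.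
  have [a b] := nz o2 o0 o1 (cv o2 o0 o1 isT) Ti E.
  exact: (h o2 o0 o1).
Qed.

Lemma base_point_other_neq0 o i k : base_point o -> o 0 i = 0 -> k != i ->
  o 0 k != 0.
Proof.
move=> bo oi ki; apply: (base_point_cases bo) => i' k' l' h Ti Tk Tl _.
have cov : forall j, j = i' \/ j = k' \/ j = l'.
  by move: h; rewrite !inE => /orP[|/orP[]] /eqP[-> -> ->]; apply: ord3P; auto.
have ii : i = i'.
  by case: (cov i) => [//|[] E]; move: oi; rewrite E => oi; rewrite oi eqxx in Tk Tl.
by case: (cov k) => [E|[] -> //]; rewrite E ii eqxx in ki.
Qed.

Lemma base_point_zero o : base_point o -> exists i, o 0 i = 0.
Proof. by move=> bo; apply: (base_point_cases bo) => i *; exists i. Qed.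

(** With [0 / 0 = 0] the vanishing coordinate of [T] contributes nothing and the other two
    contribute 1 each; [inversion] relies on the same convention. *)
Lemma inversion_form T : base_point T -> \sum_k T 0 k / T 0 k = 2%:R.
Proof.
move=> bT; apply: (base_point_cases bT) => i k l.
rewrite !inE sum3 => /orP[|/orP[]] /eqP[-> -> ->] -> h1 h2 _;
  rewrite mul0r !divff //; ring.
Qed.

Lemma inversion_base T : base_point T -> T *m inversion T = - T.
Proof.
move=> bT; rewrite inversionE (inversion_form bT) scaler_nat mulr2n opprD.
by rewrite addrA subrr add0r.
Qed.

Lemma inversionK T : base_point T -> inversion T *m inversion T = 1%:M.
Proof.
move=> bT; rewrite {1}/inversion mulmxBl mul1mx -mulmxA inversion_base //.
by rewrite mulmxN opprK /inversion subrK.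
Qed.

Lemma inversion_coords T i k l q :
  (i, k, l) \in [:: (o0, o1, o2); (o1, o0, o2); (o2, o0, o1)] ->
  T 0 i = 0 -> T 0 k != 0 -> T 0 l != 0 ->
  [/\ (q *m inversion T) 0 i = q 0 i,
      (q *m inversion T) 0 k = - (T 0 k / T 0 l) * q 0 l &
      (q *m inversion T) 0 l = - (T 0 l / T 0 k) * q 0 k].
Proof.
rewrite !inE => /orP[|/orP[]] /eqP[-> -> ->] Ti Tk Tl;
  rewrite inversionE sum3 !mxE Ti invr0; split; field;
  by rewrite ?Tk ?Tl.
Qed.

(** The inversion fixes one coordinate and exchanges the other two with factors [c] and [d].
    Opposite cubes in [T] give c^3 = d^3 = 1, and c d = 1, so the sum of cubes and the product are
    both preserved. *)
Lemma hesse_inversion m l T q : base_point T ->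
  hesse m l (q *m inversion T) = hesse m l q.
Proof.
move=> bT; apply: (base_point_cases bT) => i k n ikn Ti Tk Tn E.
have [e1 e2 e3] := inversion_coords q ikn Ti Tk Tn.
have h : T 0 k ^+ 3 = - T 0 n ^+ 3 by apply/eqP; rewrite -addr_eq0 E.
have c1 : (- (T 0 k / T 0 n)) ^+ 3 = 1.
  by rewrite exprNn expr_div_n h; field.
have c2 : (- (T 0 n / T 0 k)) ^+ 3 = 1.
  by rewrite exprNn expr_div_n h; field.
have c3 : - (T 0 k / T 0 n) * - (T 0 n / T 0 k) = 1 by field; rewrite Tk Tn.
move: e2 e3 c1 c2 c3; move: (- (T 0 k / T 0 n)) (- (T 0 n / T 0 k)) => c d.
move=> e2 e3 c1 c2 c3.
suff cub A B C : A ^+ 3 + (c * B) ^+ 3 + (d * C) ^+ 3 = A ^+ 3 + C ^+ 3 + B ^+ 3.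
  have prd A B C : A * (c * B) * (d * C) = A * C * B.
    by rewrite -[RHS]mul1r -c3; ring.
  transitivity (m * (q 0 i ^+ 3 + (c * q 0 n) ^+ 3 + (d * q 0 k) ^+ 3) +
                3%:R * l * (q 0 i * (c * q 0 n) * (d * q 0 k))).
    by move: ikn e1 e2 e3; rewrite !inE => /orP[|/orP[]] /eqP[-> -> ->] e1 e2 e3;
      rewrite hesse3 e1 e2 e3; ring.
  rewrite cub prd; move: ikn; rewrite !inE => /orP[|/orP[]] /eqP[-> -> ->];
  by rewrite hesse3; ring.
by rewrite !exprMn c1 c2; ring.
Qed.

(** The inversion preserves the cubic and every line through [T], so it exchanges the two remaining
    intersection points. This is read off from the restriction of the cubic to the line. *)
Lemma third_point_base m l T q s : m != 0 -> m ^+ 3 + l ^+ 3 != 0 ->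
  base_point T -> q != 0 -> s != 0 ->
  collinear_triple (hesse m l) T q s -> prop (q *m inversion T) s.
Proof.
move=> m0 d0 bT q0 s0 [n [n1 [n2 [n3 [[n0 Tn qn sn] [T1 q2 s3 hF]]]]]].
have T0 : T != 0 by case: bT.
have [z [zn Fz]] := hesse_no_line m0 d0 n0.
have := Fz; rewrite hF // !mulf_eq0 !negb_or => /andP[/andP[z1 z2] z3].
have nz (u : 'cV[K]_3) : (z *m u) 0 0 != 0 -> z *m u != 0 by rewrite mx11_eq0.
pose f x := \sum_k x 0 k / T 0 k.
have inv x : x *m inversion T = x - f x *: T by exact: inversionE.
have fD x y t : f (x + t *: y) = f x + t * f y.
  rewrite /f mulr_sumr -big_split; apply: eq_bigr => k _ /=.
  by rewrite !mxE; ring.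
have fT : f T = 2%:R by exact: inversion_form.
have fZ x t : f (t *: x) = t * f x.
  by rewrite -[t *: x]add0r fD /f big1 ?add0r // => k _; rewrite mxE mul0r.
have Fi x : hesse m l (x - f x *: T) = hesse m l x.
  by rewrite -inv hesse_inversion.
have in_n x t : x *m n = 0 -> (x + t *: T) *m n = 0.
  by move=> xn; rewrite mulmxDl -scalemxAl Tn scaler0 addr0 xn.
have iq0 : q *m inversion T != 0.
  apply: contra_neq q0 => E.
  by rewrite -[q]mulmx1 -(inversionK bT) mulmxA E mul0mx.
have iqn : (q *m inversion T) *m n = 0.
  by rewrite inv -scaleNr in_n.
suff iq3 : (q *m inversion T) *m n3 = 0.
  by apply: propP => //; exact: (row_prop_in_ker n0 zn (nz _ z3)).
have e00 (A B : 'M[K]_1) t : (A + t *: B) 0 0 = A 0 0 + t * B 0 0.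
  by rewrite !mxE.
(* Tangent case: [f] vanishes at [w], the inversion acts on w + t T by t -> -t, and invariance of a
   function affine in t gives T *m n3 = 0, so [T] is a flex. *)
have [[c qE]|npq] := pselect (exists c, q = c *: T).
  have c0 : c != 0 by apply: contra_neq q0 => c0; rewrite qE c0 scale0r.
  have T2 : T *m n2 = 0.
    move/eqP: q2; rewrite qE -scalemxAl scaler_eq0 (negPf c0) /=.
    by move/eqP.
  have [w [fw wn w1 w2]] : exists w, [/\ f w = 0, w *m n = 0,
      w *m n1 = z *m n1 & w *m n2 = z *m n2].
    exists (z + (- (f z / 2%:R)) *: T); split; first by rewrite fD fT; field.
    - exact: in_n.
    - by rewrite mulmxDl -scalemxAl T1 scaler0 addr0.
    - by rewrite mulmxDl -scalemxAl T2 scaler0 addr0.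
  have E t : hesse m l (w + t *: T) =
      (z *m n1) 0 0 * (z *m n2) 0 0 * ((w *m n3) 0 0 + t * (T *m n3) 0 0).
    rewrite hF ?in_n // !mulmxDl -!scalemxAl T1 T2 !scaler0 !addr0.
    by rewrite w1 w2 e00.
  have := Fi (w + 1 *: T); rewrite fD fw fT add0r mul1r -addrA -scalerBl !E.
  move/(mulfI (mulf_neq0 z1 z2)) => E3.
  have T3 : T *m n3 = 0.
    apply/eqP; rewrite mx11_eq0.
    have n2' : 2%:R != 0 :> K by rewrite pnatr_eq0.
    apply/eqP; apply: (mulfI n2'); rewrite mulr0.
    have -> : 2%:R * (T *m n3) 0 0 = ((w *m n3) 0 0 + 1 * (T *m n3) 0 0)
      - ((w *m n3) 0 0 + (1 - 2%:R) * (T *m n3) 0 0) by ring.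
    by rewrite E3 subrr.
  by rewrite qE -scalemxAl (inversion_base bT) -scalemxAl mulNmx T3 oppr0 scaler0.
have q1 : (q *m n1) 0 0 != 0.
  rewrite -mx11_eq0; apply/negP => /eqP q1; apply: npq.
  exact: (row_prop_in_ker n0 zn (nz _ z1)).
have T2 : (T *m n2) 0 0 != 0.
  rewrite -mx11_eq0; apply/negP => /eqP T2; apply: npq.
  have [c cE] := row_prop_in_ker n0 zn (nz _ z2) qn q2 Tn T2 q0.
  have c0 : c != 0 by apply: contra_neq T0 => c0; rewrite cE c0 scale0r.
  by exists c^-1; rewrite cE scalerA mulVf // scale1r.
have E t : hesse m l (q + t *: T) = (q *m n1) 0 0 * (T *m n2) 0 0 *
    (t * ((q *m n3) 0 0 + t * (T *m n3) 0 0)).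
  rewrite hF ?in_n // !mulmxDl -!scalemxAl T1 q2 scaler0 addr0 add0r e00.
  by rewrite (_ : (t *: (T *m n2)) 0 0 = t * (T *m n2) 0 0) ?mxE //; ring.
(* On q + t T the inversion is t -> - t - f q. The value t = (1 - f q) / 2 goes to t - 1, so
   equating the two values of t (q3 + t T3) leaves the linear identity q3 - f q T3 = 0. *)
have := Fi (q + ((1 - f q) / 2%:R) *: T).
rewrite fD fT -addrA -scalerBl !E => /(mulfI (mulf_neq0 q1 T2)) E3.
apply/eqP; rewrite inv mulmxBl -scalemxAl mx11_eq0 -scaleNr e00.
rewrite -(subrr ((1 - f q) / 2%:R *
     ((q *m n3) 0 0 + (1 - f q) / 2%:R * (T *m n3) 0 0))) -{2}E3.
by apply/eqP; field.
Qed.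

End BasePoints.

(** * Addition expressed through inversions *)

Section CubicAdd.
Variables (K : numFieldType) (m l : K) (o : 'rV[K]_3).
Hypotheses (m0 : m != 0) (disc0 : m ^+ 3 + l ^+ 3 != 0) (bo : base_point o).
Implicit Types (T p q r s : 'rV[K]_3).
Local Notation F := (hesse m l).
Local Notation nu T q := (q *m inversion T).

Lemma base_point_neq0 T : base_point T -> T != 0.
Proof. by case. Qed.

Lemma inversion_neq0 T q : base_point T -> q != 0 -> nu T q != 0.
Proof.
move=> bT; apply: contra_neq => E.
by rewrite -[q]mulmx1 -(inversionK bT) mulmxA E mul0mx.
Qed.

Lemma inversionKr T q : base_point T -> nu T (nu T q) = q.
Proof. by move=> bT; rewrite -mulmxA inversionK // mulmx1. Qed.

Lemma inversion_prop T p q : prop p q -> prop (nu T p) (nu T q).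
Proof. by move=> [c c0 ->]; exists c => //; rewrite -scalemxAl. Qed.

Lemma inversion_self T : base_point T -> prop (nu T T) T.
Proof.
move=> bT; exists (-1); first by rewrite oppr_eq0 oner_eq0.
by rewrite inversion_base // scaleN1r opprK.
Qed.

Lemma triple_inversion T p q r : base_point T ->
  collinear_triple F p q r -> collinear_triple F (nu T p) (nu T q) (nu T r).
Proof.
move=> bT [n [n1 [n2 [n3 [[n0 pn qn rn] [p1 q2 r3 hF]]]]]].
have E x (c : 'cV[K]_3) : nu T x *m (inversion T *m c) = x *m c.
  by rewrite mulmxA -[x *m _ *m _]mulmxA inversionK // mulmx1.
exists (inversion T *m n), (inversion T *m n1), (inversion T *m n2), (inversion T *m n3).
rewrite !E; split; split => //.
  apply: contra_neq n0 => n0.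
  by rewrite -[n]mul1mx -(inversionK bT) -mulmxA n0 mulmx0.
move=> x; rewrite !mulmxA => xn; rewrite -(hF _ xn).
by rewrite hesse_inversion.
Qed.

Lemma cubic_add_third p q r : r != 0 -> cubic_add F o p q r ->
  exists s, [/\ s != 0, collinear_triple F p q s & prop (nu o s) r].
Proof.
move=> r0 [s [s0 pqs sor]]; exists s; split => //.
exact: (third_point_base m0 disc0 bo s0 r0 (triple_swap sor)).
Qed.

(** The third point on the line through a base point [T] and [q] is an inversion of [q], so
    translation by [T] is linear, a product of two inversions. *)
Lemma cubic_add_base T q r : base_point T -> q != 0 -> r != 0 ->
  cubic_add F o T q r -> prop (nu o (nu T q)) r.
Proof.
move=> bT q0 r0 /(cubic_add_third r0)[s [s0 Tqs sr]].
apply: prop_trans sr; apply: inversion_prop.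
exact: (third_point_base m0 disc0 bT q0 s0 Tqs).
Qed.

Lemma cubic_add0 q r : q != 0 -> r != 0 -> cubic_add F o o q r -> prop q r.
Proof. by move=> q0 r0 /(cubic_add_base bo q0 r0); rewrite inversionKr. Qed.

Lemma cubic_add_opp q q' : q != 0 -> q' != 0 -> cubic_add F o q q' o ->
  prop (nu o q) q'.
Proof.
move=> q0 q0' /(cubic_add_third (base_point_neq0 bo))[s [s0 qqs so]].
have os : prop o s.
  apply: prop_trans (prop_sym (inversion_self bo)) _.
  by rewrite -[s](inversionKr _ bo); apply: inversion_prop; exact: prop_sym.
have := triple_prop (prop_sym os) (triple_rot (triple_rot qqs)).
exact: (third_point_base m0 disc0 bo q0 q0').
Qed.

(** With [s] the third point on the line of [a] and [q], inverting the triple of [a'] and [q'] at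
    [o] gives a triple on [q] and [s] with third point [a'']; uniqueness identifies it with [a]. *)
Lemma cubic_addK a q q' a' a'' : a != 0 -> q != 0 -> q' != 0 -> a' != 0 ->
  a'' != 0 -> cubic_add F o a q a' -> cubic_add F o a' q' a'' ->
  cubic_add F o q' q o -> prop a a''.
Proof.
move=> a0 q0 q0' a0' a0'' /(cubic_add_third a0')[s [s0 aqs sa]].
move=> /(cubic_add_third a0'')[s' [s0' aqs' sa']] /(cubic_add_opp q0' q0) qq.
have t1 := triple_inversion bo (triple_prop (prop_sym sa) aqs').
rewrite inversionKr // in t1.
have t2 := triple_prop qq (triple_swap t1).
have t3 := triple_rot aqs.
apply: prop_trans sa'; apply: (third_point_unique m0 disc0 q0 s0) => //.
exact: inversion_neq0.
Qed.

End CubicAdd.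

Section NodeInversion.
Variable K : numFieldType.
Implicit Types (U : 'rV[K]_3) (a b n : 'I_3).

Lemma delta_inversion U b :
  delta_mx 0 b *m inversion U = delta_mx 0 b - (U 0 b)^-1 *: U.
Proof.
rewrite inversionE (bigD1 b) //= mxE !eqxx mul1r big1 ?addr0 // => k kb.
by rewrite mxE (negPf kb) andbF mul0r.
Qed.

Lemma delta_inversion_swap U a b n : base_point U -> U 0 a = 0 -> a != b ->
  n != a -> n != b -> (forall j, j != a -> j != b -> j = n) ->
  prop (delta_mx 0 n) ((delta_mx 0 b : 'rV[K]_3) *m inversion U).
Proof.
move=> bU Ua ab na nb cov.
have Ub : U 0 b != 0 by apply: base_point_other_neq0 bU Ua _; rewrite eq_sym.
have Un : U 0 n != 0 by exact: base_point_other_neq0 bU Ua _.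
exists (- (U 0 n / U 0 b)); first by rewrite oppr_eq0 mulf_neq0 // invr_neq0.
rewrite delta_inversion; apply/rowP => k; rewrite !mxE /=.
have [->|kb] := eqVneq k b.
  by rewrite mulVf // subrr [b == n]eq_sym (negPf nb) mulr0.
have [->|ka] := eqVneq k a; first by rewrite Ua [a == n]eq_sym (negPf na) !mulr0 subr0.
by rewrite (cov _ ka kb) eqxx sub0r mulr1 [in LHS]mulrC.
Qed.

(** An inversion whose centre has its zero at index a fixes the node e_a and exchanges the other
    two. So e_k goes to e_n and on to e_i, or stays fixed when i = k. The composite is translation
    by [T], which shows the node reached by the translate of [Q] at infinity. *)
Lemma inversion_nodes o T k i : base_point o -> base_point T ->
  o 0 k = 0 -> T 0 i = 0 ->
  prop (delta_mx 0 i) ((delta_mx 0 k : 'rV[K]_3) *m inversion T *m inversion o).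
Proof.
move=> bo bT ok Ti; have [E|ik] := eqVneq i k.
  rewrite E in Ti *; rewrite !delta_inversion Ti invr0 scale0r subr0.
  by rewrite delta_inversion ok invr0 scale0r subr0; exact: prop_refl.
have [n [ni nk cov]] := ord3_third ik.
apply: prop_trans (inversion_prop o (delta_inversion_swap bT Ti ik ni nk cov)).
apply: (delta_inversion_swap bo ok) => //; rewrite 1?eq_sym // => j jk jn.
by apply/eqP/negPn/negP => ji; rewrite (cov _ ji jk) eqxx in jn.
Qed.

End NodeInversion.

(** * Curves on the surface *)

Lemma scale_coord (R : pzRingType) n (c : R) (x : 'rV[R]_n) i :
  (c *: x) 0 i = c * x 0 i.
Proof. by rewrite mxE. Qed.

(** * Proportionality through minors, and dual bases of the plane *)

Section Minors.
Variable K : numFieldType.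

Lemma prop_minors n (x y : 'rV[K]_n.+1) : x != 0 -> y != 0 ->
  prop x y <-> forall ij : 'I_n.+1 * 'I_n.+1,
    x 0 ij.1 * y 0 ij.2 - x 0 ij.2 * y 0 ij.1 = 0.
Proof.
move=> x0 y0; split=> [[c _ ->] ij|h]; first by rewrite !mxE; ring.
have /rV0Pn[k xk] := x0.
have yE : y = (y 0 k / x 0 k) *: x.
  apply/rowP => i; rewrite mxE; apply: (mulfI xk).
  by have /eqP := h (k, i); rewrite /= subr_eq0 => /eqP ->; field.
exists (y 0 k / x 0 k) => //.
by apply: contra_neq y0 => c0; rewrite yE c0 scale0r.
Qed.

Lemma prop_mulmx n m (M : 'M[K]_(n.+1, m.+1)) (x y : 'rV[K]_n.+1) :
  prop x y -> prop (x *m M) (y *m M).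
Proof. by move=> [c c0 ->]; exists c => //; rewrite -scalemxAl. Qed.

Lemma prop_neq0 n (x y : 'rV[K]_n.+1) : prop x y -> x != 0 -> y != 0.
Proof. by move=> [c c0 ->] x0; rewrite scaler_eq0 negb_or c0. Qed.

Lemma mulmx_row' n m (u : 'rV[K]_n.+1) (V : 'M[K]_(n.+1, m)) r :
  u *m V = u 0 r *: row r V + col' r u *m row' r V.
Proof.
apply/rowP => i; rewrite !mxE (bigD1_ord r) //=; congr (_ + _).
by apply: eq_bigr => k _; rewrite !mxE.
Qed.

Section DualBases.
Variables (V N : 'M[K]_3) (r : 'I_3).
Hypothesis VN : V *m N = 1%:M.

Lemma dual_split (a : 'rV[K]_3) : a *m col r N = 0 ->
  a = a *m col' r N *m row' r V.
Proof.
move=> ar; rewrite -{1}[a]mulmx1 -(mulmx1C VN) mulmxA (mulmx_row' _ V r).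
have -> : (a *m N) 0 r = 0.
  have -> : (a *m N) 0 r = (a *m col r N) 0 0.
    by rewrite !mxE; apply: eq_bigr => k _; rewrite !mxE.
  by rewrite ar mxE.
rewrite scale0r add0r; congr (_ *m _); apply/rowP => i; rewrite !mxE.
by apply: eq_bigr => k _; rewrite !mxE.
Qed.

Let VNE i k : \sum_j V i j * N j k = (i == k)%:R.
Proof. by have := congr1 (fun A : 'M_3 => A i k) VN; rewrite !mxE. Qed.

Lemma row'_col' : row' r V *m col' r N = 1%:M.
Proof.
apply/matrixP => i k; rewrite !mxE.
under eq_bigr do rewrite !mxE.
by rewrite VNE (inj_eq (@lift_inj _ r)).
Qed.

Lemma row'_col : row' r V *m col r N = 0.
Proof.
apply/matrixP => i k; rewrite !mxE.
under eq_bigr do rewrite !mxE.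
by rewrite VNE eq_sym (negPf (neq_lift r i)).
Qed.

Lemma dual_decomp (a : 'rV[K]_3) t n : n != r ->
  (forall k, k != r -> k != t -> k = n) -> (a *m N) 0 t = 0 ->
  a = (a *m N) 0 n *: row n V + (a *m N) 0 r *: row r V.
Proof.
move=> nr cov at0.
rewrite -{1}[a]mulmx1 -(mulmx1C VN) mulmxA mulmx_sum_row (bigD1 n) //=.
rewrite (bigD1 r) 1?eq_sym //= big1 ?addr0 // => k /andP[kn kr].
have [->|kt] := eqVneq k t; first by rewrite at0 scale0r.
by rewrite (cov _ kr kt) eqxx in kn.
Qed.

End DualBases.

End Minors.

Section Curves.
Variables (K : numClosedFieldType) (lam : K).
Implicit Types (a o : 'rV[K]_3) (b : 'rV[K]_2) (x : 'rV[K]_(3 + 3))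
  (v : 'rV[K]_2) (w : 'rV[K]_(3 + 2 + (3 + 3))).
Local Notation Y := (surfY lam).
Local Notation P1 := (proj_space K 1).
Implicit Types (y : Y) (A B : set Y).

Lemma surfY_pt w : Y_cone lam w -> exists y : Y, coords y w.
Proof. by move=> Dw; exists (cone_pt (@yscal K) Dw); exact: coords_cone_pt. Qed.

Lemma coords_yscal y w w' : coords y w -> coords y w' -> yscal w w'.
Proof. exact: (coords_rel (@yscal_refl K)). Qed.

Lemma coords_Y_trans y w w' : coords y w -> yscal w w' -> coords y w'.
Proof.
move=> yw ww'; apply: (coords_trans (@yscal_sym K) (@yscal_trans K) yw _ ww').
exact: Y_cone_yscal ww' (coords_dom yw).
Qed.

Lemma yscalE w w' : yscal w w' <->
  [/\ prop (crd2 w) (crd2 w'), prop (crd1 w) (crd1 w') & prop (crd5 w) (crd5 w')].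
Proof.
split=> [[c2 [c1 [c5 [n2 n1 n5 [e2 e1 e5]]]]]|[[c2 n2 e2] [c1 n1 e1] [c5 n5 e5]]].
  by split; [exists c2|exists c1|exists c5].
by exists c2, c1, c5.
Qed.

Lemma Y_cone_fibre w : Y_cone lam w -> bc_fibre lam (crd1 w) (crd2 w) = 0.
Proof.
move: w.
apply: (Y_cone_eq0 (f := fun w => bc_fibre lam (crd1 w) (crd2 w))); last by move=> w [].
by apply: polyfun_bc_fibre; [exact: polymap_crd2|exact: polymap_crd1].
Qed.

(** The 2 x 2 minors expressing proportionality vanish on the graph, hence on its closure. *)
Lemma Y_cone_node_gens w : Y_cone lam w ->
  node_gens (crd2 w) (crd1 w) != 0 ->
  prop (node_gens (crd2 w) (crd1 w)) (crd5 w).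
Proof.
move=> Dw g0; have [_ _ w5 _] := Dw.
apply/(prop_minors g0 w5) => ij; move: w Dw {g0 w5}.
apply: (Y_cone_eq0 (f := fun w =>
  node_gens (crd2 w) (crd1 w) 0 ij.1 * crd5 w 0 ij.2 -
  node_gens (crd2 w) (crd1 w) 0 ij.2 * crd5 w 0 ij.1)).
  have pg := polymap_node_gens (@polymap_crd2 K) (@polymap_crd1 K).
  by apply: polyfunB; apply: polyfunM;
    try exact: pg; exact: polymap_crd5.
by move=> w [_ _ _ _ [c ->]]; rewrite !mxE; ring.
Qed.

(** Away from the nodes the blow-up changes nothing: the P^5 component is determined by the point of
    P^2 x P^1. *)
Lemma lies_over_unique y y' a b a' b' : lies_over y a b -> lies_over y' a' b' ->
  prop a a' -> prop b b' -> node_gens a b != 0 -> y = y'.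
Proof.
move=> [w [yw wa wb]] [w' [yw' wa' wb']] aa bb g0; subst a b a' b'.
suff sc : yscal w w' by exact: coords_inj (coords_Y_trans yw sc) yw'.
apply/yscalE; split => //; have [c c0 aE] := aa; have [d d0 bE] := bb.
have gE : node_gens (crd2 w') (crd1 w') =
    (c ^+ 2 * d) *: node_gens (crd2 w) (crd1 w) by rewrite aE bE node_gensZ.
have cd0 : c ^+ 2 * d != 0 by rewrite mulf_neq0 // expf_neq0.
have g0' : node_gens (crd2 w') (crd1 w') != 0.
  by rewrite gE scaler_eq0 negb_or cd0.
apply: prop_trans (Y_cone_node_gens (coords_dom yw') g0').
apply: prop_trans (prop_sym (Y_cone_node_gens (coords_dom yw) g0)) _.
by exists (c ^+ 2 * d).
Qed.

Lemma lies_over_prop y a b a' b' : lies_over y a b -> lies_over y a' b' ->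
  prop a a' /\ prop b b'.
Proof.
move=> [w [yw <- <-]] [w' [yw' <- <-]].
by have /yscalE[] := coords_yscal yw yw'.
Qed.

Lemma lies_over_trans y a b a' b' : lies_over y a b -> prop a a' -> prop b b' ->
  lies_over y a' b'.
Proof.
move=> [w [yw <- <-]] h2 h1; exists (mkrow a' b' (crd5 w)); rewrite !crdE.
split => //; apply: coords_Y_trans yw _; apply/yscalE; rewrite !crdE.
by split => //; exact: prop_refl.
Qed.

Lemma lies_over_ex y : exists a b, lies_over y a b.
Proof. by have [w yw] := coords_ex y; exists (crd2 w), (crd1 w), w. Qed.

Lemma lies_over_neq0 y a b : lies_over y a b -> a != 0 /\ b != 0.
Proof. by move=> [w [yw <- <-]]; have [] := coords_dom yw. Qed.

Lemma closed_minors n (F G : 'rV[K]_(3 + 2 + (3 + 3)) -> 'rV[K]_n.+1) :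
  polymap F -> polymap G ->
  (forall w w', yscal w w' -> prop (F w) (F w') /\ prop (G w) (G w')) ->
  closed_in [set y : Y | forall w, coords y w -> forall ij : 'I_n.+1 * 'I_n.+1,
    F w 0 ij.1 * G w 0 ij.2 - F w 0 ij.2 * G w 0 ij.1 = 0].
Proof.
move=> pF pG FG; apply: (closed_cone (Y_cone lam) (@yscal_refl K)
  (h := fun (ij : 'I_n.+1 * 'I_n.+1) w =>
     F w 0 ij.1 * G w 0 ij.2 - F w 0 ij.2 * G w 0 ij.1)).
  by move=> ij; apply: polyfunB; apply: polyfunM.
move=> w w' /FG[[c _ ->] [d _ ->]] h ij; rewrite !scale_coord.
transitivity (c * d * (F w 0 ij.1 * G w 0 ij.2 - F w 0 ij.2 * G w 0 ij.1)).
  by ring.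
by rewrite h mulr0.
Qed.

Lemma closed_prop n (x : 'rV[K]_n.+1) (G : 'rV[K]_(3 + 2 + (3 + 3)) -> 'rV[K]_n.+1) :
  x != 0 -> polymap G -> (forall w w', yscal w w' -> prop (G w) (G w')) ->
  (forall w, Y_cone lam w -> G w != 0) ->
  closed_in [set y : Y | forall w, coords y w -> prop x (G w)].
Proof.
move=> x0 pG Gr G0; have := closed_minors (polymap_cst _ x) pG
  (fun w w' h => conj (prop_refl x) (Gr w w' h)).
congr closed_in; apply/seteqP; split=> y h w yw;
  have Gw := G0 _ (coords_dom yw).
  exact: ((prop_minors x0 Gw).2 (h _ yw)).
exact: ((prop_minors x0 Gw).1 (h _ yw)).
Qed.

(** [F] parametrises the curve and [L] inverts it. Both act on coordinate vectors, and [L] is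
    polynomial on the coordinates of the whole surface, hence defined near the curve; it yields both
    the isomorphism with P^1 and the retraction used for transversality. *)
Record curve_data A (F : 'rV[K]_2 -> 'rV[K]_(3 + 2 + (3 + 3)))
    (L : 'rV[K]_(3 + 2 + (3 + 3)) -> 'rV[K]_2) : Prop := CurveData {
  cd_closed : closed_in A;
  cd_polyF : polymap F;
  cd_polyL : polymap L;
  cd_F : forall v, v != 0 -> Y_cone lam (F v);
  cd_Fr : forall v v', prop v v' -> yscal (F v) (F v');
  cd_Lr : forall w w', yscal w w' -> prop (L w) (L w');
  cd_A : forall y w, A y -> coords y w -> L w != 0 /\ yscal w (F (L w));
  cd_mem : forall v y, v != 0 -> coords y (F v) -> A y;
  cd_LF : forall v, v != 0 -> prop v (L (F v))
}.

Section CurveMaps.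
Variables (A : set Y) (F : 'rV[K]_2 -> 'rV[K]_(3 + 2 + (3 + 3)))
  (L : 'rV[K]_(3 + 2 + (3 + 3)) -> 'rV[K]_2).
Hypothesis cd : curve_data A F L.

Let U : set Y := [set y | forall w, coords y w -> L w != 0].

Let row10 : row2 1 0 != 0 :> 'rV[K]_2.
Proof. by rewrite row2_neq0 oner_neq0. Qed.

Lemma curve_maps : exists (phi : P1 -> Y) (psi : Y -> P1),
  [/\ opn U, A `<=` U, morphism phi, morph_on U psi &
   [/\ forall (p : P1) b, coords p b -> coords (phi p) (F b),
       forall y w, U y -> coords y w -> coords (psi y) (L w),
       forall p : P1, A (phi p), forall p : P1, psi (phi p) = p &
       forall y, A y -> phi (psi y) = y]].
Proof.
have [y0 _] := surfY_pt (cd_F cd row10).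
have [v0 _] := proj_pt row10.
have [phi [phiP mphi]] := @cone_mapT K 2 _ [set v | v != 0]
  (@prop K 1) (Y_cone lam) (@yscal K) F y0
  (@prop_refl K 1) (@prop_sym K 1) (@yscal_refl K) (@yscal_sym K)
  (@yscal_trans K) (cd_polyF cd) (cd_F cd) (fun v v' _ _ h => cd_Fr cd h).
have oE : zariski_open [set w | L w != 0].
  apply/zariski_openP => w /rV0Pn[k Lk]; exists (fun z => L z 0 k); split => //.
    exact: (cd_polyL cd).
  by move=> z Lz; apply/rV0Pn; exists k.
have [||psi [psiP oU mpsi]] := @cone_map K _ 2 (Y_cone lam) (@yscal K)
  [set v | v != 0] (@prop K 1)
  [set w | L w != 0] L v0 (@yscal_refl K) (@yscal_sym K) (@prop_refl K 1)
  (@prop_sym K 1) (@prop_trans K 1) (cd_polyL cd) oE.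
- by [].
- move=> v w _ _ /(cd_Lr cd) h v1; split => //; exact: prop_neq0 h v1.
have AU : A `<=` U by move=> y Ay w yw; have [] := cd_A cd Ay yw.
have Aphi (v : P1) : A (phi v).
  have [b vb] := coords_ex v; apply: (cd_mem cd _ (phiP _ _ vb)).
  exact: (coords_dom vb).
exists phi, psi; split => //; split => //.
- move=> v; have [b vb] := coords_ex v.
  apply: (coords_inj (w := L (F b))).
    by apply: psiP (phiP _ _ vb); exact: AU.
  apply: (coords_trans (@prop_sym K 1) (@prop_trans K 1) vb).
    apply: (prop_neq0 (cd_LF cd _)) => //; exact: (coords_dom vb).
  by apply: (cd_LF cd); exact: (coords_dom vb).
- move=> y Ay; have [w yw] := coords_ex y.
  have [_ wF] := cd_A cd Ay yw.
  apply: (coords_inj (w := F (L w))); last exact: coords_Y_trans yw wF.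
  by apply: phiP; apply: psiP => //; exact: AU.
Qed.

Lemma smooth_rational_of_data : smooth_rational_curve A.
Proof.
have [phi [psi [oU AU mphi mpsi [_ _ h1 h2 h3]]]] := curve_maps.
apply: (smooth_rational_param (good_surfY lam) (good_proj_space _ _)
  (cd_closed cd) oU AU mphi mpsi) => //.
Qed.

(** Following [L] by the parametrisation gives a retraction onto [A]; the hypothesis says that it
    contracts [B] to [p] where it is defined. *)
Lemma transversal_of_data B p : A p ->
  (forall y w w', B y -> coords y w -> coords p w' -> L w != 0 ->
     prop (L w') (L w)) ->
  transversal_at A B p.
Proof.
move=> Ap hB; have [phi [psi [oU AU mphi mpsi [_ psiP h1 h2 h3]]]] := curve_maps.
have Up := AU _ Ap.
apply: (transversal_retraction (good_surfY lam) oU Up mphi mpsi) => //.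
- exact: h3.
- by move=> y Ay _; exact: h3.
- move=> y By Uy; have [w yw] := coords_ex y; have [w' pw'] := coords_ex p.
  have c1 := psiP _ _ Uy yw; have c2 := psiP _ _ Up pw'.
  suff sc : prop (L w') (L w).
    apply: (coords_inj c1).
    exact: (coords_trans (@prop_sym K 1) (@prop_trans K 1) c2 (coords_dom c1) sc).
  exact: (hB _ _ _ By yw pw' (Uy _ yw)).
Qed.

End CurveMaps.

(** Weaker than being isomorphic to P^1, but enough for irreducibility; it is what gets proved for
    the exceptional curves. *)
Definition rational_image A : Prop := exists2 phi : P1 -> Y, morphism phi &
  (forall p : P1, A (phi p)) /\ (forall y, A y -> exists p : P1, phi p = y).

Lemma rational_image_of_data A F L : curve_data A F L -> rational_image A.
Proof.
move=> cd; have [phi [psi [_ _ mphi _ [_ _ h1 _ h3]]]] := curve_maps cd.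
by exists phi => //; split=> // y /h3 E; exists (psi y).
Qed.

Lemma rational_image_cover A (I : eqType) (s : seq I) (C : I -> set Y)
    (h : Y -> Y) : rational_image A -> morphism h ->
  (forall i, closed_in (C i)) ->
  (forall y, A y -> exists2 i, i \in s & C i (h y)) ->
  exists2 i, i \in s & forall y, A y -> C i (h y).
Proof.
move=> [phi mphi [Aphi surj]] mh cC cov.
have [|||i si Ci] := @irreducible_cover K P1 I s (fun i => (h \o phi) @^-1` C i)
  (@irreducible_proj_space K 1) (good_proj_space K 1).
- have [|v _] := @proj_pt K 1 (row2 1 0); last by exists v.
  by rewrite row2_neq0 oner_neq0.
- move=> i; apply: closed_preimage (cC i); exact: morphism_comp.
- by move=> v; have [i si Ci] := cov _ (Aphi v); exists i.
by exists i => // y /surj[v <-]; exact: Ci.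
Qed.

End Curves.

(** * Plane coordinates relative to a distinguished index [k] *)

Section LiftCoordinates.
Variable k : 'I_3.

Lemma lift3E : (k, lift k 0, lift k 1) \in
  [:: (o0, o1, o2); (o1, o0, o2); (o2, o0, o1)].
Proof. by move: k; apply: ord3P. Qed.

Lemma ord3_liftP (P : 'I_3 -> Prop) : P k -> P (lift k 0) -> P (lift k 1) ->
  forall i, P i.
Proof.
move=> h0 h1 h2; have := lift3E; move: h0 h1 h2.
move: (k) (lift k 0) (lift k 1) => a b c.
by move=> ha hb hc; rewrite !inE => /orP[|/orP[]] /eqP E;
  case: E ha hb hc => -> -> -> *; exact: ord3P.
Qed.

Lemma lift3_neq : [/\ k != lift k 0, k != lift k 1 & lift k 0 != lift k 1].
Proof. by move: k; apply: ord3P. Qed.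

Lemma eq_lift3 : ((lift k 0 == k) = false) * ((lift k 1 == k) = false) *
  ((lift k 0 == lift k 1) = false) * ((lift k 1 == lift k 0) = false) *
  ((k == lift k 0) = false) * ((k == lift k 1) = false).
Proof. by move: k; apply: ord3P. Qed.

Lemma row3_liftP (T : Type) (a b : 'rV[T]_3) : a 0 k = b 0 k ->
  a 0 (lift k 0) = b 0 (lift k 0) -> a 0 (lift k 1) = b 0 (lift k 1) -> a = b.
Proof. by move=> *; apply/rowP; apply: ord3_liftP. Qed.

Variable R : comNzRingType.

Let lE : [/\ lift o0 0 = o1, lift o0 1 = o2, lift o1 0 = o0, lift o1 1 = o2 &
  lift o2 0 = o0 /\ lift o2 1 = o1].
Proof. by split; [..|split]; exact: val_inj. Qed.

Lemma sum3_lift (f : 'I_3 -> R) :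
  \sum_(i < 3) f i = f k + f (lift k 0) + f (lift k 1).
Proof.
have [a b c d [e g]] := lE.
by move: k; apply: ord3P; rewrite sum3 ?a ?b ?c ?d ?e ?g; ring.
Qed.

Lemma prod3_lift (f : 'I_3 -> R) :
  \prod_(i < 3) f i = f k * f (lift k 0) * f (lift k 1).
Proof.
have [a b c d [e g]] := lE.
by move: k; apply: ord3P; rewrite prod3 ?a ?b ?c ?d ?e ?g; ring.
Qed.

Lemma cof3_lift (f : 'I_3 -> R) :
  [/\ \prod_(i < 3 | i != k) f i = f (lift k 0) * f (lift k 1),
      \prod_(i < 3 | i != lift k 0) f i = f k * f (lift k 1) &
      \prod_(i < 3 | i != lift k 1) f i = f k * f (lift k 0)].
Proof.
have [a b c d [e g]] := lE.
by move: k; apply: ord3P; split; rewrite prod3D1 ?a ?b ?c ?d ?e ?g /=; ring.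
Qed.

Lemma row'1E (v : 'rV[R]_2) :
  [/\ (v *m row' k 1%:M) 0 k = 0, (v *m row' k 1%:M) 0 (lift k 0) = v 0 0 &
      (v *m row' k 1%:M) 0 (lift k 1) = v 0 1].
Proof.
by split; rewrite mxE sum2 !mxE ?eqxx ?eq_lift3 !(mulr0, mulr1, addr0, add0r).
Qed.

Lemma delta3E : [/\ (delta_mx 0 k : 'rV[R]_3) 0 k = 1,
  (delta_mx 0 k : 'rV[R]_3) 0 (lift k 0) = 0 &
  (delta_mx 0 k : 'rV[R]_3) 0 (lift k 1) = 0].
Proof. by split; rewrite mxE ?eqxx ?eq_lift3. Qed.

End LiftCoordinates.

(** * Sections through base points, and lines inside a fibre *)

Section SpecialCurves.
Variables (K : numClosedFieldType) (lam : K).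
Implicit Types (a o : 'rV[K]_3) (b : 'rV[K]_2) (x : 'rV[K]_(3 + 3))
  (v : 'rV[K]_2) (w : 'rV[K]_(3 + 2 + (3 + 3))).
Local Notation Y := (surfY lam).
Local Notation P1 := (proj_space K 1).
Implicit Types (y : Y) (A B : set Y).

(** Base points are not nodes: off s = 0 a generator s x^2 survives, and on s = 0 the product of the
    two non-zero coordinates of [o] does. *)
Lemma node_gens_base o b : base_point o -> b != 0 -> node_gens o b != 0.
Proof.
move=> bo b0; have [s0|s0] := eqVneq (b 0 0) 0; last first.
  by apply: node_gens_neq0 => //; case: bo.
have t0 : b 0 1 != 0.
  by move: b0; rewrite (row2E b) s0 row2_neq0 eqxx /= row2_1.
have [i oi] := base_point_zero bo.
have [ne0 ne1 _] := lift3_neq i.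
apply/rV0Pn; exists (rshift 3 i); rewrite row_mxEr mxE.
have [-> _ _] := cof3_lift i (fun n => o 0 n).
by rewrite !mulf_neq0 //; apply: (base_point_other_neq0 bo oi); rewrite eq_sym.
Qed.

Lemma bc_fibre_base o b : base_point o -> bc_fibre lam b o = 0.
Proof. by move=> [_ h1 h2]; rewrite /bc_fibre /hesse h1 h2 !mulr0 addr0. Qed.

Definition section_map o b := mkrow o b (node_gens o b).

Lemma section_map_Y o b : base_point o -> b != 0 -> Y_cone lam (section_map o b).
Proof.
move=> bo b0; have o0 : o != 0 by case: bo.
have g0 := node_gens_base bo b0.
split; rewrite ?crdE // => f; apply; split; rewrite ?crdE //.
  exact: bc_fibre_base.
by exists 1; rewrite scale1r.
Qed.

Lemma zero_sectionP o y w : base_point o -> coords y w ->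
  zero_section o y <-> prop o (crd2 w).
Proof.
move=> bo yw; split=> [[b [w' [yw' <- _]]]|h].
  by have /yscalE[] := coords_yscal yw' yw.
exists (crd1 w); have : lies_over y (crd2 w) (crd1 w) by exists w.
move/lies_over_trans; apply; [exact: prop_sym|exact: prop_refl].
Qed.

Lemma section_data o : base_point o ->
  curve_data (@zero_section K lam o) (section_map o) (@crd1 K).
Proof.
move=> bo; have o0 : o != 0 by case: bo.
split.
- rewrite (_ : zero_section o = [set y | forall w, coords y w -> prop o (crd2 w)]).
    apply: closed_prop => //; first exact: polymap_crd2.
      by move=> w w' /yscalE[].
    by move=> w [].
  apply/seteqP; split=> y; first by move=> oy w yw; apply/(zero_sectionP bo yw).
  by have [w yw] := coords_ex y; move/(_ w yw)/(zero_sectionP bo yw).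
- apply: polymap_mkrow; [exact: polymap_cst|exact: polymap_id|].
  by apply: polymap_node_gens; [exact: polymap_cst|exact: polymap_id].
- exact: polymap_crd1.
- by move=> b b0; exact: section_map_Y.
- move=> b b' bb; apply/yscalE; rewrite !crdE; split => //.
    exact: prop_refl.
  have [c c0 ->] := bb; rewrite -[in X in prop _ X](scale1r o) node_gensZ.
  by rewrite expr1n mul1r; exists c.
- by move=> w w' /yscalE[].
- move=> y w /(zero_sectionP bo) h yw; have oy := h _ yw.
  have Dw := coords_dom yw; have [_ b0 _ _] := Dw; split => //.
  apply/yscalE; rewrite !crdE; split; [exact: prop_sym|exact: prop_refl|].
  have [c c0 e] := oy.
  have gE : node_gens (crd2 w) (crd1 w) = c ^+ 2 *: node_gens o (crd1 w).
    by rewrite e -[in LHS](scale1r (crd1 w)) node_gensZ mulr1.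
  have c20 : c ^+ 2 != 0 by rewrite expf_neq0.
  have g0 : node_gens (crd2 w) (crd1 w) != 0.
    by rewrite gE scaler_eq0 negb_or c20 node_gens_base.
  apply: prop_trans (prop_sym (Y_cone_node_gens Dw g0)) _.
  by rewrite gE; apply: prop_sym; exists (c ^+ 2).
- move=> b y b0 yb; apply/(zero_sectionP bo yb); rewrite crdE.
  exact: prop_refl.
- by move=> b _; rewrite crdE; exact: prop_refl.
Qed.

(* The line a N_r = 0 in the fibre over b; the map X gives the P^5-component of
   its points in terms of the parameter a N' of the line. *)
Definition plane_line (N : 'M[K]_3) r b (X : 'rV[K]_2 -> 'rV[K]_(3 + 3)) : set Y :=
  [set y | forall w, coords y w -> [/\ prop b (crd1 w), crd2 w *m col r N = 0 &
     prop (X (crd2 w *m col' r N)) (crd5 w)]].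

Lemma plane_line_data (V N : 'M[K]_3) r b X : V *m N = 1%:M -> b != 0 ->
  polymap X -> (forall v v', prop v v' -> prop (X v) (X v')) ->
  (forall v, v != 0 -> Y_cone lam (mkrow (v *m row' r V) b (X v))) ->
  curve_data (plane_line N r b X) (fun v => mkrow (v *m row' r V) b (X v))
    (fun w => crd2 w *m col' r N).
Proof.
move=> VN b0 pX Xr hY.
have L0 w : Y_cone lam w -> crd2 w *m col r N = 0 -> crd2 w *m col' r N != 0.
  move=> [w2 _ _ _] wn; apply: contra_neq w2 => E.
  by rewrite (dual_split VN wn) E mul0mx.
have X0 v : v != 0 -> X v != 0 by move=> /hY[_ _]; rewrite crdE.
have pL : polymap (fun w => crd2 w *m col' r N).
  exact: polymap_comp (@polymap_crd2 K) (polymap_mulmx _).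
have Lr w w' : yscal w w' -> prop (crd2 w *m col' r N) (crd2 w' *m col' r N).
  by move=> /yscalE[h _ _]; exact: (prop_mulmx (col' r N) h).
have line1 w y : coords y w -> prop b (crd1 w) -> crd2 w *m col r N = 0 ->
    prop (X (crd2 w *m col' r N)) (crd5 w) -> plane_line N r b X y.
  move=> yw h1 h2 h3 w' yw'; have ww := coords_yscal yw yw'.
  have /yscalE[g2 g1 g5] := ww; split; first exact: prop_trans h1 g1.
    by have [c _ ->] := g2; rewrite -scalemxAl h2 scaler0.
  apply: prop_trans g5; apply: prop_trans h3.
  by apply: Xr; apply: prop_sym; exact: Lr.
split.
- rewrite (_ : plane_line N r b X =
    [set y | forall w, coords y w -> prop b (crd1 w)] `&`
    ([set y | forall w, coords y w -> forall _ : unit,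
       (crd2 w *m col r N) 0 0 = 0] `&`
    [set y | forall w, coords y w -> forall ij : 'I_6 * 'I_6,
       X (crd2 w *m col' r N) 0 ij.1 * crd5 w 0 ij.2 -
       X (crd2 w *m col' r N) 0 ij.2 * crd5 w 0 ij.1 = 0])); last first.
    apply/seteqP; split=> y.
      move=> h; split; [|split] => w yw; have [h1 h2 h3] := h _ yw;
        have Dw := coords_dom yw; have [_ w1 w5 _] := Dw.
      - exact: h1.
      - by move=> _; rewrite h2 mxE.
      - exact: ((prop_minors (X0 _ (L0 _ Dw h2)) w5).1 h3).
    move=> [h1 [h2 h3]] w yw; have Dw := coords_dom yw; have [_ w1 w5 _] := Dw.
    have h2' : crd2 w *m col r N = 0 by apply/eqP; rewrite mx11_eq0 (h2 _ yw tt).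
    split => //; first exact: h1.
    by apply/prop_minors => //; [apply: X0; exact: L0|exact: h3].
  have gY := good_surfY lam; apply: (closed_setI gY); [|apply: (closed_setI gY)].
  + apply: closed_prop => //; first exact: polymap_crd1.
      by move=> w w' /yscalE[].
    by move=> w [].
  + apply: (closed_cone (Y_cone lam) (@yscal_refl K) (h := fun (_ : unit) w =>
      (crd2 w *m col r N) 0 0)).
      move=> _; exact: (polymap_comp (@polymap_crd2 K) (polymap_mulmx (col r N)) 0).
    move=> w w' /yscalE[[c _ e] _ _] h _; rewrite e -scalemxAl scale_coord.
    by rewrite (h tt) mulr0.
  + apply: closed_minors; [exact: polymap_comp pL pX|exact: polymap_crd5|].
    by move=> w w' ww; have /yscalE[_ _ h] := ww; split => //; exact/Xr/Lr.
- apply: polymap_mkrow => //; first exact: polymap_mulmx.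
  exact: polymap_cst.
- exact: pL.
- exact: hY.
- move=> v v' vv; apply/yscalE; rewrite !crdE; split; last exact: Xr.
    exact: prop_mulmx.
  exact: prop_refl.
- exact: Lr.
- move=> y w Ay yw; have [h1 h2 h3] := Ay _ yw.
  split; first by apply: L0 => //; exact: coords_dom yw.
  apply/yscalE; rewrite !crdE; split; [|exact: prop_sym|exact: prop_sym].
  by rewrite -(dual_split VN h2); exact: prop_refl.
- move=> v y v0 yv; apply: (line1 _ _ yv); rewrite !crdE.
  + exact: prop_refl.
  + by rewrite -mulmxA row'_col // mulmx0.
  + by rewrite -mulmxA row'_col' // mulmx1; exact: prop_refl.
- by move=> v v0; rewrite crdE -mulmxA row'_col' // mulmx1; exact: prop_refl.
Qed.

End SpecialCurves.

(* The rows of V are the vertices of the triangle and the columns of N the linear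
   forms of its sides. *)
Section Triangle.
Variables (K : numClosedFieldType) (lam : K) (V N : 'M[K]_3) (b0 : 'rV[K]_2)
  (e : K).
Hypotheses (VN : V *m N = 1%:M) (s0 : b0 0 0 != 0) (e0 : e != 0)
  (fibreE : forall a, bc_fibre lam b0 a = e * \prod_r (a *m N) 0 r).
Implicit Types (a o : 'rV[K]_3) (b v : 'rV[K]_2)
  (w : 'rV[K]_(3 + 2 + (3 + 3))) (r t : 'I_3).
Local Notation Y := (surfY lam).
Implicit Types (y : Y).

Let b0n0 : b0 != 0.
Proof. by apply/rV0Pn; exists 0. Qed.

Let mul_col a r : (a *m col r N == 0) = ((a *m N) 0 r == 0).
Proof.
rewrite mx11_eq0; congr (_ == 0); rewrite !mxE.
by apply: eq_bigr => k _; rewrite !mxE.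
Qed.

Definition tri_gens r v := node_gens (v *m row' r V) b0.
Definition tri_line r : set Y := plane_line N r b0 (tri_gens r).

Let row'_neq0 r v : v != 0 -> v *m row' r V != 0.
Proof.
apply: contra_neq => E; rewrite -[v]mulmx1 -(row'_col' r VN) mulmxA E.
exact: mul0mx.
Qed.

Lemma tri_line_data r : curve_data (tri_line r)
  (fun v => mkrow (v *m row' r V) b0 (tri_gens r v)) (fun w => crd2 w *m col' r N).
Proof.
apply: plane_line_data => //.
- by apply: polymap_node_gens; [exact: polymap_mulmx|exact: polymap_cst].
- move=> v v' [c c0 ->]; rewrite /tri_gens -scalemxAl -[b0]scale1r node_gensZ.
  rewrite scale1r mulr1; exists (c ^+ 2) => //; exact: expf_neq0.
- move=> v v0; have a0 := row'_neq0 r v0; have g0 := node_gens_neq0 s0 a0.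
  split; rewrite ?crdE // => f; apply; split; rewrite ?crdE //; last first.
    by exists 1; rewrite scale1r.
  rewrite fibreE (bigD1 r) //= (_ : (_ *m N) 0 r = 0) ?mul0r ?mulr0 //.
  by apply/eqP; rewrite -mul_col -mulmxA row'_col // mulmx0.
Qed.

Lemma tri_lineP r y a b : lies_over y a b ->
  tri_line r y <-> prop b0 b /\ a *m col r N = 0.
Proof.
move=> yab; have [w [yw wa wb]] := yab; split=> [/(_ _ yw)[]|[h1 h2]].
  by rewrite wa wb.
apply: (cd_mem (tri_line_data r) (v := a *m col' r N)).
  have [a0 _] := lies_over_neq0 yab.
  by apply: contra_neq a0 => E; rewrite (dual_split VN h2) E mul0mx.
rewrite /tri_gens -(dual_split VN h2).
apply: (coords_Y_trans yw); apply/yscalE; rewrite !crdE wa wb; split.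
- exact: prop_refl.
- exact: prop_sym.
have [a0 _] := lies_over_neq0 yab; have g0 := node_gens_neq0 s0 a0.
have [c c0 bE] := h1.
have gE : node_gens a b = c *: node_gens a b0.
  by rewrite bE -[in LHS](scale1r a) node_gensZ expr1n mul1r.
have g0' : node_gens a b != 0 by rewrite gE scaler_eq0 negb_or c0.
have h5 : prop (node_gens a b) (crd5 w).
  by have := Y_cone_node_gens (coords_dom yw); rewrite wa wb; apply.
apply: prop_trans (prop_sym h5) (prop_sym _); exists c => //; exact: gE.
Qed.

Lemma tri_line_cover y a b : lies_over y a b -> prop b0 b ->
  exists r, tri_line r y.
Proof.
move=> yab h; have [w [yw wa wb]] := yab.
have := Y_cone_fibre (coords_dom yw); rewrite wa wb.
have [c c0 ->] := h; rewrite -[a]scale1r bc_fibreZ fibreE.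
move/eqP; rewrite mulf_eq0 expr1n mulr1 expf_eq0 (negPf c0) /=.
rewrite mulf_eq0 (negPf e0) /= => /prodf_eq0[r _ ar].
by exists r; apply/(tri_lineP _ yab); split => //; apply/eqP; rewrite mul_col.
Qed.

Lemma tri_point a : a != 0 -> bc_fibre lam b0 a = 0 ->
  exists y, lies_over (lam := lam) y a b0.
Proof.
move=> a0 Fa; have g0 := node_gens_neq0 s0 a0.
have [|y yw] := @surfY_pt K lam (mkrow a b0 (node_gens a b0)).
  split; rewrite ?crdE // => f; apply; split; rewrite ?crdE //.
  by exists 1; rewrite scale1r.
by exists y, (mkrow a b0 (node_gens a b0)); rewrite !crdE.
Qed.

Let vertex_col r t : (row t V *m N) 0 r = (t == r)%:R.
Proof. by rewrite -row_mul VN !mxE. Qed.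

Lemma tri_vertex_point t : exists y, lies_over (lam := lam) y (row t V) b0.
Proof.
apply: tri_point.
  by apply/negP => /eqP E; have := vertex_col t t;
    rewrite E mul0mx mxE eqxx => /eqP; rewrite eq_sym oner_eq0.
rewrite fibreE; have [n nt] : exists n : 'I_3, t != n.
  by move: t; apply: ord3P; [exists o1|exists o0|exists o0].
by rewrite (bigD1 n) //= vertex_col (negPf nt) mul0r mulr0.
Qed.

Lemma tri_line_vertex r t y : lies_over y (row t V) b0 ->
  tri_line r y <-> t != r.
Proof.
move=> h; split=> [/(tri_lineP _ h)[_ /eqP]|tr].
  by rewrite mul_col vertex_col pnatr_eq0; case: (t == r).
apply/(tri_lineP _ h); split; first exact: prop_refl.
by apply/eqP; rewrite mul_col vertex_col (negPf tr).
Qed.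

Lemma tri_line_incl r t : tri_line r `<=` tri_line t -> r = t.
Proof.
move=> rt; have [y h] := tri_vertex_point t; apply/eqP/negPn/negP => nrt.
have /rt : tri_line r y by apply/(tri_line_vertex _ h); rewrite eq_sym.
by move/(tri_line_vertex _ h); rewrite eqxx.
Qed.

Lemma tri_lines_meet r t : r != t -> exists p,
  tri_line r `&` tri_line t = [set p] /\
  transversal_at (tri_line r) (tri_line t) p.
Proof.
move=> rt; have [n [nr nt cov]] := ord3_third rt.
have [p hp] := tri_vertex_point n.
have pr : tri_line r p by apply/(tri_line_vertex _ hp).
have pt : tri_line t p by apply/(tri_line_vertex _ hp).
have dec a : a *m col t N = 0 ->
    a = (a *m N) 0 n *: row n V + (a *m N) 0 r *: row r V.
  move=> /eqP; rewrite mul_col => /eqP at0.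
  exact: (dual_decomp VN nr cov at0).
have on a : a *m col r N = 0 -> a *m col t N = 0 -> a != 0 ->
    prop (row n V) a.
  move=> /eqP; rewrite mul_col => /eqP ar /dec aE a0.
  rewrite ar scale0r addr0 in aE; exists ((a *m N) 0 n) => //.
  by apply: contra_neq a0 => c0; rewrite aE c0 scale0r.
exists p; split.
  apply/seteqP; split=> [y [yr yt]|_ ->]; last by split.
  have [a [b yab]] := lies_over_ex y.
  have [h1 h2] := (tri_lineP _ yab).1 yr; have [_ h3] := (tri_lineP _ yab).1 yt.
  have [a0 _] := lies_over_neq0 yab.
  have [n0 _] := lies_over_neq0 hp; symmetry.
  exact: (lies_over_unique hp yab (on _ h2 h3 a0) h1 (node_gens_neq0 s0 n0)).
apply: (transversal_of_data (tri_line_data r)) => // y w w' yt yw pw' Lw.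
have [w2' _ _ _] := coords_dom pw'.
have [_ at' _] := yt _ yw; have [_ ar' _] := pr _ pw'; have [_ at'' _] := pt _ pw'.
apply: prop_trans (prop_sym (prop_mulmx (col' r N) (on _ ar' at'' w2'))) _.
(* [L] is the projection from vertex [r], which lies on side [t]; it therefore contracts that side
   to the image of vertex [n]. *)
have LE : crd2 w *m col' r N =
    (crd2 w *m N) 0 n *: (row n V *m col' r N).
  rewrite {1}(dec _ at') mulmxDl -!scalemxAl.
  suff -> : row r V *m col' r N = 0 by rewrite scaler0 addr0.
  apply/rowP => k; rewrite !mxE.
  have := congr1 (fun A : 'M_3 => A r (lift r k)) VN; rewrite !mxE.
  rewrite (negPf (neq_lift r k)) => E; rewrite -[RHS]E.
  by apply: eq_bigr => i _; rewrite !mxE.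
exists ((crd2 w *m N) 0 n) => //.
by apply: contra_neq Lw => c0; rewrite LE c0 scale0r.
Qed.

End Triangle.

(** * Splitting of the I_3 members into three lines *)

Section I3Fibre.
Variables (K : numClosedFieldType) (lam : K).
Implicit Types (a o : 'rV[K]_3) (b : 'rV[K]_2) (r t : 'I_3).

Lemma cube_root_unity : exists w : K, w ^+ 2 + w + 1 = 0 /\ w ^+ 3 = 1.
Proof.
pose s := sqrtC (- 3%:R : K); have s2 : s ^+ 2 = - 3%:R := sqrtCK _.
have w1 : ((-1 + s) / 2%:R) ^+ 2 + (-1 + s) / 2%:R + 1 = 0.
  move: (s) s2 => {}s s2.
  transitivity ((s ^+ 2 + 3%:R) / 4%:R); first by field.
  by rewrite s2 addNr mul0r.
exists ((-1 + s) / 2%:R); split => //.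
move: (_ / _) w1 => w w1.
transitivity ((w - 1) * (w ^+ 2 + w + 1) + 1); first by ring.
by rewrite w1 mulr0 add0r.
Qed.

(** With mu = - lambda, mu^3 = 1 and z' = mu z, the member is x^3 + y^3 + z'^3 - 3 x y z', the
    product over r of x + w^r y + w^(2r) z'. So [N] is a Fourier matrix with one row scaled by mu,
    and [V] is its inverse. The non-zero entries of [V] keep the vertices apart from the base
    points. *)
Lemma I3_triangle b : bc_m b != 0 -> (bc_l lam b / bc_m b) ^+ 3 = -1 ->
  exists (V N : 'M[K]_3) (e : K), [/\ V *m N = 1%:M, e != 0,
    forall a, bc_fibre lam b a = e * \prod_r (a *m N) 0 r &
    forall r k, V r k != 0].
Proof.
have [w [w1 w3]] := cube_root_unity.
move=> m0 l3; set mu := - (bc_l lam b / bc_m b).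
have mu3 : mu ^+ 3 = 1 by rewrite /mu exprNn l3; ring.
have mu0 : mu != 0.
  by apply/eqP => E; move/eqP: mu3; rewrite E expr0n /= eq_sym oner_eq0.
have w0 : w != 0.
  by apply/eqP => E; move/eqP: w3; rewrite E expr0n /= eq_sym oner_eq0.
have th0 : 3%:R != 0 :> K by rewrite pnatr_eq0.
pose d (i : 'I_3) : K := if i == o2 then mu else 1.
have d0 i : d i != 0 by rewrite /d; case: ifP => // _; exact: oner_neq0.
pose N : 'M[K]_3 := \matrix_(i, r) (d i * w ^+ (i * r)).
(* The exponent 2 i r stands for - i r, since w^3 = 1. *)
pose V : 'M[K]_3 := \matrix_(r, i) (w ^+ (2 * i * r) / (3%:R * d i)).
have VN : V *m N = 1%:M.
  apply/matrixP => r t; rewrite !mxE.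
  have VNE (k : 'I_3) : V r k * N k t = w ^+ (2 * r + t) ^+ k / 3%:R.
    rewrite !mxE -exprM (_ : ((2 * r + t) * k = 2 * k * r + k * t)%N); last first.
      by rewrite mulnDl [(t * k)%N]mulnC mulnAC.
    rewrite exprD; move: (d k) (d0 k) (w ^+ (2 * k * r)) (w ^+ (k * t)) => D D0 A B.
    by field; rewrite D0.
  rewrite (eq_bigr _ (fun k _ => VNE k)) -mulr_suml sum3 /= expr0 expr1.
  have [->|rt] := eqVneq r t.
    have -> : w ^+ (2 * t + t) = 1.
      by rewrite -mulSnr exprM w3 expr1n.
    by rewrite expr1n -[true%:R]/1; field.
  suff E : 1 + w ^+ (2 * r + t) + w ^+ (2 * r + t) ^+ 2 = 0 by rewrite E mul0r.
  have h1 : 1 + w + w ^+ 2 = 0 by rewrite -[RHS]w1; ring.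
  have h2 : 1 + w ^+ 2 + w ^+ 2 ^+ 2 = 0.
    have -> : 1 + w ^+ 2 + w ^+ 2 ^+ 2 = 1 + w ^+ 2 + w ^+ 3 * w by ring.
    by rewrite w3 mul1r -[RHS]w1; ring.
  have h4 : w ^+ 4 = w by rewrite (exprD w 3 1) w3 mul1r.
  have h5 : w ^+ 5 = w ^+ 2 by rewrite (exprD w 3 2) w3 mul1r.
  move: r t rt {VNE}; apply: ord3P; apply: ord3P => // _;
    rewrite -[(2 * _ + _)%N]/1%N || rewrite -[(2 * _ + _)%N]/2%N ||
    rewrite -[(2 * _ + _)%N]/4%N || rewrite -[(2 * _ + _)%N]/5%N;
    by rewrite ?expr1 ?h4 ?h5.
exists V, N, (bc_m b); split => //; last first.
  by move=> r k; rewrite mxE mulf_neq0 ?expf_neq0 // invr_neq0 // mulf_neq0.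
move=> a; rewrite prod3 !mxE !sum3 !mxE /d /= !(mul0n, mul1n, muln0, muln1).
rewrite /bc_fibre hesse3.
have -> : bc_l lam b = - mu * bc_m b by rewrite /mu opprK divfK.
move: (a 0 o0) (a 0 o1) (a 0 o2) (bc_m b) => x y z m.
rewrite !expr0 !expr1.
have -> : (x * (1 * 1) + y * (1 * 1) + z * (mu * 1)) *
   (x * (1 * 1) + y * (1 * w) + z * (mu * w ^+ 2)) *
   (x * (1 * 1) + y * (1 * w ^+ 2) + z * (mu * w ^+ (2 * 2))) =
   (x + y + z * mu) * (x ^+ 2 + w ^+ 3 * (y ^+ 2 + w ^+ 3 * (z * mu) ^+ 2) +
   (w ^+ 2 + w ^+ 3 * w) * x * (z * mu) + (w ^+ 2 + w) * x * y +
   (w ^+ 3 * w ^+ 2 + w ^+ 3 * w) * y * (z * mu)) by ring.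
have wE : w ^+ 2 = - 1 - w.
  by transitivity (w ^+ 2 + w + 1 - 1 - w); [ring|rewrite w1; ring].
rewrite w3 wE.
have -> : m * (x ^+ 3 + y ^+ 3 + z ^+ 3) + 3 * (- mu * m) * (x * y * z) =
  m * (x ^+ 3 + y ^+ 3 + mu ^+ 3 * z ^+ 3) + 3 * (- mu * m) * (x * y * z).
  by rewrite mu3 mul1r.
ring.
Qed.

End I3Fibre.

(** * Position of points on the sides of a triangle *)

Section Marked.
Variables (K : numClosedFieldType) (lam : K) (V N : 'M[K]_3) (b0 : 'rV[K]_2)
  (e : K).
Hypotheses (VN : V *m N = 1%:M) (s0 : b0 0 0 != 0) (e0 : e != 0)
  (fibreE : forall a, bc_fibre lam b0 a = e * \prod_r (a *m N) 0 r)
  (V0 : forall r k, V r k != 0).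
Implicit Types (a o : 'rV[K]_3) (b : 'rV[K]_2) (r t : 'I_3).

(** A point on two sides is a vertex, whose coordinates are all non-zero, whereas a base point has a
    zero coordinate. *)
Lemma base_point_one_line o r t : base_point o ->
  o *m col r N = 0 -> o *m col t N = 0 -> r = t.
Proof.
move=> bo /eqP + /eqP; rewrite !mx11_eq0.
have E k : (o *m col k N) 0 0 = (o *m N) 0 k.
  by rewrite !mxE; apply: eq_bigr => j _; rewrite !mxE.
rewrite !E => /eqP or /eqP ot; apply/eqP/negPn/negP => rt.
have [n [nr nt cov]] := ord3_third rt.
have oE : o = (o *m N) 0 n *: row n V.
  by rewrite {1}(dual_decomp VN nr cov ot) or scale0r addr0.
have [on0 _ P0] := bo.
have c0 : (o *m N) 0 n != 0.
  by apply: contra_neq on0 => c0; rewrite oE c0 scale0r.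
move/eqP: P0; rewrite prod3 oE !scale_coord !mulf_eq0 (negPf c0) !mxE.
by rewrite !(negPf (V0 _ _)).
Qed.

(** [same_line] allows any line contained in the triangle. If no side contained both points, each
    side form would be non-zero somewhere on that line, and so would their product. *)
Lemma same_lineP o q : same_line (bc_fibre lam b0) o q <->
  exists r, o *m col r N = 0 /\ q *m col r N = 0.
Proof.
have E (x : 'rV[K]_3) k : (x *m col k N) 0 0 = (x *m N) 0 k.
  by rewrite !mxE; apply: eq_bigr => j _; rewrite !mxE.
split=> [[n [n0 on qn h]]|[r [hor hqr]]]; last first.
  exists (col r N); split => //.
    apply/negP => /eqP c0; have : (V *m col r N) r 0 = (V *m N) r r.
      by rewrite !mxE; apply: eq_bigr => j _; rewrite !mxE.
    by rewrite c0 mulmx0 VN !mxE eqxx => /eqP; rewrite eq_sym oner_eq0.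
  move=> x /eqP; rewrite mx11_eq0 E => /eqP xr.
  by rewrite fibreE (bigD1 r) //= xr mul0r mulr0.
apply: contrapT => nr.
have hx r : exists x : 'rV[K]_3, x *m n = 0 /\ (x *m N) 0 r != 0.
  apply: contrapT => hr; apply: nr; exists r.
  split; apply/eqP; rewrite mx11_eq0 E; apply/negPn/negP => nz; apply: hr;
    [by exists o|by exists q].
have [x0 [xn0 h0]] := hx o0; have [x1 [xn1 h1]] := hx o1; have [x2 [xn2 h2]] := hx o2.
(* Along x0 + u x1 + u^2 x2 the side form r has its value at x_r as coefficient of degree r, so none
   of the three polynomials is zero. *)
pose P r : {poly K} := ((x0 *m N) 0 r)%:P + ((x1 *m N) 0 r) *: 'X + ((x2 *m N) 0 r) *: 'X^2.
have PE r u : (P r).[u] = ((x0 + u *: x1 + u ^+ 2 *: x2) *m N) 0 r.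
  rewrite /P !hornerD !hornerZ hornerC hornerX hornerXn !mulmxDl -!scalemxAl.
  rewrite !(mxE, scale_coord); ring.
have cP r k : (P r)`_k = if k == 0%N then (x0 *m N) 0 r else
    if k == 1%N then (x1 *m N) 0 r else if k == 2%N then (x2 *m N) 0 r else 0.
  rewrite /P !coefD coefC !coefZ coefX coefXn.
  by case: k => [|[|[|k]]] /=; rewrite !(mulr0, mulr1, addr0, add0r).
have P0 r : P r != 0.
  apply/negP => /eqP Pr; have := cP r 0%N; have := cP r 1%N; have := cP r 2%N.
  rewrite Pr !coef0 /=; move: r {Pr}; apply: ord3P => c2 c1 c0.
  - by rewrite -c0 eqxx in h0.
  - by rewrite -c1 eqxx in h1.
  - by rewrite -c2 eqxx in h2.
have [u] := poly_nonroot (mulf_neq0 (mulf_neq0 (P0 o0) (P0 o1)) (P0 o2)).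
rewrite !hornerM !PE => nz.
have := h (x0 + u *: x1 + u ^+ 2 *: x2).
rewrite !mulmxDl -!scalemxAl xn0 xn1 xn2 !scaler0 !addr0 => /(_ erefl) /eqP.
by rewrite fibreE prod3 mulf_eq0 (negPf e0) (negPf nz).
Qed.

End Marked.

(** * The I_6 fibre over s = 0 *)

Section Hexagon.
Variables (K : numClosedFieldType) (lam : K).
Implicit Types (a o T : 'rV[K]_3) (b v : 'rV[K]_2) (x : 'rV[K]_(3 + 3))
  (w : 'rV[K]_(3 + 2 + (3 + 3))) (i k n : 'I_3).
Local Notation Y := (surfY lam).
Implicit Types (y : Y).

Let b0 : 'rV[K]_2 := row2 0 1.
Let b0n0 : b0 != 0. Proof. by rewrite row2_neq0 oner_neq0 orbT. Qed.

(** The P^5 component of the strict transform of the line x_k = 0: over s = 0 only the generator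
    omitting x_k survives on it, so this component is constant. *)
Definition node_dir k : 'rV[K]_(3 + 3) := row_mx 0 (delta_mx 0 k).

Lemma delta_coord k n : (delta_mx 0 k : 'rV[K]_3) 0 n = (n == k)%:R.
Proof. by rewrite mxE. Qed.

Lemma node_gens_l a b i : node_gens a b 0 (lshift 3 i) = b 0 0 * a 0 i ^+ 2.
Proof. by rewrite row_mxEl mxE. Qed.

Lemma node_gens_r a b i : node_gens a b 0 (rshift 3 i) =
  b 0 1 * \prod_(n < 3 | n != i) a 0 n.
Proof. by rewrite row_mxEr mxE. Qed.

Lemma node_dirE k : [/\ forall i, node_dir k 0 (lshift 3 i) = 0,
  node_dir k 0 (rshift 3 k) = 1 &
  forall i, i != k -> node_dir k 0 (rshift 3 i) = 0].
Proof.
split=> [i||i ik]; rewrite ?row_mxEl ?row_mxEr mxE // ?eqxx //.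
by rewrite (negPf ik).
Qed.

Lemma node_dir_neq0 k : node_dir k != 0.
Proof.
apply/rV0Pn; exists (rshift 3 k); have [_ -> _] := node_dirE k.
exact: oner_neq0.
Qed.

Lemma node_dir_inj i k : prop (node_dir i) (node_dir k) -> i = k.
Proof.
move=> [c c0 E]; apply/eqP/negPn/negP => ik.
have := congr1 (fun x : 'rV[K]_(3 + 3) => x 0 (rshift 3 k)) E.
rewrite scale_coord; have [_ -> _] := node_dirE k.
have [_ _ ->] := node_dirE i; last by rewrite eq_sym.
by rewrite mulr0 => /eqP; rewrite oner_eq0.
Qed.

Lemma node_gens_opposite k a b : b 0 0 = 0 -> a 0 k = 0 ->
  node_gens a b = (b 0 1 * (a 0 (lift k 0) * a 0 (lift k 1))) *: node_dir k.
Proof.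
move=> s0 ak; have [c1 c2 c3] := cof3_lift k (fun n => a 0 n).
rewrite /node_dir scale_row_mx scaler0; congr row_mx.
  by apply/rowP => n; rewrite !mxE s0 mul0r.
by apply: (row3_liftP (k := k)); rewrite !mxE ?c1 ?c2 ?c3 ?ak ?eqxx ?eq_lift3 /=;
  rewrite ?(mulr0, mul0r, mulr1).
Qed.

(* The points of the line which are not nodes lie on the graph; the two nodes
   are limits of them. *)
Lemma hexa_line_Y k v : v != 0 ->
  Y_cone lam (mkrow (v *m row' k 1%:M) b0 (node_dir k)).
Proof.
move=> v0; have a0 (u : 'rV[K]_2) : u != 0 -> u *m row' k 1%:M != 0.
  apply: contra_neq => E; rewrite -[u]mulmx1 -(row'_col' k (mulmx1 1%:M)).
  by rewrite mulmxA E mul0mx.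
split; rewrite ?crdE ?node_dir_neq0 ?a0 // => f hf; move: f hf.
pose u1 := row2 (1 : K) 1.
have [P hP] := polyfun_curve (polycurve_line v u1)
  (polyfunM (polyfun_coord K 0) (polyfun_coord K 1)).
have P0 : P != 0.
  apply/negP => /eqP E; have := hP 1; rewrite E horner0 line_through1 row2_0 row2_1.
  by rewrite mulr1 => /eqP; rewrite oner_eq0.
have := @quad_closure _ 0 1 P _ _ (fun u _ => line_through v u1 u)
  (fun u => mkrow (u *m row' k 1%:M) b0 (node_dir k)) (graph_cone lam) P0 _ _ _ _ 0.
rewrite line_through0; apply.
- by rewrite hornerC oner_eq0.
- apply: polymap_mkrow; [exact: polymap_mulmx|exact: polymap_cst|exact: polymap_cst].
- exact: quad_fun_curve (polycurve_line v u1).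
- move=> u t _; rewrite -hP; move: (line_through v u1 u) => z z0.
  have nz : z != 0.
    by apply: contra_neq z0 => ->; rewrite !mxE mul0r.
  have [zk zk0 zk1] := row'1E k z.
  split; rewrite ?crdE ?node_dir_neq0 ?a0 //.
    rewrite bc_fibreE /b0 row2_0 row2_1 /xyz (bigD1 k) //= zk; ring.
  exists (z 0 0 * z 0 1)^-1.
  rewrite (node_gens_opposite (row2_0 _ _) zk) row2_1 zk0 zk1 mul1r scalerA mulVf //.
  by rewrite scale1r.
- by rewrite horner0 expr0n mulr0.
Qed.

Definition hexa_line k : set Y := plane_line 1%:M k b0 (fun=> node_dir k).

Lemma hexa_line_data k : curve_data (hexa_line k)
  (fun v => mkrow (v *m row' k 1%:M) b0 (node_dir k))
  (fun w => crd2 w *m col' k 1%:M).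
Proof.
apply: plane_line_data => //.
- exact: mulmx1.
- exact: polymap_cst.
- by move=> v v' _; exact: prop_refl.
- exact: hexa_line_Y.
Qed.

Let col1 a k : (a *m col k 1%:M == 0) = (a 0 k == 0).
Proof.
rewrite mx11_eq0 mxE (bigD1 k) //= !mxE eqxx mulr1 big1 ?addr0 // => n nk.
by rewrite !mxE (negPf nk) mulr0.
Qed.

Lemma hexa_lineP k y w : coords y w -> hexa_line k y <->
  [/\ prop b0 (crd1 w), crd2 w 0 k = 0 & prop (node_dir k) (crd5 w)].
Proof.
move=> yw; split=> [/(_ _ yw)[h1 /eqP h2 h3]|[h1 h2 h3] w' yw'].
  by rewrite col1 in h2; split => //; exact/eqP.
have /yscalE[g2 g1 g5] := coords_yscal yw yw'.
split; [exact: prop_trans h1 g1| |exact: prop_trans h3 g5].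
by apply/eqP; rewrite col1; have [c _ ->] := g2; rewrite scale_coord h2 mulr0.
Qed.

(** No condition on [b] is imposed: at the node e_k the fibre equation is s^2 = 0, so a point over
    e_k automatically lies over s = 0. *)
Definition exc k : set Y :=
  [set y | forall w, coords y w -> prop (delta_mx 0 k) (crd2 w)].

Lemma excP k y a b : lies_over y a b -> exc k y <-> prop (delta_mx 0 k) a.
Proof.
move=> [w [yw <- _]]; split=> [/(_ _ yw) //|h w' yw'].
have /yscalE[g2 _ _] := coords_yscal yw yw'; exact: prop_trans h g2.
Qed.

Let delta_neq0 k : (delta_mx 0 k : 'rV[K]_3) != 0.
Proof.
apply/rV0Pn; exists k; have [-> _ _] := delta3E k K; exact: oner_neq0.
Qed.

Lemma closed_exc k : closed_in (exc k).
Proof.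
apply: closed_prop => //; first exact: polymap_crd2.
  by move=> w w' /yscalE[].
by move=> w [].
Qed.

Lemma bc_fibre_node k b : bc_fibre lam b (delta_mx 0 k) = b 0 0 ^+ 2.
Proof.
have [d0 d1 d2] := delta3E k K.
rewrite bc_fibreE /cubes /xyz (sum3_lift k) (prod3_lift k) d0 d1 d2; ring.
Qed.

Lemma exc_fibre k y w : exc k y -> coords y w -> prop b0 (crd1 w).
Proof.
move=> h yw; have [c c0 e] := h _ yw; have Dw := coords_dom yw.
have := Y_cone_fibre Dw; rewrite e -[crd1 w]scale1r bc_fibreZ bc_fibre_node.
rewrite expr1n mul1r => /eqP; rewrite mulf_eq0 expf_eq0 (negPf c0) /= sqrf_eq0.
move=> /eqP s0; have [_ w1 _ _] := Dw.
exists (crd1 w 0 1).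
  by move: w1; rewrite (row2E (crd1 w)) s0 row2_neq0 eqxx /= row2_1.
by apply: row2P; rewrite !scale_coord /b0 ?row2_0 ?row2_1 ?s0 ?mulr0 ?mulr1 ?mul1r.
Qed.

Lemma hexa_line_disjoint i k : i != k -> hexa_line i `&` hexa_line k = set0.
Proof.
move=> ik; apply/seteqP; split=> // y [yi yk]; have [w yw] := coords_ex y.
have [_ _ h1] := (hexa_lineP i yw).1 yi; have [_ _ h2] := (hexa_lineP k yw).1 yk.
by move/eqP: ik; apply; apply: node_dir_inj; apply: prop_trans h1 (prop_sym h2).
Qed.

Lemma exc_disjoint i k : i != k -> exc i `&` exc k = set0.
Proof.
move=> ik; apply/seteqP; split=> // y [yi yk]; have [w yw] := coords_ex y.
have [c c0 E] := prop_trans (yi _ yw) (prop_sym (yk _ yw)).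
have := congr1 (fun x : 'rV[K]_3 => x 0 k) E; rewrite scale_coord !mxE !eqxx.
by rewrite eq_sym (negPf ik) mulr0 => /eqP; rewrite oner_eq0.
Qed.

Lemma hexa_line_exc_same k : hexa_line k `&` exc k = set0.
Proof.
apply/seteqP; split=> // y [yl ye]; have [w yw] := coords_ex y.
have [_ wk _] := (hexa_lineP k yw).1 yl; have [c c0 cE] := ye _ yw.
by move: c0; rewrite -[c]mulr1 -wk cE scale_coord mxE !eqxx.
Qed.

(** The parameter of the line depends only on the plane point, which is constant on [exc k], so the
    retraction contracts the exceptional curve. *)
Lemma hexa_line_exc_meet i k : i != k -> exists p,
  hexa_line i `&` exc k = [set p] /\ transversal_at (hexa_line i) (exc k) p.
Proof.
move=> ik.
have [v [v0 vE]] : exists v : 'rV[K]_2, v != 0 /\ v *m row' i 1%:M = delta_mx 0 k.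
  exists (delta_mx 0 k *m col' i 1%:M).
  have E : (delta_mx 0 k : 'rV[K]_3) *m col i 1%:M = 0.
    by apply/eqP; rewrite col1 mxE (negPf ik) andbF.
  have Es := dual_split (mulmx1 (1%:M : 'M[K]_3)) E.
  split; last by rewrite -Es.
  apply: contra_neq (delta_neq0 k) => z; by rewrite Es z mul0mx.
have [p pE] := surfY_pt (hexa_line_Y i v0); rewrite vE in pE.
have pl : hexa_line i p.
  apply/(hexa_lineP _ pE); rewrite !crdE; split; try exact: prop_refl.
  by rewrite mxE (negPf ik) andbF.
have pe : exc k p.
  apply/(excP k (a := delta_mx 0 k) (b := b0)); last exact: prop_refl.
  by exists (mkrow (delta_mx 0 k) b0 (node_dir i)); rewrite !crdE.
exists p; split.
  apply/seteqP; split=> [y [yl ye]|_ ->]; last by split.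
  have [w yw] := coords_ex y; have [h1 _ h3] := (hexa_lineP i yw).1 yl.
  apply: (coords_inj yw); apply: (coords_Y_trans pE); apply/yscalE.
  by rewrite !crdE; split => //; exact: ye.
apply: (transversal_of_data (hexa_line_data i)) => // y w w' ye yw pw' _.
exact: (prop_mulmx (col' i 1%:M) (prop_trans (prop_sym (pe _ pw')) (ye _ yw))).
Qed.

Lemma hexagon_cover y w : coords y w -> prop b0 (crd1 w) ->
  exists k, hexa_line k y \/ exc k y.
Proof.
move=> yw h1; have Dw := coords_dom yw; have [w2 w1 _ _] := Dw.
have s0 : crd1 w 0 0 = 0 by have [c _ ->] := h1; rewrite scale_coord row2_0 mulr0.
have t0 : crd1 w 0 1 != 0.
  by move: w1; rewrite (row2E (crd1 w)) s0 row2_neq0 eqxx /= row2_1.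
have [k ak] : exists k, crd2 w 0 k = 0.
  have /eqP := Y_cone_fibre Dw; rewrite bc_fibreE s0 expr0n /= mul0r mulr0 !add0r.
  rewrite mulf_eq0 mulf_eq0 pnatr_eq0 sqrf_eq0 (negPf t0) /=.
  by move=> /prodf_eq0[k _ /eqP ak]; exists k.
have [l0|l0] := eqVneq (crd2 w 0 (lift k 0)) 0.
  exists (lift k 1); right; apply/(excP _ (a := crd2 w) (b := crd1 w)).
    by exists w.
  have aE : crd2 w = crd2 w 0 (lift k 1) *: delta_mx 0 (lift k 1).
    by apply: (row3_liftP (k := k));
      rewrite scale_coord delta_coord ?eqxx ?eq_lift3 ?mulr0 ?mulr1.
  exists (crd2 w 0 (lift k 1)) => //.
  by apply: contra_neq w2 => c0; rewrite aE c0 scale0r.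
have [l1|l1] := eqVneq (crd2 w 0 (lift k 1)) 0.
  exists (lift k 0); right; apply/(excP _ (a := crd2 w) (b := crd1 w)).
    by exists w.
  have aE : crd2 w = crd2 w 0 (lift k 0) *: delta_mx 0 (lift k 0).
    by apply: (row3_liftP (k := k));
      rewrite scale_coord delta_coord ?eqxx ?eq_lift3 ?mulr0 ?mulr1.
  exists (crd2 w 0 (lift k 0)) => //.
exists k; left; apply/(hexa_lineP k yw); split => //.
have gE := node_gens_opposite s0 ak.
have c0 : crd1 w 0 1 * (crd2 w 0 (lift k 0) * crd2 w 0 (lift k 1)) != 0.
  by rewrite !mulf_neq0.
have g0 : node_gens (crd2 w) (crd1 w) != 0.
  by rewrite gE scaler_eq0 negb_or c0 node_dir_neq0.
apply: prop_trans (Y_cone_node_gens Dw g0).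
by exists (crd1 w 0 1 * (crd2 w 0 (lift k 0) * crd2 w 0 (lift k 1))).
Qed.

(* The exceptional curve over e_k is the conic X_k^2 = -3 Y_i Y_j; its points are
   limits for u -> 0 along arcs with a = e_k + O(u) and s = u S. *)

Let arc k v (u S : K) := mkrow
  (delta_mx 0 k + u *: (row2 (v 0 1 ^+ 2) (v 0 0 ^+ 2) *m row' k 1%:M))
  (row2 (u * S) 1)
  (row_mx (\row_i (S * (delta_mx 0 k + u *: (row2 (v 0 1 ^+ 2) (v 0 0 ^+ 2) *m row' k 1%:M)
             : 'rV[K]_3) 0 i ^+ 2))
    ((u * (v 0 0 ^+ 2 * v 0 1 ^+ 2)) *: delta_mx 0 k +
       row2 (v 0 0 ^+ 2) (v 0 1 ^+ 2) *m row' k 1%:M)).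

Let conic5 k v : 'rV[K]_(3 + 3) :=
  row_mx ((sqrtC (- 3%:R) * (v 0 0 * v 0 1)) *: delta_mx 0 k)
         (row2 (v 0 0 ^+ 2) (v 0 1 ^+ 2) *m row' k 1%:M).

Let conic k v := mkrow (delta_mx 0 k) b0 (conic5 k v).

Let conic5Z k v c : conic5 k (c *: v) = c ^+ 2 *: conic5 k v.
Proof.
rewrite /conic5 scale_row_mx !scale_coord; congr row_mx.
  by rewrite scalerA; congr (_ *: _); ring.
rewrite scalemxAl; congr (_ *m _).
by apply: row2P; rewrite scale_coord ?row2_0 ?row2_1 exprMn.
Qed.

Let conicE k v : conic k v = arc k v 0 (sqrtC (- 3%:R) * (v 0 0 * v 0 1)).
Proof.
rewrite /conic /conic5 /arc !scale0r !addr0 !mul0r scale0r add0r.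
congr (mkrow _ _ (row_mx _ _)); apply/rowP => i; rewrite !mxE.
by case: (i == k); rewrite ?andbF /= ?expr1n ?expr0n.
Qed.

Let arc_coords k v u (a := delta_mx 0 k + u *: (row2 (v 0 1 ^+ 2) (v 0 0 ^+ 2) *m row' k 1%:M)
             : 'rV[K]_3) :
  [/\ a 0 k = 1, a 0 (lift k 0) = u * v 0 1 ^+ 2 & a 0 (lift k 1) = u * v 0 0 ^+ 2].
Proof.
have [e1 e2 e3] := row'1E k (row2 (v 0 1 ^+ 2) (v 0 0 ^+ 2)).
have [d1 d2 d3] := delta3E k K.
by rewrite /a; split; rewrite mxE scale_coord ?d1 ?d2 ?d3 ?e1 ?e2 ?e3 ?row2_0 ?row2_1
  ?mulr0 ?addr0 ?add0r.
Qed.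

Let arc_graph k v u S : v != 0 -> u != 0 ->
  (1 + ((v 0 0 ^+ 6 + v 0 1 ^+ 6) * u ^+ 3 +
    3%:R * lam * (v 0 0 ^+ 2 * v 0 1 ^+ 2) * u ^+ 2)) * S ^+ 2 =
    - (3%:R * (v 0 0 ^+ 2 * v 0 1 ^+ 2)) ->
  graph_cone lam (arc k v u S).
Proof.
move=> v0 u0 hS; rewrite /arc; have [a1 a2 a3] := arc_coords k v u.
move: (delta_mx 0 k + u *: _) a1 a2 a3 => a a1 a2 a3.
have [e1 e2 e3] := row'1E k (row2 (v 0 0 ^+ 2) (v 0 1 ^+ 2)).
have [d1 d2 d3] := delta3E k K.
rewrite row2_0 in e2; rewrite row2_1 in e3.
split; rewrite !crdE.
- by apply/rV0Pn; exists k; rewrite a1 oner_neq0.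
- by rewrite row2_neq0 oner_neq0 orbT.
- have : (v 0 0 != 0) || (v 0 1 != 0) by rewrite -row2_neq0 -row2E.
  move=> /orP[z|z]; apply/rV0Pn; [exists (rshift 3 (lift k 0))|exists (rshift 3 (lift k 1))];
    by rewrite row_mxEr mxE scale_coord ?d2 ?d3 ?e2 ?e3 mulr0 add0r expf_neq0.
- rewrite bc_fibreE /cubes /xyz (sum3_lift k) (prod3_lift k) a1 a2 a3 row2_0 row2_1.
  (* Since s^2 = u^2 S^2, t = 1 and x y z = u^2 v0^2 v1^2, a factor u^2 splits off the fibre
     equation. *)
  transitivity (u ^+ 2 * ((1 + ((v 0 0 ^+ 6 + v 0 1 ^+ 6) * u ^+ 3 +
    3%:R * lam * (v 0 0 ^+ 2 * v 0 1 ^+ 2) * u ^+ 2)) * S ^+ 2 +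
    3%:R * (v 0 0 ^+ 2 * v 0 1 ^+ 2))); first by ring.
  by rewrite hS addNr mulr0.
- exists u^-1; rewrite /node_gens scale_row_mx; congr row_mx.
    by apply/rowP => i; rewrite !mxE /=; field.
  have [c1 c2 c3] := cof3_lift k (fun n => a 0 n).
  by apply: (row3_liftP (k := k)); rewrite [LHS]mxE scale_coord ?d1 ?d2 ?d3 ?e1 ?e2 ?e3
    scale_coord [in RHS]mxE ?c1 ?c2 ?c3 ?a1 ?a2 ?a3 row2_1; field.
Qed.

(** For u non-zero the arc lies on the graph once S solves a quadratic equation over the u-line; the
    point of the conic is the limit at u = 0, where the equation reads S^2 = -3 v0^2 v1^2. *)
Lemma conic_Y k v : v != 0 -> Y_cone lam (conic k v).
Proof.
move=> v0; split; rewrite ?crdE //.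
  have [e1 e2 e3] := row'1E k (row2 (v 0 0 ^+ 2) (v 0 1 ^+ 2)).
  rewrite row2_0 in e2; rewrite row2_1 in e3.
  have : (v 0 0 != 0) || (v 0 1 != 0) by rewrite -row2_neq0 -row2E.
  move=> /orP[z|z]; apply/rV0Pn; [exists (rshift 3 (lift k 0))|exists (rshift 3 (lift k 1))];
    by rewrite row_mxEr ?e2 ?e3 expf_neq0.
rewrite conicE.
pose q : {poly K} := 1 + ((v 0 0 ^+ 6 + v 0 1 ^+ 6) *: 'X^3 +
  (3%:R * lam * (v 0 0 ^+ 2 * v 0 1 ^+ 2)) *: 'X^2).
pose p : {poly K} := (- (3%:R * (v 0 0 ^+ 2 * v 0 1 ^+ 2)))%:P.
have qE u : q.[u] = 1 + ((v 0 0 ^+ 6 + v 0 1 ^+ 6) * u ^+ 3 +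
    3%:R * lam * (v 0 0 ^+ 2 * v 0 1 ^+ 2) * u ^+ 2).
  by rewrite /q !hornerD !hornerZ !hornerXn hornerC.
have q0 : q.[0] = 1 by rewrite qE !expr0n !mulr0 !addr0.
have := @quad_closure _ p q 'X 2 _ (fun u S => row2 u S)
  (fun z => arc k v (z 0 0) (z 0 1)) (graph_cone lam) _ _ _ _ _
  (sqrtC (- 3%:R) * (v 0 0 * v 0 1)).
rewrite row2_0 row2_1; apply.
- by rewrite polyX_eq0.
- by rewrite q0 oner_neq0.
- have p0 : polyfun (fun z : 'rV[K]_2 => z 0 0) := polyfun_coord K 0.
  have p1 : polyfun (fun z : 'rV[K]_2 => z 0 1) := polyfun_coord K 1.
  have pa : polymap (fun z : 'rV[K]_2 => delta_mx 0 k +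
      z 0 0 *: (row2 (v 0 1 ^+ 2) (v 0 0 ^+ 2) *m row' k 1%:M) : 'rV[K]_3).
    move=> i; under eq_fun do rewrite mxE scale_coord.
    by apply: polyfunD; [exact: polyfun_cst|apply: polyfunM => //; exact: polyfun_cst].
  apply: polymap_mkrow => //.
    apply: ord2P; [under eq_fun do rewrite row2_0; exact: polyfunM|].
    by under eq_fun do rewrite row2_1; exact: polyfun_cst.
  apply: polymap_row_mx => i.
    under eq_fun do rewrite mxE; apply: polyfunM => //; exact/polyfunX/pa.
  under eq_fun do rewrite mxE scale_coord.
  apply: polyfunD; last exact: polyfun_cst.
  apply: polyfunM; last exact: polyfun_cst.
  by apply: polyfunM => //; exact: polyfun_cst.
- apply: quad_fun_row2 (quad_fun_sqrt p q).
  have [M [A [B h]]] := quad_fun_poly p q 'X.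
  by exists M, A, B => u t E; rewrite -(h u t E) hornerX.
- move=> u S; rewrite qE hornerC hornerX row2_0 row2_1 => E u0.
  exact: arc_graph.
- by rewrite q0 hornerC mul1r exprMn sqrtCK exprMn; ring.
Qed.

Lemma exc_equation k w : Y_cone lam w -> crd2 w = delta_mx 0 k ->
  [/\ crd5 w 0 (lshift 3 (lift k 0)) = 0, crd5 w 0 (lshift 3 (lift k 1)) = 0,
      crd5 w 0 (rshift 3 k) = 0 &
      crd5 w 0 (lshift 3 k) ^+ 2 = - 3%:R *
        (crd5 w 0 (rshift 3 (lift k 0)) * crd5 w 0 (rshift 3 (lift k 1)))].
Proof.
move=> Dw aE; have [d0 d1 d2] := delta3E k K.
have p2 i : polyfun (fun w => crd2 w 0 i) by exact: polymap_crd2.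
have p5 (i : 'I_(3 + 3)) : polyfun (fun w => crd5 w 0 i) by exact: polymap_crd5.
have X0 i : k != i -> crd5 w 0 (lshift 3 i) = 0.
  move=> ki; have := @Y_cone_eq0 K lam (fun w =>
    crd5 w 0 (lshift 3 i) * crd2 w 0 k ^+ 2 - crd5 w 0 (lshift 3 k) * crd2 w 0 i ^+ 2)
    _ _ w Dw.
  rewrite aE d0 delta_coord [i == k]eq_sym (negPf ki) expr1n mulr1 expr0n mulr0 subr0.
  apply.
    by apply: polyfunB; apply: polyfunM => //; exact: polyfunX.
  by move=> z [_ _ _ _ [c ->]]; rewrite !scale_coord !node_gens_l; ring.
have Y0 : crd5 w 0 (rshift 3 k) = 0.
  have := @Y_cone_eq0 K lam (fun w =>
    crd5 w 0 (rshift 3 k) * crd2 w 0 k - crd5 w 0 (rshift 3 (lift k 0)) * crd2 w 0 (lift k 0))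
    _ _ w Dw.
  rewrite aE d0 d1 mulr1 mulr0 subr0; apply.
    by apply: polyfunB; exact: polyfunM.
  move=> z [_ _ _ _ [c ->]]; rewrite !scale_coord !node_gens_r.
  have [c1 c2 _] := cof3_lift k (fun n => crd2 z 0 n).
  by rewrite c1 c2; ring.
have [n0 n1 _] := lift3_neq k.
split; [exact: X0|exact: X0|exact: Y0|].
(* On the graph this expression is c^2 x_k^4 times the fibre equation, so it vanishes on the
   closure; at e_k it becomes the conic. *)
have := @Y_cone_eq0 K lam (fun w =>
  3%:R * crd2 w 0 k ^+ 3 * (crd5 w 0 (rshift 3 (lift k 0)) * crd5 w 0 (rshift 3 (lift k 1)))
  + crd5 w 0 (lshift 3 k) ^+ 2 * (cubes (crd2 w) + 3%:R * lam * xyz (crd2 w))) _ _ w Dw.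
rewrite aE d0 /cubes /xyz !(sum3_lift k) !(prod3_lift k) d0 d1 d2.
rewrite !expr1n !expr0n /= !addr0 !mulr0 !mulr1 addr0 mulr1.
move=> h; apply/eqP; rewrite mulNr -addr_eq0 addrC; apply/eqP; apply: h.
  apply: polyfunD; apply: polyfunM.
  - by apply: polyfunM; [exact: polyfun_cst|exact: polyfunX].
  - exact: polyfunM.
  - exact: polyfunX.
  - apply: polyfunD; first exact: (polyfun_comp (@polymap_crd2 K) (@polyfun_cubes K)).
    apply: polyfunM; first exact: polyfun_cst.
    exact: (polyfun_comp (@polymap_crd2 K) (@polyfun_xyz K)).
move=> z [_ _ _ F [c ->]]; rewrite !scale_coord !node_gens_l !node_gens_r.
have [_ c1 c2] := cof3_lift k (fun n => crd2 z 0 n).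
rewrite c1 c2; rewrite bc_fibreE /cubes /xyz !(sum3_lift k) !(prod3_lift k) in F *.
transitivity (c ^+ 2 * crd2 z 0 k ^+ 4 * 0); last by rewrite mulr0.
by rewrite -[in RHS]F; ring.
Qed.

Lemma exc_conic k y : exc k y -> exists v, v != 0 /\ coords y (conic k v).
Proof.
move=> ye; have [w1 yw1] := coords_ex y.
have [w [yw aE bE]] : exists w, [/\ coords y w, crd2 w = delta_mx 0 k & crd1 w = b0].
  exists (mkrow (delta_mx 0 k) b0 (crd5 w1)); rewrite !crdE; split => //.
  apply: (coords_Y_trans yw1); apply/yscalE; rewrite !crdE; split.
  - exact: prop_sym (ye _ yw1).
  - exact: prop_sym (exc_fibre ye yw1).
  - exact: prop_refl.
have Dw := coords_dom yw; have [_ _ w5 _] := Dw.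
have [x1 x2 y0 xE] := exc_equation Dw aE.
set X := crd5 w 0 (lshift 3 k) in xE.
set Y1 := crd5 w 0 (rshift 3 (lift k 0)) in xE.
set Y2 := crd5 w 0 (rshift 3 (lift k 1)) in xE.
(* The square roots are determined up to sign, and the sign of the second one is adjusted to match
   [X]. *)
have [v [v1 v2 vX]] : exists v : 'rV[K]_2, [/\ v 0 0 ^+ 2 = Y1, v 0 1 ^+ 2 = Y2 &
    sqrtC (- 3%:R) * (v 0 0 * v 0 1) = X].
  have : X ^+ 2 == (sqrtC (- 3%:R) * (sqrtC Y1 * sqrtC Y2)) ^+ 2.
    by rewrite xE !exprMn !sqrtCK.
  rewrite eqf_sqr => /orP[] /eqP E.
    by exists (row2 (sqrtC Y1) (sqrtC Y2)); rewrite row2_0 row2_1 !sqrtCK.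
  exists (row2 (sqrtC Y1) (- sqrtC Y2)); rewrite row2_0 row2_1 sqrrN !sqrtCK.
  by split => //; rewrite E; ring.
have wE : w = conic k v.
  rewrite (mk_crd w) aE bE; congr mkrow.
  have [e1 e2 e3] := row'1E k (row2 (v 0 0 ^+ 2) (v 0 1 ^+ 2)).
  have [d0 d1 d2] := delta3E k K.
  rewrite /conic5 -[LHS]hsubmxK vX; congr row_mx; apply: (row3_liftP (k := k));
    rewrite ?scale_coord ?d0 ?d1 ?d2 ?mulr0 ?mulr1 ?e1 ?e2 ?e3 ?row2_0 ?row2_1;
    rewrite [LHS]mxE ?v1 ?v2 //.
exists v; split; last by rewrite -wE.
apply: contra_neq w5 => v0; rewrite wE crdE /conic5 v0 !mxE mulr0 mulr0 scale0r expr0n /=.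
rewrite (_ : row2 0 0 = 0) ?mul0mx ?row_mx0 //.
by apply: row2P; rewrite !mxE.
Qed.

Lemma rational_image_exc k : rational_image (exc k).
Proof.
have [y0 _] := surfY_pt (hexa_line_Y k b0n0).
have [|||phi [phiP mphi]] := @cone_mapT K 2 _ [set v | v != 0]
  (@prop K 1) (Y_cone lam) (@yscal K) (conic k) y0
  (@prop_refl K 1) (@prop_sym K 1) (@yscal_refl K) (@yscal_sym K)
  (@yscal_trans K).
- apply: polymap_mkrow; [exact: polymap_cst|exact: polymap_cst|].
  have p0 : polyfun (fun z : 'rV[K]_2 => z 0 0) := polyfun_coord K 0.
  have p1 : polyfun (fun z : 'rV[K]_2 => z 0 1) := polyfun_coord K 1.
  apply: polymap_row_mx.
    apply: polymapZ; last exact: polymap_cst.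
    by apply: polyfunM; [exact: polyfun_cst|exact: polyfunM].
  apply: (polymap_comp (F := fun v : 'rV[K]_2 => row2 (v 0 0 ^+ 2) (v 0 1 ^+ 2))
    (G := fun z => z *m row' k 1%:M)); last exact: polymap_mulmx.
  by apply: ord2P; [under eq_fun do rewrite row2_0|under eq_fun do rewrite row2_1];
    exact: polyfunX.
- by move=> v v0; exact: conic_Y.
- move=> v v' _ _ [c c0 ->]; apply/yscalE; rewrite !crdE.
  split; try exact: prop_refl.
  by exists (c ^+ 2); [exact: expf_neq0|exact: conic5Z].
exists phi => //; split=> [p|y ye].
  have [v pv] := coords_ex p.
  apply/(excP k (a := delta_mx 0 k) (b := b0)); last exact: prop_refl.
  by exists (conic k v); rewrite !crdE; split => //; exact: phiP.
have [v [v0 yv]] := exc_conic ye; have [p pv] := proj_pt v0.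
by exists p; exact: coords_inj (phiP _ _ pv) yv.
Qed.

End Hexagon.

(** * The involution and the configuration *)

Lemma transversal_sym (K : fieldType) (X : fspace K) (A B : set X) p :
  transversal_at A B p -> transversal_at B A p.
Proof.
move=> t U f oU Up rf fp.
have [V [g [h [[oV Vp VU rg rh] [gA hB E]]]]] := t _ _ oU Up rf fp.
by exists V, h, g; split; split => // x Vx; rewrite E // addrC.
Qed.

Lemma meet_once_sym (K : fieldType) (X : fspace K) (A B : set X) :
  meet_once A B -> meet_once B A.
Proof.
by move=> [p [E t]]; exists p; split; [rewrite setIC|exact: transversal_sym].
Qed.

Section EnriquesInvolution.
Variables (K : numClosedFieldType) (lam : K) (o : 'rV[K]_3)
  (Q : proj_space K 1 -> surfY lam) (j : surfY lam -> surfY lam).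
Hypotheses (lam3 : lam ^+ 3 != -1) (bo : base_point o)
  (twQ : twist_section o Q) (trj : translation_deck o Q j).
Implicit Types (a q T : 'rV[K]_3) (b : 'rV[K]_2)
  (w : 'rV[K]_(3 + 2 + (3 + 3))).
Local Notation Y := (surfY lam).
Local Notation P1 := (proj_space K 1).
Implicit Types (y : Y) (v : P1).

Let mj : morphism j. Proof. by case: trj. Qed.
Let mQ : morphism Q. Proof. by case: twQ => -[]. Qed.
Let Q_ex v b : coords v b -> exists a, lies_over (Q v) a b.
Proof. by case: twQ => -[_ h] _ _ _ _; exact: h. Qed.

Let gY : good Y := good_surfY lam.
Let gP : good P1 := good_proj_space K 1.

Lemma deckE b : deck b = row2 (b 0 0) (- b 0 1).
Proof. by apply: row2P; rewrite !mxE. Qed.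

Lemma deckK b : deck (deck b) = b.
Proof. by rewrite !deckE row2_0 row2_1 opprK -row2E. Qed.

Lemma deckZ c b : deck (c *: b) = c *: deck b.
Proof. by apply: row2P; rewrite !deckE !scale_coord ?row2_0 ?row2_1 ?mulrN. Qed.

Lemma deck_neq0 b : b != 0 -> deck b != 0.
Proof. by rewrite deckE row2_neq0 oppr_eq0 -row2_neq0 -row2E. Qed.

Lemma prop_deck b b' : prop b b' -> prop (deck b) (deck b').
Proof. by move=> [c c0 ->]; exists c => //; rewrite deckZ. Qed.

Lemma bc_m_deck b : bc_m (deck b) = bc_m b.
Proof. by rewrite /bc_m deckE row2_0. Qed.

Lemma bc_l_deck b : bc_l lam (deck b) = bc_l lam b.
Proof. by rewrite /bc_l deckE row2_0 row2_1 sqrrN. Qed.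

Lemma bc_fibre_deck b : bc_fibre lam (deck b) = bc_fibre lam b.
Proof. by rewrite /bc_fibre bc_m_deck bc_l_deck. Qed.

Lemma smooth_fibre_deck b : smooth_fibre lam (deck b) <-> smooth_fibre lam b.
Proof. by rewrite /smooth_fibre bc_m_deck bc_l_deck. Qed.

Let P1_pt b : b != 0 -> exists v, coords v b.
Proof. exact: proj_pt. Qed.

Let coordsP1 v b b' : coords v b -> prop b b' -> coords v b'.
Proof.
move=> vb bb; apply: (coords_trans (@prop_sym K 1) (@prop_trans K 1) vb _ bb).
by apply: (prop_neq0 bb); exact: (coords_dom vb).
Qed.

Let coordsP1_prop v b b' : coords v b -> coords v b' -> prop b b'.
Proof. exact: (coords_rel (@prop_refl K 1)). Qed.

Let v0_ex : exists v : P1, True.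
Proof. by have [|v _] := @P1_pt (row2 1 0); [rewrite row2_neq0 oner_neq0|exists v]. Qed.

Lemma deck_map : exists deckP : P1 -> P1,
  (forall v b, coords v b -> coords (deckP v) (deck b)) /\ morphism deckP.
Proof.
have [v0 _] := v0_ex.
apply: (@cone_mapT K 2 2 [set v | v != 0] (@prop K 1) [set v | v != 0]
  (@prop K 1) (@deck K) v0 (@prop_refl K 1) (@prop_sym K 1) (@prop_refl K 1)
  (@prop_sym K 1) (@prop_trans K 1)).
- apply: ord2P; under eq_fun do rewrite deckE ?row2_0 ?row2_1.
    exact: polyfun_coord.
  by apply: polyfunN; exact: polyfun_coord.
- exact: deck_neq0.
- by move=> b b' _ _; exact: prop_deck.
Qed.

Lemma projection : exists beta : Y -> P1,
  (forall y a b, lies_over y a b -> coords (beta y) b) /\ morphism beta.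
Proof.
have [v0 _] := v0_ex.
have [|||beta [h m]] := @cone_mapT K _ 2 (Y_cone lam) (@yscal K) [set v | v != 0]
  (@prop K 1) (@crd1 K) v0 (@yscal_refl K) (@yscal_sym K) (@prop_refl K 1)
  (@prop_sym K 1) (@prop_trans K 1).
- exact: polymap_crd1.
- by move=> w [].
- by move=> w w' _ _ /yscalE[].
by exists beta; split => // y a b [w [yw _ <-]]; exact: h.
Qed.

Lemma plane_map (M M' : 'M[K]_3) : M *m M' = 1%:M ->
  exists alpha : Y -> proj_space K 2,
  (forall y a b, lies_over y a b -> coords (alpha y) (a *m M)) /\ morphism alpha.
Proof.
move=> MM.
have M0 a : a != 0 -> a *m M != 0.
  by apply: contra_neq => E; rewrite -[a]mulmx1 -MM mulmxA E mul0mx.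
have [v0 _] : exists v : proj_space K 2, True.
  have o0 : o != 0 by case: bo.
  by have [v _] := proj_pt o0; exists v.
have [|||alpha [h m]] := @cone_mapT K _ 3 (Y_cone lam) (@yscal K) [set v | v != 0]
  (@prop K 2) (fun w => crd2 w *m M) v0 (@yscal_refl K) (@yscal_sym K) (@prop_refl K 2)
  (@prop_sym K 2) (@prop_trans K 2).
- exact: (polymap_comp (@polymap_crd2 K) (polymap_mulmx M)).
- by move=> w [w2 _ _ _]; exact: M0.
- by move=> w w' _ _ /yscalE[h _ _]; exact: prop_mulmx.
by exists alpha; split => // y a b [w [yw <- _]]; exact: h.
Qed.

Lemma section_ex T : base_point T -> exists sigma : P1 -> Y,
  (forall v b, coords v b -> lies_over (sigma v) T b) /\ morphism sigma.
Proof.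
move=> bT.
have [phi [_ [_ _ m _ [h _ _ _ _]]]] := curve_maps (section_data lam bT).
exists phi; split => // v b vb; exists (section_map T b).
by rewrite !crdE; split => //; exact: h.
Qed.

Lemma smooth_dense : dense [set v : P1 | exists2 b, coords v b & smooth_fibre lam b].
Proof.
pose h (_ : unit) := disc lam.
have ph i : polyfun (h i) := polyfun_disc lam.
have oU : closed_in [set v : P1 | forall b, coords v b -> forall i, h i b = 0].
  apply: (closed_cone _ (@prop_refl K 1) ph) => b b' [c c0 ->] hb i.
  rewrite /h /disc /bc_m /bc_l !scale_coord.
  transitivity (c ^+ 8 * h i b); last by rewrite hb mulr0.
  by rewrite /h /disc /bc_m /bc_l; ring.
have [b1 [sb b10]] : exists b, smooth_fibre lam b /\ b != 0.
  exists (row2 1 (sqrtC (- lam))); rewrite row2_neq0 oner_neq0; split => //.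
  exact: smooth_fibre_ex.
have [v1 vb1] := P1_pt b10.
move=> U oU' U0; have [|v [nv Uv]] := irreducible_proj_space oU oU' _ U0.
  exists v1 => /= /(_ _ vb1 tt)/eqP; case: sb => m0 d0.
  by rewrite /h /disc mulf_eq0 (negPf m0) (negPf d0).
exists v; split => //; have [b vb] := coords_ex v; exists b => //.
apply: contrapT => nsb; apply: nv => b' vb' i.
have [c c0 ->] := coordsP1_prop vb vb'.
have hb : h i b = 0.
  apply/eqP/negPn/negP; rewrite /h /disc mulf_eq0 negb_or => /andP[m0 d0].
  by apply: nsb.
transitivity (c ^+ 8 * h i b); last by rewrite hb mulr0.
by rewrite /h /disc /bc_m /bc_l !scale_coord; ring.
Qed.

Let smooth_s b : smooth_fibre lam b -> b 0 0 != 0.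
Proof. by case; rewrite /bc_m expf_eq0. Qed.

Let smooth_neq0 b : smooth_fibre lam b -> b != 0.
Proof. by move=> /smooth_s b0; apply/rV0Pn; exists 0. Qed.

Let smooth_gens a b : smooth_fibre lam b -> a != 0 -> node_gens a b != 0.
Proof. by move=> /smooth_s; exact: node_gens_neq0. Qed.

(** On a smooth fibre [j (j y)] is y + Q(-b) + Q(b), with -b short for [deck b], and anti-invariance
    cancels the last two terms; the equality spreads by density. *)
Lemma enriques_involution : involutive j.
Proof.
move=> y; apply: (dense_closed (A := [set y | j (j y) = y])
  (@smooth_fibres_dense K lam)) y.
  exact: (closed_equalizer gY gY (@pair_charts_surfY K lam)
    (morphism_comp mj mj) (morphism_id Y)).
move=> y [w [yw [gw sb]]] /=; set b := crd1 w in sb; set a := crd2 w.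
have yab : lies_over y a b by exists w.
have b0 := smooth_neq0 sb; have sdb := (smooth_fibre_deck b).2 sb.
have [v vb] := P1_pt b0; have [v' vb'] := P1_pt (smooth_neq0 sdb).
have [q Qq] := Q_ex vb'; have [q2 Qq2] := Q_ex vb.
have [a' ja add1] := trj.2 _ _ _ _ _ sb yab vb' Qq.
have vb2 : coords v (deck (deck b)) by rewrite deckK.
have Qq2' : lies_over (Q v) q2 (deck (deck b)) by rewrite deckK.
have [a'' jja add2] := trj.2 _ _ _ _ _ sdb ja vb2 Qq2'.
rewrite deckK in jja add2; rewrite bc_fibre_deck in add1.
have [_ anti _ _ _] := twQ.
have add3 := anti _ _ _ _ _ sb vb vb' Qq2 Qq.
have [m0 d0] := sb.
have [[a0 _] [q0 _]] := (lies_over_neq0 yab, lies_over_neq0 Qq).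
have [[a0' _] [q20 _]] := (lies_over_neq0 ja, lies_over_neq0 Qq2).
have [a0'' _] := lies_over_neq0 jja.
have aa := cubic_addK m0 d0 bo a0 q0 q20 a0' a0'' add1 add2 add3.
symmetry; apply: (lies_over_unique yab jja aa (prop_refl b)).
exact: smooth_gens.
Qed.

Lemma lies_over_j y a b a' b' : lies_over y a b -> lies_over (j y) a' b' ->
  prop (deck b) b'.
Proof.
move=> yab jab; have [deckP [hd md]] := deck_map; have [beta [hb mb]] := projection.
suff E : beta (j y) = deckP (beta y).
  have := hb _ _ _ jab; rewrite E; have := hd _ _ (hb _ _ _ yab).
  exact: coordsP1_prop.
apply: (dense_closed (A := [set y | beta (j y) = deckP (beta y)])
  (@smooth_fibres_dense K lam)).
  exact: (closed_equalizer gY gP (@pair_charts_proj_space K 1)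
    (morphism_comp mj mb) (morphism_comp mb md)).
move=> z [w [zw [gw sb]]] /=; set c := crd1 w in sb.
have zc : lies_over z (crd2 w) c by exists w.
have [v vb] := P1_pt (smooth_neq0 ((smooth_fibre_deck c).2 sb)).
have [q Qq] := Q_ex vb.
have [a'' jz _] := trj.2 _ _ _ _ _ sb zc vb Qq.
apply: (coords_inj (hb _ _ _ jz)); exact: hd (hb _ _ _ zc).
Qed.

(** On smooth fibres o + Q = Q. Both sides are morphisms on P^1, so the equality also holds over the
    singular fibres. *)
Lemma j_section y v b : lies_over y o b -> coords v (deck b) -> j y = Q v.
Proof.
move=> yob vb; have [deckP [hd md]] := deck_map.
have [sigma [hs ms]] := section_ex bo.
have E v' : j (sigma v') = Q (deckP v').
  apply: (dense_closed (A := [set v | j (sigma v) = Q (deckP v)]) smooth_dense).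
    exact: (closed_equalizer gP gY (@pair_charts_surfY K lam)
      (morphism_comp ms mj) (morphism_comp md mQ)).
  move=> u [c uc sc] /=; have uc' := hd _ _ uc; have [q Qq] := Q_ex uc'.
  have [a' ja add] := trj.2 _ _ _ _ _ sc (hs _ _ uc) uc' Qq.
  rewrite bc_fibre_deck in add; have [m0 d0] := sc.
  have [[q0 _] [a0' _]] := (lies_over_neq0 Qq, lies_over_neq0 ja).
  have qa := cubic_add0 m0 d0 bo q0 a0' add.
  symmetry; apply: (lies_over_unique Qq ja qa (prop_refl _)).
  by apply: smooth_gens => //; exact/smooth_fibre_deck.
have [_ b0] := lies_over_neq0 yob.
have [u ub] := P1_pt b0.
have -> : y = sigma u.
  apply: (lies_over_unique yob (hs _ _ ub) (prop_refl o) (prop_refl b)).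
  exact: node_gens_base.
by rewrite E; congr Q; exact: coords_inj (hd _ _ ub) vb.
Qed.

Let jK := enriques_involution.

Local Notation exc := (@exc K lam).
Local Notation hexa_line := (@hexa_line K lam).

(** * The action of [j] on the I_6 fibre *)

Let binf : 'rV[K]_2 := row2 0 1.

Let binf_neq0 : binf != 0.
Proof. by rewrite row2_neq0 oner_neq0 orbT. Qed.

(** Translation by [T] is linear on the plane, so the plane component of [j] along the section
    through [T] is a fixed linear image of that of [Q]. This extends to infinity, where [Q] lies
    over the node e_k, and [inversion_nodes] gives e_i. *)
Lemma j_torsion T i y : base_point T -> T 0 i = 0 -> lies_over y T binf ->
  exc i (j y).
Proof.
move=> bT Ti yT; have [deckP [hd md]] := deck_map.
have [sigma [hs ms]] := section_ex bT.
pose M := inversion T *m inversion o.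
have MM : M *m (inversion o *m inversion T) = 1%:M.
  by rewrite mulmxA -[M *m _]mulmxA inversionK // mulmx1 inversionK.
have [alpha [ha ma]] := plane_map MM.
have [alpha1 [ha1 ma1]] := plane_map (mulmx1 (1%:M : 'M[K]_3)).
have E v : alpha1 (j (sigma v)) = alpha (Q (deckP v)).
  apply: (dense_closed (A := [set v | alpha1 (j (sigma v)) = alpha (Q (deckP v))])
    smooth_dense).
    exact: (closed_equalizer gP (good_proj_space K 2) (@pair_charts_proj_space K 2)
      (morphism_comp (morphism_comp ms mj) ma1)
      (morphism_comp (morphism_comp md mQ) ma)).
  move=> u [c uc sc] /=; have uc' := hd _ _ uc; have [q Qq] := Q_ex uc'.
  have [a' ja add] := trj.2 _ _ _ _ _ sc (hs _ _ uc) uc' Qq.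
  rewrite bc_fibre_deck in add; have [m0 d0] := sc.
  have [[q0 _] [a0' _]] := (lies_over_neq0 Qq, lies_over_neq0 ja).
  have qa := cubic_add_base m0 d0 bo bT q0 a0' add.
  have c1 := ha1 _ _ _ ja; rewrite mulmx1 in c1.
  have c2 := ha _ _ _ Qq; rewrite mulmxA in c2.
  apply: (coords_inj c1).
  exact: (coords_trans (@prop_sym K 2) (@prop_trans K 2) c2 (coords_dom c1) qa).
have [v vb] := P1_pt binf_neq0.
have -> : y = sigma v.
  apply: (lies_over_unique yT (hs _ _ vb) (prop_refl T) (prop_refl _)).
  exact: node_gens_base.
have [_ _ _ [k [ok Qk]] _] := twQ.
have vd : coords (deckP v) (delta_mx 0 1).
  apply: coordsP1 (hd _ _ vb) _; exists (-1); first by rewrite oppr_eq0 oner_eq0.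
  by apply: row2P; rewrite scale_coord deckE !mxE /=; ring.
have c2 := ha _ _ _ (Qk _ vd); rewrite -E mulmxA in c2.
have [a [b jab]] := lies_over_ex (j (sigma v)).
apply/(excP i jab); apply: prop_trans (inversion_nodes bo bT ok Ti) _.
have c1 := ha1 _ _ _ jab; rewrite mulmx1 in c1.
exact: (coords_rel (@prop_refl K 2) c2 c1).
Qed.

(** By irreducibility [j] sends C i into one C' k, and that into one C l. Since [j] is an
    involution, C i is contained in C l, so l = i. *)
Lemma component_swap (I : finType) (C C' : I -> set Y) :
  (forall i, closed_in (C i)) -> (forall i, closed_in (C' i)) ->
  (forall i, rational_image (C i)) -> (forall i, rational_image (C' i)) ->
  (forall i y, C i y -> exists k, C' k (j y)) ->
  (forall i y, C' i y -> exists k, C k (j y)) ->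
  (forall i k, C i `<=` C k -> i = k) ->
  forall i, exists k, (forall y, C i y -> C' k (j y)) /\
                      (forall y, C' k y -> C i (j y)).
Proof.
move=> cC cC' rC rC' CC' C'C incl i.
have [y Cy|k _ hk] := @rational_image_cover K lam _ I (enum I) C' j (rC i) mj cC'.
  by have [k Ck] := CC' _ _ Cy; exists k => //; rewrite mem_enum.
have [y Cy|l _ hl] := @rational_image_cover K lam _ I (enum I) C j (rC' k) mj cC.
  by have [l Cl] := C'C _ _ Cy; exists l => //; rewrite mem_enum.
exists k; split => //.
by rewrite (incl i l) // => y Cy; rewrite -[y]jK; apply: hl; exact: hk.
Qed.

Let hexC (u : 'I_3 + 'I_3) : set Y :=
  match u with inl i => hexa_line i | inr k => exc k end.

Let hexC_binf u y a b : lies_over y a b -> hexC u y -> prop binf b.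
Proof.
move=> [w [yw _ <-]]; case: u => i /=.
  by move=> /(hexa_lineP i yw)[].
by move=> /exc_fibre/(_ yw).
Qed.

Let hexC_cover y a b : lies_over y a b -> prop binf b -> exists u, hexC u y.
Proof.
move=> [w [yw _ <-]] /(hexagon_cover yw)[k [h|h]].
  by exists (inl k).
by exists (inr k).
Qed.

Let deck_binf b : prop binf b -> prop binf (deck b).
Proof.
move=> h; apply: prop_trans (prop_deck h); exists (-1).
  by rewrite oppr_eq0 oner_eq0.
by apply: row2P; rewrite scale_coord deckE ?row2_0 ?row2_1 ?mulr0 ?mulr1.
Qed.

Let hexC_j u y : hexC u y -> exists u', hexC u' (j y).
Proof.
move=> hu; have [a [b yab]] := lies_over_ex y.
have [a' [b' jab]] := lies_over_ex (j y).
apply: (hexC_cover jab); apply: prop_trans (lies_over_j yab jab).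
exact/deck_binf/(hexC_binf yab hu).
Qed.

Lemma neq3 (i k : 'I_3) : exists n, n != i /\ n != k.
Proof.
move: i k; apply: ord3P; apply: ord3P;
  by [exists o0|exists o1|exists o2].
Qed.

Let hexC_incl u u' : hexC u `<=` hexC u' -> u = u'.
Proof.
have meet i k : i != k -> exists y, hexa_line i y /\ exc k y.
  move=> /(hexa_line_exc_meet lam)[p [E _]]; exists p.
  by have : [set p] p by []; rewrite -E.
have dj (A B : set Y) y : A `&` B = set0 -> A y -> B y -> False.
  by move=> E Ay By; have : set0 y by rewrite -E.
case: u u' => i [] k /= h; have [n [ni nk]] := neq3 i k;
  have ni' : i != n by rewrite eq_sym.
- have [y [y1 y2]] := meet i n ni'.
  congr inl; apply/eqP/negPn/negP => ik.
  exact: (dj _ _ y (hexa_line_disjoint lam ik) y1 (h _ y1)).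
- have [y [y1 y2]] := meet i n ni'.
  by exfalso; exact: (dj _ _ y (exc_disjoint lam nk) y2 (h _ y1)).
- have [y [y1 y2]] := meet n i ni.
  by exfalso; exact: (dj _ _ y (hexa_line_disjoint lam nk) y1 (h _ y2)).
- have [y [y1 y2]] := meet n i ni.
  congr inr; apply/eqP/negPn/negP => ik.
  exact: (dj _ _ y (exc_disjoint lam ik) y2 (h _ y2)).
Qed.

Let torsion_points i : exists T T', [/\ base_point T, base_point T',
  T 0 i = 0, T' 0 i = 0 & ~ prop T T'].
Proof.
have [w [w1 w3]] := cube_root_unity K.
pose T c : 'rV[K]_3 := row2 1 (- c) *m row' i 1%:M.
have TE c : [/\ T c 0 i = 0, T c 0 (lift i 0) = 1 & T c 0 (lift i 1) = - c].
  by have := row'1E i (row2 1 (- c)); rewrite row2_0 row2_1.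
have bT c : c ^+ 3 = 1 -> base_point (T c).
  move=> c3; have [e1 e2 e3] := TE c; split.
  - by apply/rV0Pn; exists (lift i 0); rewrite e2 oner_neq0.
  - by rewrite (sum3_lift i) e1 e2 e3 exprNn c3; ring.
  - by rewrite (prod3_lift i) e1 !mul0r.
have [e1 e2 e3] := TE 1; have [f1 f2 f3] := TE w.
exists (T 1), (T w); split => //; [by apply: bT; rewrite expr1n|exact: bT|].
move=> [c c0 E]; have E1 := congr1 (fun x : 'rV[K]_3 => x 0 (lift i 0)) E.
have E2 := congr1 (fun x : 'rV[K]_3 => x 0 (lift i 1)) E.
rewrite /= scale_coord e2 f2 mulr1 in E1.
rewrite /= scale_coord e3 f3 -E1 mul1r in E2.
move/oppr_inj: E2 => w1'; move: w1; rewrite w1' expr1n => /eqP.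
have -> : 1 + 1 + 1 = 3%:R :> K by ring.
by rewrite pnatr_eq0.
Qed.

(** Two distinct base points on x_i = 0 give two points of the line that [j] sends into [exc i]. No
    other component meets [exc i] in more than one point, so the image component is [exc i]. *)
Lemma j_hexa_line i : (forall y, hexa_line i y -> exc i (j y)) /\
  (forall y, exc i y -> hexa_line i (j y)).
Proof.
have cl u : closed_in (hexC u).
  case: u => k; [exact: cd_closed (hexa_line_data lam k)|exact: closed_exc].
have ri u : rational_image (hexC u).
  case: u => k; last exact: rational_image_exc.
  exact: rational_image_of_data (hexa_line_data lam k).
have [u [h1 h2]] := component_swap cl cl ri ri hexC_j hexC_j hexC_incl (inl i).
suff E : u = inr i by rewrite E in h1 h2.
have [T [T' [bT bT' Ti Ti' nTT]]] := torsion_points i.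
have point U : base_point U -> U 0 i = 0 -> exists y,
    [/\ lies_over y U binf, hexa_line i y & exc i (j y)].
  move=> bU Ui; have [sigma [hs _]] := section_ex bU.
  have [v vb] := P1_pt binf_neq0; have yU := hs _ _ vb; exists (sigma v).
  split => //; last exact: j_torsion bU Ui yU.
  have [w [yw wa wb]] := yU; apply/(hexa_lineP i yw).
  rewrite wa wb; split => //; first exact: prop_refl.
  have g0 := node_gens_base bU binf_neq0.
  have := Y_cone_node_gens (coords_dom yw); rewrite wa wb => /(_ g0).
  apply: prop_trans; rewrite (node_gens_opposite (k := i)) ?row2_0 // row2_1.
  rewrite mul1r; exists (U 0 (lift i 0) * U 0 (lift i 1)) => //.
  have [ne0 ne1 _] := lift3_neq i.
  by rewrite mulf_neq0 //; apply: (base_point_other_neq0 bU Ui); rewrite eq_sym.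
have [y [yT yl ye]] := point T bT Ti; have [y' [yT' yl' ye']] := point T' bT' Ti'.
have := h1 _ yl; have := h1 _ yl'; case: (u) => k /= jy' jy.
  have [ki|ki] := eqVneq k i.
    have : (hexa_line i `&` exc i) (j y) by rewrite {1}ki in jy.
    by rewrite hexa_line_exc_same.
  have [p [E _]] := hexa_line_exc_meet lam ki.
  have e1 : (hexa_line k `&` exc i) (j y) by [].
  have e2 : (hexa_line k `&` exc i) (j y') by [].
  rewrite E in e1 e2; exfalso; apply: nTT.
  have yy : y = y' by rewrite -[y]jK -[y']jK e1 e2.
  by rewrite yy in yT; have [] := lies_over_prop yT yT'.
congr inr; apply/eqP/negPn/negP => ki.
by have : (exc k `&` exc i) (j y) by []; rewrite exc_disjoint.
Qed.

(** * The I_3 fibres and the components met by O and Q *)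

Definition fibre_over (mu : option K) : set Y := [set y | forall a b,
  lies_over y a b -> if mu is Some l then bc_m b != 0 /\ bc_l lam b = l * bc_m b
                     else bc_m b = 0].

(** The deck transformation preserves lambda ([None] is lambda = oo), so curves over different
    values are disjoint on [S] as well as on [Y]. *)
Lemma fibre_over_disjoint mu mu' (A B : set Y) : mu <> mu' ->
  A `<=` fibre_over mu -> B `<=` fibre_over mu' ->
  A `&` B = set0 /\ A `&` (j @^-1` B) = set0.
Proof.
move=> nmu hA hB.
pose cond (m : option K) b := if m is Some l then bc_m b != 0 /\ bc_l lam b = l * bc_m b
                     else bc_m b = 0.
have cond_inj b : cond mu b -> cond mu' b -> False.
  case: mu mu' nmu {hA hB} => [l|] [l'|] //= nmu.
  - move=> [m0 e1] [_ e2]; apply: nmu; congr Some; apply: (mulIf m0).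
    by rewrite -e1 -e2.
  - by move=> [m0 _] m00; rewrite m00 eqxx in m0.
  - by move=> m00 [m0 _]; rewrite m00 eqxx in m0.
have cond_deck b b' : prop (deck b) b' -> cond mu' b' -> cond mu' b.
  move=> [c c0 ->]; rewrite /cond /bc_m /bc_l !scale_coord !deckE !row2_0 !row2_1.
  have c2 : c ^+ 2 != 0 by rewrite expf_neq0.
  case: (mu') => [l|] /=; rewrite !exprMn.
    rewrite mulf_eq0 (negPf c2) /= sqrrN => -[m0 E]; split => //.
    apply: (mulfI c2); rewrite [RHS]mulrCA -E; ring.
  by move/eqP; rewrite mulf_eq0 (negPf c2) => /eqP.
split; apply/seteqP; split=> // y [yA yB].
  have [a [b yab]] := lies_over_ex y.
  exact: cond_inj (hA _ yA _ _ yab) (hB _ yB _ _ yab).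
have [a [b yab]] := lies_over_ex y; have [a' [b' jab]] := lies_over_ex (j y).
apply: cond_inj (hA _ yA _ _ yab) _.
exact: cond_deck (lies_over_j yab jab) (hB _ yB _ _ jab).
Qed.

(** [L] consists of the sides over one of the two points with t^2 = mu - lam. Since lam^3 != -1
    these points differ and [j] exchanges their fibres, so no side meets the [j]-image of a side.
    [r0] is the side met by O and [r1] the one met by Q. *)
Lemma special_fibre mu mu0 : mu ^+ 3 = -1 ->
  (forall v b q, coords v b -> bc_m b != 0 ->
     (bc_l lam b / bc_m b) ^+ 3 = -1 -> lies_over (Q v) q b ->
     (~ same_line (bc_fibre lam b) o q <-> bc_l lam b / bc_m b = mu0)) ->
  exists (L : 'I_3 -> set Y) (r0 r1 : 'I_3),
  [/\ [/\ forall r, smooth_rational_curve (L r),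
          forall r, L r `<=` fibre_over (Some mu),
          forall r t, L r `&` (j @^-1` L t) = set0 &
          forall r t, r != t -> exists p, L r `&` L t = [set p] /\
            transversal_at (L r) (L t) p],
      forall r, r != r0 -> zero_section o `&` L r = set0,
      exists p, zero_section o `&` L r0 = [set p] /\
        transversal_at (zero_section o) (L r0) p,
      forall r, r != r1 -> L r `&` (j @^-1` zero_section o) = set0 &
      (r0 != r1 <-> mu = mu0)].
Proof.
move=> mu3 hmu0; pose t := sqrtC (mu - lam); pose b := row2 1 t.
have t2 : t ^+ 2 = mu - lam := sqrtCK _.
have t0 : t != 0.
  apply: contra_neq lam3 => t0; move: t2; rewrite t0 expr0n /= => /esym/eqP.
  by rewrite subr_eq0 => /eqP <-.
have s0 : b 0 0 != 0 by rewrite row2_0 oner_neq0.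
have b0 : b != 0 by rewrite row2_neq0 oner_neq0.
have mb : bc_m b = 1 by rewrite /bc_m row2_0 expr1n.
have lb : bc_l lam b = mu by rewrite /bc_l row2_0 row2_1 t2; ring.
have m0 : bc_m b != 0 by rewrite mb oner_neq0.
have l3 : (bc_l lam b / bc_m b) ^+ 3 = -1 by rewrite mb lb divr1.
have [V [N [e [VN e0 fE V0]]]] := I3_triangle m0 l3.
have sd : deck b 0 0 != 0 by rewrite deckE row2_0.
have fE' a : bc_fibre lam (deck b) a = e * \prod_r (a *m N) 0 r.
  by rewrite bc_fibre_deck.
pose C : 'I_3 -> set Y := tri_line V N b.
pose C' : 'I_3 -> set Y := tri_line V N (deck b).
have CP r y a c : lies_over y a c -> C r y <-> prop b c /\ a *m col r N = 0.
  exact: (tri_lineP VN s0 fE).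
have CP' r y a c : lies_over y a c -> C' r y <-> prop (deck b) c /\ a *m col r N = 0.
  exact: (tri_lineP VN sd fE').
have cov y a c : lies_over y a c -> prop b c -> exists r, C r y.
  exact: (tri_line_cover VN s0 e0 fE).
have cov' y a c : lies_over y a c -> prop (deck b) c -> exists r, C' r y.
  exact: (tri_line_cover VN sd e0 fE').
have nbb : ~ prop (deck b) b.
  move=> [k _ E]; have E0 := congr1 (fun x : 'rV[K]_2 => x 0 0) E.
  have E1 := congr1 (fun x : 'rV[K]_2 => x 0 1) E.
  rewrite /= scale_coord deckE !row2_0 mulr1 in E0.
  rewrite /= scale_coord deckE !row2_1 -E0 mul1r in E1.
  have : t *+ 2 = 0 by rewrite mulr2n {1}E1 addNr.
  by move/eqP; rewrite mulrn_eq0 (negPf t0).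
have swap := @component_swap _ C C'
  (fun r => cd_closed (tri_line_data VN s0 fE r))
  (fun r => cd_closed (tri_line_data VN sd fE' r))
  (fun r => rational_image_of_data (tri_line_data VN s0 fE r))
  (fun r => rational_image_of_data (tri_line_data VN sd fE' r)).
have {}swap r : exists k, (forall y, C r y -> C' k (j y)) /\
                          (forall y, C' k y -> C r (j y)).
  apply: swap => [{}r y|{}r y|].
  - have [a [c yac]] := lies_over_ex y; have [a' [c' jac]] := lies_over_ex (j y).
    move=> /(CP _ _ _ _ yac)[h _]; apply: (cov' _ _ _ jac).
    exact: prop_trans (prop_deck h) (lies_over_j yac jac).
  - have [a [c yac]] := lies_over_ex y; have [a' [c' jac]] := lies_over_ex (j y).
    move=> /(CP' _ _ _ _ yac)[h _]; apply: (cov _ _ _ jac).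
    rewrite -[b]deckK; exact: prop_trans (prop_deck h) (lies_over_j yac jac).
  - exact: (tri_line_incl VN s0 fE).
have [v vb] := P1_pt b0; have [v' vb'] := P1_pt (deck_neq0 b0).
have [sigma [hs _]] := section_ex bo.
have y0o := hs _ _ vb; have [r0 C0] := cov _ _ _ y0o (prop_refl b).
have [_ or0] := (CP _ _ _ _ y0o).1 C0.
have [q Qq] := Q_ex vb; have [r1 C1] := cov _ _ _ Qq (prop_refl b).
have [_ qr1] := (CP _ _ _ _ Qq).1 C1.
have one_o r k : o *m col r N = 0 -> o *m col k N = 0 -> r = k.
  exact: (base_point_one_line VN V0 bo).
have jQ : lies_over (j (Q v)) o (deck b).
  have y1 := hs _ _ vb'; rewrite -(j_section y1 (v := v)) ?deckK // jK //.
(* [j] carries [Q v] to a point of O over the other fibre, where a base point lies on one side only;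
   the bijection of sides brings this back. *)
have one_q r k : C r (Q v) -> C k (Q v) -> r = k.
  move=> Cr Ck; have [r' [h1 h2]] := swap r; have [k' [h3 h4]] := swap k.
  have [_ e1] := (CP' _ _ _ _ jQ).1 (h1 _ Cr).
  have [_ e2] := (CP' _ _ _ _ jQ).1 (h3 _ Ck).
  apply: (tri_line_incl VN s0 fE) => y Cy.
  by rewrite -[y]jK; apply: h4; rewrite -(one_o _ _ e1 e2); exact: h1.
exists C, r0, r1; split.
- split.
  + by move=> r; exact: smooth_rational_of_data (tri_line_data VN s0 fE r).
  + move=> r y Cy a c yac; have [[k k0 ->] _] := (CP _ _ _ _ yac).1 Cy.
    rewrite /bc_m /bc_l !scale_coord -/(bc_m b).
    have -> : lam * (k * b 0 0) ^+ 2 + (k * b 0 1) ^+ 2 = k ^+ 2 * bc_l lam b.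
      by rewrite /bc_l; ring.
    by rewrite lb exprMn -/(bc_m b) mb mulr1 mulrC expf_neq0.
  + move=> r k; apply/seteqP; split=> // y [Cy Cjy].
    have [a [c yac]] := lies_over_ex y; have [a' [c' jac]] := lies_over_ex (j y).
    have [h1 _] := (CP _ _ _ _ yac).1 Cy; have [h2 _] := (CP _ _ _ _ jac).1 Cjy.
    apply: nbb; apply: prop_trans (prop_deck h1) _.
    exact: prop_trans (lies_over_j yac jac) (prop_sym h2).
  + by move=> r k rk; exact: (tri_lines_meet VN s0 fE rk).
- move=> r rr0; apply/seteqP; split=> // y [[c yoc] Cy].
  have [_ h] := (CP _ _ _ _ yoc).1 Cy.
  by move/eqP: rr0; apply; exact: one_o.
- exists (sigma v); split.
    apply/seteqP; split=> [y [[c yoc] Cy]|_ ->]; last by split => //; exists b.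
    have [h _] := (CP _ _ _ _ yoc).1 Cy; symmetry.
    apply: (lies_over_unique y0o yoc (prop_refl o) h); exact: node_gens_base.
  apply: (transversal_of_data (section_data lam bo)); first by exists b.
  move=> y w w' /[swap] yw /(_ _ yw)[h1 _ _] pw' _.
  have [h2 _ _] := C0 _ pw'; exact: prop_trans (prop_sym h2) h1.
(* A point of the side mapped by [j] into O must be [Q v], which lies on the side [r1] only. *)
- move=> r rr1; apply/seteqP; split=> // y [Cy [c jyc]].
  move/eqP: rr1; apply; apply: one_q (C1).
  have [a [d yad]] := lies_over_ex y; have [h _] := (CP _ _ _ _ yad).1 Cy.
  have cd : prop (deck c) b.
    rewrite -[b]deckK; apply: prop_deck; apply: prop_trans (prop_sym (lies_over_j yad jyc)) _.
    exact/prop_deck/prop_sym.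
  have [_ c0] := lies_over_neq0 jyc; have [u uc] := P1_pt (deck_neq0 c0).
  suff <- : y = Q v by [].
  rewrite -[y]jK (j_section jyc uc); congr Q.
  exact: coords_inj (coordsP1 uc cd) vb.
- have := hmu0 _ _ _ vb m0 l3 Qq; rewrite mb lb divr1 => <-.
  have sl := same_lineP VN e0 fE o q.
  split=> [r01 /sl[r [h1 h2]]|nsl].
    move/eqP: r01; apply; rewrite (one_o _ _ or0 h1).
    by apply: one_q C1; apply/(CP _ _ _ _ Qq); split => //; exact: prop_refl.
  apply/negP => /eqP r01; apply: nsl; apply/sl; exists r0; split => //.
  by rewrite r01.
Qed.

(** * Assembly of the nine curves *)

Lemma enriques_configuration :
  exists C : 'I_3 + 'I_3 * 'I_2 -> set (involution_quotient j),
    rational_configuration A3_3A2 C.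
Proof.
have [_ _ QO [k0 [ok0 _]] [mu0 [mu03 hmu0]]] := twQ.
have [w [w1 w3]] := cube_root_unity K.
have mu00 : mu0 != 0.
  apply/eqP => E; move/eqP: mu03; rewrite E expr0n /= eq_sym oppr_eq0.
  by rewrite oner_eq0.
have wn1 : w != 1.
  apply/eqP => E; move: w1; rewrite E expr1n => /eqP.
  have -> : 1 + 1 + 1 = 3%:R :> K by ring.
  by rewrite pnatr_eq0.
have w0 : w != 0.
  by apply/eqP => E; move/eqP: w3; rewrite E expr0n /= eq_sym oner_eq0.
have w2n1 : w ^+ 2 != 1.
  apply: contra_neq wn1 => E.
  by move: w3; rewrite exprS E mulr1.
(* The other two cube roots of -1, that is, the I_3 fibres where O and Q meet the same component. *)
pose mu1 := w * mu0; pose mu2 := w ^+ 2 * mu0.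
have mu13 : mu1 ^+ 3 = -1 by rewrite exprMn w3 mu03 mul1r.
have mu23 : mu2 ^+ 3 = -1 by rewrite exprMn -exprM (exprM w 3 2) w3 expr1n mu03 mul1r.
have n10 : mu1 != mu0 by rewrite -[X in _ != X]mul1r (inj_eq (mulIf mu00)).
have n20 : mu2 != mu0 by rewrite -[X in _ != X]mul1r (inj_eq (mulIf mu00)).
have n12 : mu1 != mu2.
  rewrite (inj_eq (mulIf mu00)) -[X in X != _]mulr1 expr2 (inj_eq (mulfI w0)).
  by rewrite eq_sym.
have emp (A B : set Y) y : A `&` B = set0 -> A y -> B y -> False.
  by move=> AB Ay By; have : set0 y by rewrite -AB.
pose O : set Y := zero_section o.
have dO := section_data lam bo.
have sO : smooth_rational_curve O := smooth_rational_of_data dO.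
have OjO : O `&` (j @^-1` O) = set0.
  apply/seteqP; split=> // y [[b yob] Ojy]; have [_ b0] := lies_over_neq0 yob.
  have [v vb] := P1_pt (deck_neq0 b0).
  by apply: (QO v); rewrite -(j_section yob vb).
have cOf (A : set Y) : smooth_rational_curve A -> closed_in A by case.
have dj_sym (A B : set Y) : A `&` (j @^-1` B) = set0 -> B `&` (j @^-1` A) = set0.
  move=> E; apply/seteqP; split=> // y [By Ajy].
  have : (A `&` (j @^-1` B)) (j y) by split => //=; rewrite jK.
  by rewrite E.
pose pi := quot_pi (fun y : Y => [set y; j y]) : Y -> involution_quotient j.
have pairY := @pair_charts_surfY K lam.
have disj (A B : set Y) : A `&` B = set0 -> A `&` (j @^-1` B) = set0 ->
    pi @` A `&` pi @` B = set0 by exact: disjoint_quot jK _ _.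
have meet (A B : set Y) : smooth_rational_curve A -> smooth_rational_curve B ->
    A `&` (j @^-1` A) = set0 -> B `&` (j @^-1` B) = set0 ->
    A `&` (j @^-1` B) = set0 ->
    (exists p, A `&` B = [set p] /\ transversal_at A B p) ->
    meet_once (pi @` A) (pi @` B).
  move=> [cA _] [cB _] h1 h2 h3 [p [E t]].
  exact: (meet_once_quot gY pairY mj jK cA cB h1 h2 h3 E t).
have [L0 [r0 [s0 [[sL0 fL0 jL0 mL0] oL0 moL0 qL0 e0]]]] := special_fibre mu03 hmu0.
have [L1 [r1 [s1 [[sL1 fL1 jL1 mL1] oL1 _ qL1 e1]]]] := special_fibre mu13 hmu0.
have [L2 [r2 [s2 [[sL2 fL2 jL2 mL2] oL2 _ qL2 e2]]]] := special_fibre mu23 hmu0.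
have rs0 : r0 != s0 by apply/e0.
have rs1 : s1 = r1.
  by apply/eqP/negPn/negP; rewrite eq_sym => /e1 E; rewrite E eqxx in n10.
have rs2 : s2 = r2.
  by apply/eqP/negPn/negP; rewrite eq_sym => /e2 E; rewrite E eqxx in n20.
have [n0 [nr0 ns0]] := neq3 r0 s0.
(* O meets the hexagon on the line x_k0 = 0; [lift k0] runs over the two remaining indices. *)
pose H i : set Y := hexa_line (lift k0 i).
pose E i : set Y := exc (lift k0 i).
have sH i : smooth_rational_curve (H i) := smooth_rational_of_data (hexa_line_data lam _).
have jHE i y : H i y -> E i (j y) by case: (j_hexa_line (lift k0 i)) => + _; exact.
have jEH i y : E i y -> H i (j y) by case: (j_hexa_line (lift k0 i)) => _; exact.
have fH i : H i `<=` fibre_over None.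
  move=> y Hy a b yab; have [c _ ->] := @hexC_binf (inl (lift k0 i)) _ _ _ yab Hy.
  by rewrite /bc_m scale_coord row2_0 mulr0 expr0n.
have jHH i : H i `&` (j @^-1` H i) = set0.
  apply/seteqP; split=> // y [Hy Hjy].
  exact: (emp _ _ _ (hexa_line_exc_same lam _) Hjy (jHE _ _ Hy)).
have OH i : O `&` H i = set0.
  apply/seteqP; split=> // y [[b [w' [yw oE _]]] /(hexa_lineP _ yw)[_ E0 _]].
  have := base_point_other_neq0 (k := lift k0 i) bo ok0.
  by rewrite -oE E0 eqxx eq_sym => /(_ (neq_lift _ _)).
have OjH i : O `&` (j @^-1` H i) = set0.
  apply/seteqP; split=> // y [[b yob] Hjy].
  have Ey : E i y by rewrite -[y]jK; exact: jHE.
  have [c c0 oE] := (excP _ yob).1 Ey.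
  have [_ o3 _] := bo; move/eqP: o3; rewrite oE (sum3_lift (lift k0 i)).
  have [d1 d2 d3] := delta3E (lift k0 i) K.
  rewrite !scale_coord d1 d2 d3 !mulr0 !expr0n /= !addr0 mulr1 expf_eq0 /=.
  by rewrite (negPf c0).
have mH i i' : i != i' -> meet_once (pi @` H i) (pi @` H i').
  move=> ii; have ll : lift k0 i != lift k0 i' by rewrite (inj_eq (@lift_inj _ k0)).
  (* Two lines of the hexagon are disjoint on Y. On S they meet because [H i'] has the same image as
     [E i'], which meets [H i] once. *)
  have piE : pi @` H i' = pi @` E i'.
    apply/seteqP; split=> _ [y Hy <-]; exists (j y); [exact: jHE| |exact: jEH|];
      by apply/quot_pi_eq => //; right; rewrite jK.
  rewrite piE; have [p [Ep t]] := hexa_line_exc_meet lam ll.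
  have cE : closed_in (E i') by exact: closed_exc.
  apply: (meet_once_quot gY pairY mj jK (cOf _ (sH i)) cE (jHH i) _ _ Ep t).
    apply/seteqP; split=> // y [Ey Ejy].
    exact: (emp _ _ _ (hexa_line_exc_same lam _) (jEH _ _ Ey) Ejy).
  apply/seteqP; split=> // y [Hy Ejy].
  exact: (emp _ _ _ (exc_disjoint lam ll) (jHE _ _ Hy) Ejy).
pose D (u : 'I_3 + 'I_3 * 'I_2) : set Y := match u with
  | inl i => if i == o0 then O else if i == o1 then L0 r0 else L0 n0
  | inr (k, i) => if k == o0 then H i else
                  if k == o1 then L1 (lift r1 i) else L2 (lift r2 i) end.
(* The value of lambda on each curve other than O; it settles all pairs of such curves in different
   fibres. *)
pose cl (u : 'I_3 + 'I_3 * 'I_2) := match u with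
  | inl i => Some mu0
  | inr (k, i) => if k == o0 then None else if k == o1 then Some mu1 else Some mu2 end.
have fD u : u != inl o0 -> D u `<=` fibre_over (cl u).
  case: u => [i|[k i]] /=; last by case: ifP => _ //; case: ifP.
  by move: i; apply: ord3P => //= _.
have cl_disj u u' : u != inl o0 -> u' != inl o0 -> cl u <> cl u' ->
    pi @` D u `&` pi @` D u' = set0.
  move=> un un' ne; have [h1 h2] := fibre_over_disjoint ne (fD _ un) (fD _ un').
  exact: disj.
have OD k i : pi @` O `&` pi @` D (inr (k, i)) = set0.
  apply: disj; move: k; apply: ord3P => /=.
  - exact: OH.
  - by apply: oL1; rewrite eq_sym neq_lift.
  - by apply: oL2; rewrite eq_sym neq_lift.
  - exact: OjH.
  - by apply: dj_sym; apply: qL1; rewrite rs1 eq_sym neq_lift.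
  - by apply: dj_sym; apply: qL2; rewrite rs2 eq_sym neq_lift.
have ok01 : meet_once (pi @` O) (pi @` L0 r0).
  by apply: meet => //; apply: dj_sym; exact: qL0.
have ok02 : pi @` O `&` pi @` L0 n0 = set0.
  by apply: disj; [exact: oL0|apply: dj_sym; exact: qL0].
have ok12 : meet_once (pi @` L0 r0) (pi @` L0 n0).
  by apply: meet => //; apply: mL0; rewrite eq_sym.
exists (fun u => pi @` D u); split.
  have sD u : smooth_rational_curve (D u) /\ D u `&` (j @^-1` D u) = set0.
    case: u => [|[+ i]]; apply: ord3P => //=; split => //.
  by move=> u; have [h1 h2] := sD u; exact: (smooth_rational_quot gY pairY mj jK h2 h1).
move=> [i|[k i]] [i'|[k' i']] ne.
- move: i i' ne; apply: ord3P; apply: ord3P => // _; rewrite /A3_3A2 /dynkinA /=.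
  + exact: meet_once_sym.
  + by rewrite setIC.
  + exact: meet_once_sym.
- move: i ne; apply: ord3P => _ /=; first exact: OD.
    by apply: (cl_disj (inl o1) (inr (k', i'))) => //=; move: k'; apply: ord3P => //=;
      [case=> E'; move/eqP: n10|case=> E'; move/eqP: n20]; rewrite E'.
  by apply: (cl_disj (inl o2) (inr (k', i'))) => //=; move: k'; apply: ord3P => //=;
      [case=> E'; move/eqP: n10|case=> E'; move/eqP: n20]; rewrite E'.
- rewrite setIC; move: i' ne; apply: ord3P => _ /=; first exact: OD.
    by apply: (cl_disj (inl o1) (inr (k, i))) => //=; move: k; apply: ord3P => //=;
      [case=> E'; move/eqP: n10|case=> E'; move/eqP: n20]; rewrite E'.
  by apply: (cl_disj (inl o2) (inr (k, i))) => //=; move: k; apply: ord3P => //=;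
      [case=> E'; move/eqP: n10|case=> E'; move/eqP: n20]; rewrite E'.
- rewrite /A3_3A2; have [kk|kk] := eqVneq k k'; last first.
    apply: cl_disj => //; move: k k' kk {ne}; apply: ord3P; apply: ord3P => //= _;
    by case=> E'; move/eqP: n12; rewrite E'.
  have ii : i != i' by apply: contra_neq ne => ->; rewrite kk.
  have -> : true && dynkinA i i' by move: i i' ii {ne}; apply: ord2P; apply: ord2P.
  rewrite -kk; move: k {kk ne}; apply: ord3P => /=.
  + exact: mH.
  + by apply: meet => //; apply: mL1; rewrite (inj_eq (@lift_inj _ r1)).
  + by apply: meet => //; apply: mL2; rewrite (inj_eq (@lift_inj _ r2)).
Qed.

End EnriquesInvolution.

Theorem proposition3p14 (R : realType) (o : 'rV[R[i]]_3)
    (Q : proj_space R[i] 1 -> surfY (5 / 4 : R[i]))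
    (j : surfY (5 / 4 : R[i]) -> surfY (5 / 4 : R[i])) :
  base_point o ->
  twist_section o Q ->
  translation_deck o Q j ->
  exists C : 'I_3 + 'I_3 * 'I_2 -> set (involution_quotient j),
    rational_configuration A3_3A2 C.
Proof.
apply: enriques_configuration.
(* The branch point 5/4 is not at an I_3 fibre: 64 ((5/4)^3 + 1) = 125 + 64. *)
have n0 : 4%:R ^+ 3 != 0 :> R[i] by rewrite expf_neq0 // pnatr_eq0.
rewrite -subr_eq0 opprK -(inj_eq (mulfI n0)) mulr0.
have -> : 4%:R ^+ 3 * ((5%:R / 4%:R) ^+ 3 + 1) = 189%:R :> R[i] by field.
by rewrite pnatr_eq0.
Qed.
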